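(* Let $W,X,Y,Z$ be manifolds with corners. (i) If $f:X\to Y$ and $g:Y\to Z$ are smooth then $g\circ f:X\to Z$ is smooth. (ii) The identity map $\mathrm{id}_X:X\to X$ is smooth. (iii) Diffeomorphisms $f:X\to Y$ (smooth maps with a smooth inverse) are equivalent to isomorphisms of smooth manifolds, that is, to homeomorphisms of topological spaces $f:X\to Y$ which identify the maximal atlases on $X$ and $Y$. (iv) The map $i_X:\partial X\to X$, $(x,\beta)\mapsto x$, is a smooth immersion. (v) If $f:W\to Y$ and $g:X\to Z$ are smooth, the product $f\times g:W\times X\to Y\times Z$ given by $(f\times g)(w,x)=(f(w),g(x))$ is smooth. (vi) If $f:X\to Y$ and $g:X\to Z$ are smooth, the direct product $(f,g):X\to Y\times Z$ given by $(f,g)(x)=(f(x),g(x))$ is smooth. (vii) Regarding the empty set $\emptyset$ as a manifold and the point $\{0\}$ as a $0$-manifold, the unique maps $\emptyset:\emptyset\to X$ and $\pi:X\to\{0\}$ are smooth.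
   Context: Manifolds with corners. For $0\le k\le n$ write $\mathbb{R}^n_k=[0,\infty)^k\times\mathbb{R}^{n-k}$. A continuous map $\alpha:A\to B$ with $A\subseteq\mathbb{R}^m$, $B\subseteq\mathbb{R}^n$ is smooth if it extends to a smooth map $A'\to\mathbb{R}^n$ on an open $A'\subseteq\mathbb{R}^m$ containing $A$; if $m=n$, it is a diffeomorphism if it is a homeomorphism and $\alpha,\alpha^{-1}$ are smooth. An $n$-manifold with corners $X$ is a paracompact Hausdorff space with a maximal atlas of pairwise compatible charts $(U,\phi)$, where $U\subseteq\mathbb{R}^n_k$ is open for some $0\le k\le n$ and $\phi:U\to X$ is a homeomorphism onto a nonempty open set; $(U,\phi),(V,\psi)$ are compatible if $\psi^{-1}\circ\phi:\phi^{-1}(\phi(U)\cap\psi(V))\to\psi^{-1}(\phi(U)\cap\psi(V))$ is a diffeomorphism. A function $h:X\to\mathbb{R}$ is smooth if $h\circ\phi$ is smooth for all charts. $T_xX$ is the $n$-dimensional space of derivations at $x$ of the algebra $C^\infty(X)$ of smooth functions. The product of manifolds with corners is a manifold with corners with charts the products of charts, via $\mathbb{R}^m_a\times\mathbb{R}^n_b\cong\mathbb{R}^{m+n}_{a+b}$. Boundary. If $(U,\phi)$ is a chart with $U\subseteq\mathbb{R}^n_k$ and $\phi(u)=x$, then $\mathrm{depth}_Xx$ is the number of $u_1,\ldots,u_k$ which are zero, and $S^k(X)=\{x\in X:\mathrm{depth}_Xx=k\}$. A local boundary component $\beta$ of $X$ at $x$ is a local choice of connected component of $S^1(X)$ near $x$: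 for each sufficiently small open neighbourhood $V$ of $x$ it gives a connected component $W$ of $V\cap S^1(X)$ with $x\in\overline W$, any two choices $(V,W),(V',W')$ satisfying $x\in\overline{W\cap W'}$. In a chart with $\phi(u)=x$ these correspond to the $i\le k$ with $u_i=0$ (written $\phi_*(\{x_i=0\})$). $\partial X=\{(x,\beta): x\in X$, $\beta$ a local boundary component of $X$ at $x\}$, with $i_X:\partial X\to X$, $(x,\beta)\mapsto x$. It is an $(n-1)$-manifold with corners ($\emptyset$ if $n=0$), with charts $(U_i,\phi_i)$ for each chart $(U,\phi)$ of $X$ with $U\subseteq\mathbb{R}^n_k$ and $i\le k$, where $U_i=\{(x_1,\ldots,x_{n-1})\in\mathbb{R}^{n-1}_{k-1}:(x_1,\ldots,x_{i-1},0,x_i,\ldots,x_{n-1})\in U\}$ and $\phi_i(x_1,\ldots,x_{n-1})=(\phi(x_1,\ldots,x_{i-1},0,x_i,\ldots,x_{n-1}),\phi_*(\{x_i=0\}))$. Boundary defining functions. A boundary defining function for $X$ at $(x,\beta)\in\partial X$ is a pair $(V,b)$, where $V$ is an open neighbourhood of $x$ in $X$ and $b:V\to[0,\infty)$ is smooth as a function $V\to\mathbb{R}$, with $\mathrm{d}b|_x\ne0$, such that there is an open neighbourhood $\tilde V$ of $(x,\beta)$ in $i_X^{-1}(V)$ with $b\circ i_X|_{\tilde V}\equiv0$ and $i_X|_{\tilde V}$ a homeomorphism from $\tilde V$ to an open subset of $\{x'\in V:b(x')=0\}$. Smooth maps. A continuous $f:X\to Y$ is weakly smooth if $\psi^{-1}\circ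 f\circ\phi:(f\circ\phi)^{-1}(\psi(V))\to V$ is smooth for all charts $(U,\phi)$ on $X$, $(V,\psi)$ on $Y$. It is smooth if in addition, whenever $x\in X$, $y=f(x)$, $\beta$ is a local boundary component of $Y$ at $y$ and $(V,b)$ is a boundary defining function for $Y$ at $(y,\beta)$, either $b\circ f\equiv0$ on an open neighbourhood of $x$ in $f^{-1}(V)$, or $(f^{-1}(V),b\circ f)$ is a boundary defining function for $X$ at $(x,\tilde\beta)$ for some unique local boundary component $\tilde\beta$ of $X$ at $x$. A smooth map $f$ is an immersion if $\mathrm{d}f|_x:T_xX\to T_{f(x)}Y$ is injective for all $x\in X$. *)

(* Defs.v *)
From HB Require Import structures.
From mathcomp Require Import all_boot all_order all_algebra.
From mathcomp Require Import all_classical all_reals all_analysis.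

Set Implicit Arguments.
Unset Strict Implicit.
Unset Printing Implicit Defensive.

Import Order.TTheory GRing.Theory Num.Theory.
Import numFieldNormedType.Exports.

Local Open Scope classical_set_scope.
Local Open Scope ring_scope.

Fixpoint Ck {R : realType} {E F : normedModType R} (k : nat) (A : set E)
    (f : E -> F) : Prop :=
  if k is k'.+1 then
    (forall x, A x -> differentiable f x) /\
    (forall v, Ck k' A (fun x => 'D_v f x))
  else forall x, A x -> {for x, continuous f}.

Definition Cinfty {R : realType} {E F : normedModType R} (A : set E)
  (f : E -> F) : Prop := forall k, Ck k A f.

(* Only the restriction of f to A matters. *)
Definition smooth_on {R : realType} {E F : normedModType R} (A : set E)
    (f : E -> F) : Prop :=
  {within A, continuous f} /\
  exists (A' : set E) (f' : E -> F),
    [/\ open A', A `<=` A', Cinfty A' f' & forall x, A x -> f' x = f x].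

Definition homeo_on {S T : topologicalType} (A : set S) (B : set T)
    (f : S -> T) : Prop :=
  [/\ set_bij A B f, {within A, continuous f} &
      exists g : T -> S, {in A, cancel f g} /\ {within B, continuous g}].

Definition diffeo_on {R : realType} {n : nat} (A B : set 'rV[R]_n)
    (f : 'rV[R]_n -> 'rV[R]_n) : Prop :=
  [/\ homeo_on A B f, smooth_on A f & smooth_on B ('pinv_(fun=> 0) A f)].

Definition rel_open {T : topologicalType} (S U : set T) : Prop :=
  exists2 O, open O & U = S `&` O.

(* R^n_k = [0, oo)^k x R^(n - k); coordinates are numbered from 0. *)
Definition orthant (R : realType) (n k : nat) : set 'rV[R]_n :=
  [set u | forall i : 'I_n, (i < k)%N -> 0 <= u 0 i].

(* A chart (U, phi) with U in R^n_k, together with the number k of corner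
   coordinates. The total function chart_map stands for its restriction to
   chart_dom. The same (U, phi) may occur with several values of k, but the
   extra coordinates are then nowhere 0 on U. *)
Record chart (R : realType) (n : nat) (T : Type) := Chart {
  corners : nat;
  chart_dom : set 'rV[R]_n;
  chart_map : 'rV[R]_n -> T }.

Section Charts.
Context {R : realType} {n : nat} {T : topologicalType}.
Implicit Types c d : chart R n T.

Definition chart_img c : set T := chart_map c @` chart_dom c.

Definition chart_inv c : T -> 'rV[R]_n :=
  'pinv_(fun=> 0) (chart_dom c) (chart_map c).

Definition is_chart c : Prop :=
  [/\ (corners c <= n)%N, rel_open (orthant (corners c)) (chart_dom c),
      homeo_on (chart_dom c) (chart_img c) (chart_map c),
      open (chart_img c) & chart_img c !=set0].

Definition compatible c d : Prop :=
  diffeo_on (chart_dom c `&` chart_map c @^-1` (chart_img c `&` chart_img d))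
            (chart_dom d `&` chart_map d @^-1` (chart_img c `&` chart_img d))
            (chart_inv d \o chart_map c).

(* When A is an atlas, the maximal atlas containing it. *)
Definition max_atlas (A : set (chart R n T)) : set (chart R n T) :=
  [set c | is_chart c /\ forall a, A a -> compatible c a].

End Charts.

(* The data of a space with charts in a fixed dimension. All the notions below
   make sense for such data; the axioms of a manifold are in is_mwc. *)
Record charted (R : realType) := Charted {
  dim : nat;
  carrier :> topologicalType;
  atlas : set (chart R dim carrier) }.
Arguments atlas {R} _ _.

Definition paracompact (T : topologicalType) : Prop :=
  forall C : set (set T),
    (forall A, C A -> open A) -> \bigcup_(A in C) A = setT ->
    exists D : set (set T),
      [/\ forall A, D A -> open A, \bigcup_(A in D) A = setT,
          forall A, D A -> exists2 B, C B & A `<=` B &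
          forall x : T, exists2 N, nbhs x N &
            finite_set [set A | D A /\ A `&` N !=set0]].

Definition is_mwc {R : realType} (X : charted R) : Prop :=
  [/\ hausdorff_space X, paracompact X,
      (forall c, atlas X c -> is_chart c) /\
      (forall c d, atlas X c -> atlas X d -> compatible c d),
      \bigcup_(c in atlas X) chart_img c = setT &
      max_atlas (atlas X) `<=` atlas X].

Record mwc (R : realType) := Mwc {
  mwc_charted :> charted R;
  mwcP : is_mwc mwc_charted }.

Section Functions.
Context {R : realType} (X : charted R).

(* The smooth functions on the open submanifold V of X; those on X are the
   case V = setT. Values outside V are irrelevant. *)
Definition smooth_fun (V : set X) (h : X -> R) : Prop :=
  forall c, atlas X c ->
    smooth_on (chart_dom c `&` chart_map c @^-1` V) (h \o chart_map c).

(* D represents an element of T_x V = T_x X. A tangent vector is the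
   restriction of D to smooth_fun V, regarded as functions on V; the first
   clause says that D is well defined on these. *)
Definition derivation (V : set X) (x : X) (D : (X -> R) -> R) : Prop :=
  [/\ forall a b, smooth_fun V a -> smooth_fun V b ->
        (forall y, V y -> a y = b y) -> D a = D b,
      forall (l : R) a b, smooth_fun V a -> smooth_fun V b ->
        D (fun y => l * a y + b y) = l * D a + D b &
      forall a b, smooth_fun V a -> smooth_fun V b ->
        D (fun y => a y * b y) = a x * D b + b x * D a].

Definition differential_neq0 (V : set X) (x : X) (b : X -> R) : Prop :=
  exists2 D, derivation V x D & D b <> 0.

Definition depth_stratum (d : nat) : set X :=
  [set x | exists (c : chart R (dim X) X) (u : 'rV[R]_(dim X)),
    [/\ atlas X c, chart_dom c u, chart_map c u = x &
        #|[set i : 'I_(dim X) | (i < corners c)%N && (u 0 i == 0)]%SET| = d]].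

Definition is_component {T : topologicalType} (A W : set T) : Prop :=
  exists2 y, A y & W = connected_component A y.

Definition small_nbhd (x : X) (V0 V : set X) : Prop :=
  [/\ open V, V x & V `<=` V0].

Definition component_choice (x : X) (w : set X -> set X) : Prop :=
  exists V0, [/\ open V0, V0 x,
    forall V, small_nbhd x V0 V ->
      is_component (V `&` depth_stratum 1) (w V) /\ closure (w V) x &
    forall V V', small_nbhd x V0 V -> small_nbhd x V0 V' ->
      closure (w V `&` w V') x].

Definition same_germ (x : X) (w w' : set X -> set X) : Prop :=
  exists V0, [/\ open V0, V0 x & forall V, small_nbhd x V0 V -> w V = w' V].

(* A local boundary component is a choice of components "for each sufficiently
   small V", that is, a class of choices up to agreement on small V. *)
Definition local_bdry_comp (x : X) (beta : set (set X -> set X)) : Prop :=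
  exists2 w, component_choice x w &
    beta = [set w' | component_choice x w' /\ same_germ x w w'].

Record bdry := Bdry {
  bdry_pt : X;
  bdry_comp : set (set X -> set X);
  bdryP : local_bdry_comp bdry_pt bdry_comp }.

(* beta = phi_*({x_i = 0}) at x = phi u: near x, the component of S^1(X)
   selected by beta lies in the hypersurface x_i = 0 of the chart. *)
Definition face_comp (c : chart R (dim X) X) (i : 'I_(dim X))
    (u : 'rV[R]_(dim X)) (beta : set (set X -> set X)) : Prop :=
  local_bdry_comp (chart_map c u) beta /\
  exists2 w, beta w & exists V0,
    [/\ open V0, V0 (chart_map c u) &
        forall V, small_nbhd (chart_map c u) V0 V ->
          w V `<=` chart_map c @` (chart_dom c `&` [set v | v 0 i = 0])].

Definition insert0 {n : nat} (i : 'I_n) (v : 'rV[R]_n.-1) : 'rV[R]_n :=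
  \row_j (if unlift i j is Some j' then v 0 j' else 0).

(* c' = (U_i, phi_i) for some chart (U, phi) of X and some corner index i. *)
Definition bdry_chart (c' : chart R (dim X).-1 bdry) : Prop :=
  exists (c : chart R (dim X) X) (i : 'I_(dim X)),
    [/\ atlas X c, (i < corners c)%N,
        corners c' = (corners c).-1,
        chart_dom c' = [set v | chart_dom c (insert0 i v)] /\
        chart_dom c' !=set0 &
        forall v, chart_dom c' v ->
          bdry_pt (chart_map c' v) = chart_map c (insert0 i v) /\
          face_comp c i (insert0 i v) (bdry_comp (chart_map c' v))].

(* The topology of the boundary is the one determined by its charts. *)
Definition bdry_open (A : set bdry) : Prop :=
  forall c', bdry_chart c' ->
    rel_open (chart_dom c') (chart_dom c' `&` chart_map c' @^-1` A).

Lemma bdry_openT : bdry_open setT.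
Proof. by move=> c _; exists setT; [exact: openT | rewrite preimage_setT]. Qed.

Lemma bdry_openI : setI_closed bdry_open.
Proof.
move=> A B oA oB c cX; have [G oG eG] := oA c cX; have [P oP eP] := oB c cX.
exists (G `&` P); first exact: openI.
by rewrite preimage_setI -(setIid (chart_dom c)) setIACA eG eP setIACA.
Qed.

Lemma bdry_open_bigU (I : Type) (F : I -> set bdry) :
  (forall i, bdry_open (F i)) -> bdry_open (\bigcup_i F i).
Proof.
move=> oF c cX.
have /choice [G HG] : forall i, exists O, open O /\
    chart_dom c `&` chart_map c @^-1` F i = chart_dom c `&` O.
  by move=> i; have [G ? ?] := oF i c cX; exists G.
exists (\bigcup_i G i); first by apply: bigcup_open => i _; case: (HG i).
rewrite preimage_bigcup !setI_bigcupr; apply: eq_bigcupr => i _.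
by case: (HG i).
Qed.

HB.instance Definition _ := gen_eqMixin bdry.
HB.instance Definition _ := gen_choiceMixin bdry.
HB.instance Definition _ :=
  isOpenTopological.Build bdry bdry_openT bdry_openI bdry_open_bigU.

(* In dimension 0 there are no indices i, and the boundary is empty. *)
Definition boundary : charted R :=
  @Charted R (dim X).-1 bdry (max_atlas bdry_chart).

Definition bdry_def_fun (p : bdry) (V : set X) (b : X -> R) : Prop :=
  [/\ open V /\ V (bdry_pt p),
      (forall x, V x -> 0 <= b x) /\ smooth_fun V b,
      differential_neq0 V (bdry_pt p) b &
      exists V' : set bdry,
        [/\ open V', V' p, V' `<=` bdry_pt @^-1` V,
            forall q, V' q -> b (bdry_pt q) = 0 &
            exists2 O, rel_open (V `&` [set x | b x = 0]) O &
              homeo_on V' O bdry_pt]].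

End Functions.

Section Maps.
Context {R : realType}.
Implicit Types X Y : charted R.

Definition weakly_smooth X Y (f : X -> Y) : Prop :=
  continuous f /\
  forall c d, atlas X c -> atlas Y d ->
    smooth_on (chart_dom c `&` (f \o chart_map c) @^-1` chart_img d)
              (chart_inv d \o f \o chart_map c).

Definition smooth_map X Y (f : X -> Y) : Prop :=
  weakly_smooth f /\
  forall (x : X) (p : bdry Y) (V : set Y) (b : Y -> R),
    bdry_pt p = f x -> bdry_def_fun p V b ->
    (exists N, [/\ open N, N x, N `<=` f @^-1` V &
                   forall x', N x' -> b (f x') = 0]) \/
    (exists! q : bdry X, bdry_pt q = x /\ bdry_def_fun q (f @^-1` V) (b \o f)).

(* df|_x sends the derivation D to h |-> D (h \o f). *)
Definition injective_differential X Y (f : X -> Y) (x : X) : Prop :=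
  forall D D', derivation setT x D -> derivation setT x D' ->
    (forall h, smooth_fun setT h -> D (h \o f) = D' (h \o f)) ->
    forall a, smooth_fun setT a -> D a = D' a.

Definition immersion X Y (f : X -> Y) : Prop :=
  smooth_map f /\ forall x, injective_differential f x.

Definition diffeomorphism X Y (f : X -> Y) : Prop :=
  smooth_map f /\
  exists g : Y -> X, [/\ cancel f g, cancel g f & smooth_map g].

(* Tagging charts with their dimension allows atlases of manifolds with a
   priori different dimensions to be compared. *)
Definition tagged_atlas X : set {n & chart R n X} :=
  [set existT (fun n => chart R n X) (dim X) c | c in atlas X].
Arguments tagged_atlas : clear implicits.

Definition push_chart X Y (f : X -> Y) (c : {n & chart R n X}) :
    {n & chart R n Y} :=
  existT (fun n => chart R n Y) (projT1 c)
    (Chart (corners (projT2 c)) (chart_dom (projT2 c))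
           (f \o chart_map (projT2 c))).

Definition manifold_iso X Y (f : X -> Y) : Prop :=
  homeo_on setT setT f /\
  push_chart f @` tagged_atlas X = tagged_atlas Y.

End Maps.

Section Constructions.
Context {R : realType}.

Definition coord {n : nat} (w : 'rV[R]_n) (i : nat) : R :=
  if insub i is Some i' then w 0 i' else 0.

(* The identification of R^m_a x R^n_b with R^(m + n)_(a + b) keeps the order
   of coordinates within each factor, but lists the a + b corner coordinates
   (those of the first factor, then those of the second) before the others. *)
Definition split_fst (m n a b : nat) (w : 'rV[R]_(m + n)) : 'rV[R]_m :=
  \row_(j < m) coord w (if (j < a)%N then j : nat else (b + j)%N).

Definition split_snd (m n a b : nat) (w : 'rV[R]_(m + n)) : 'rV[R]_n :=
  \row_(j < n) coord w (if (j < b)%N then (a + j)%N else (m + j)%N).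

Definition prod_chart {m n : nat} {S T : Type} (c : chart R m S)
    (d : chart R n T) : chart R (m + n) (S * T) :=
  let fst' := split_fst (corners c) (corners d) in
  let snd' := split_snd (corners c) (corners d) in
  Chart (corners c + corners d)%N
    [set w | chart_dom c (fst' w) /\ chart_dom d (snd' w)]
    (fun w => (chart_map c (fst' w), chart_map d (snd' w))).

Definition product (X Y : charted R) : charted R :=
  @Charted R (dim X + dim Y) (X * Y)%type
    (max_atlas [set e | exists c d,
       [/\ atlas X c, atlas Y d & e = prod_chart c d]]).

Lemma void_openI : setI_closed (@setT (set void)).
Proof. by []. Qed.

HB.instance Definition _ :=
  isOpenTopological.Build void (I : @setT (set void) setT) void_openI
    (fun _ _ _ => I).

(* The empty set is a manifold of any dimension. *)
Definition empty_manifold (n : nat) : charted R := @Charted R n void set0.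

(* The point {0} = R^0. *)
Definition point_manifold : charted R :=
  @Charted R 0 'rV[R]_0 (max_atlas [set Chart 0%N setT id]).

End Constructions.

(* Main.v *)
From HB Require Import structures.
Require Import Defs.
From mathcomp Require Import all_boot all_order all_algebra.
From mathcomp Require Import all_classical all_reals all_analysis.
From mathcomp Require Import ring lra zify.

(* Smoothness of a map defined on a subset is a local condition, because local
   extensions are glued by the functions chi_i * prod_(j < i) (1 - chi_j), where the
   chi_i are bump functions.  Transition maps preserve tangent cones, so in every
   chart the depth-one stratum consists of the points with exactly one vanishing
   corner coordinate, and the local boundary components at phi u correspond to the
   i <= k with u_i = 0.  By Hadamard's lemma, a boundary defining function is, in a
   chart, x_i times a positive function.  Hence a continuous map is smooth iff, in
   charts, it has smooth components and each corner coordinate that vanishes at the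
   image point is, nearby, either identically 0 or some x_i times a positive
   function; this condition needs to be tested in one pair of charts only, and it is
   stable under composition, products and pairing.  The map i_X is an immersion
   because functions on the boundary extend locally to X: extend them in a chart
   constantly along x_i and multiply by a cut-off. *)

Set Implicit Arguments.
Unset Strict Implicit.
Unset Printing Implicit Defensive.

Import Order.TTheory GRing.Theory Num.Theory.
Import numFieldNormedType.Exports.

Local Open Scope classical_set_scope.
Local Open Scope ring_scope.

(* Both names are shadowed by vector.v. *)
Local Notation dim := Defs.dim.
Local Notation coord := Defs.coord.

(** * Calculus of C^k functions *)

Section Calculus.
Context {R : realType}.
Implicit Types E F : normedModType R.

Lemma diff_of_linear_approx E F (f : E -> F) (x : E)
    (L : {linear E -> F}) :
  continuous L ->
  (forall e, 0 < e ->
     \forall h \near 0, `|f (h + x) - f x - L h| <= e * `|h|) ->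
  differentiable f x /\ 'd f x = L :> (E -> F).
Proof.
move=> cL H.
have fE : f \o shift x = cst (f x) + (L : E -> F) +o_ 0 id.
  apply/eqaddoP => e e0; apply: filterS (H _ e0) => h.
  by rewrite /= !fctE /= opprD addrA.
have dfE := diff_unique cL fE; split=> //.
by apply/diff_locallyP; rewrite dfE.
Qed.

Lemma near_eq_differentiable E F (f g : E -> F) x :
  (\forall y \near x, f y = g y) -> differentiable f x -> differentiable g x.
Proof.
move=> fg df; apply: (proj1 (@diff_of_linear_approx _ _ g x ('d f x) _ _)).
  exact: diff_continuous.
move=> e e0; have /diff_locally /eqaddoP /(_ _ e0) H := df.
have : (fun h : E => h + x) @ 0 --> x.
  rewrite -[X in _ --> X]add0r; apply: cvgD; [exact: cvg_id|exact: cvg_cst].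
move=> /(_ _ fg); apply: filterS2 H => h.
by rewrite /= !fctE /= opprD addrA => + <-; rewrite -(nbhs_singleton fg).
Qed.

Lemma Ck_sub E F k (A B : set E) (f : E -> F) : B `<=` A -> Ck k A f -> Ck k B f.
Proof.
elim: k f => [|k IH] f BA /=; first by move=> + x /BA; apply.
move=> [df Df]; split; first by move=> x /BA; exact: df.
by move=> v; apply: IH.
Qed.

Lemma near_open (T : topologicalType) (A : set T) x (P : T -> Prop) :
  open A -> A x -> (forall y, A y -> P y) -> \forall y \near x, P y.
Proof.
move=> oA Ax AP; have := open_nbhs_nbhs (conj oA Ax).
by apply: filterS.
Qed.

Lemma near_openE (T : topologicalType) x (P : T -> Prop) :
  (\forall y \near x, P y) -> exists A, [/\ open A, A x & forall y, A y -> P y].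
Proof.
move=> H; have : nbhs x P by exact: H.
by rewrite nbhsE => -[A [oA Ax] AP]; exists A.
Qed.

Lemma open_forall (T : topologicalType) (I : finType) (A : I -> set T) :
  (forall i, open (A i)) -> open [set x | forall i, A i x].
Proof.
move=> oA; rewrite openE => x Ax.
apply: (@filter_forall _ _ A (nbhs x) (nbhs_filter x)) => i.
exact: open_nbhs_nbhs.
Qed.

Lemma Ck_eq E F k (A : set E) (f g : E -> F) : open A ->
  (forall x, A x -> f x = g x) -> Ck k A f -> Ck k A g.
Proof.
move=> oA; elim: k f g => [|k IH] f g fg /=.
  move=> cf x Ax; have := cf x Ax.
  rewrite /prop_for /continuous_at -(fg x Ax) => H.
  apply: cvg_trans H; apply: near_eq_cvg; apply: near_open oA Ax _ => y Ay.
  by rewrite fg.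
move=> [df Df]; split => [x Ax|v].
  apply: near_eq_differentiable (df _ Ax).
  exact: near_open oA Ax _.
apply: IH (Df v) => x Ax; apply: near_eq_derive.
exact: near_open oA Ax _.
Qed.

Lemma CkS E F k (A : set E) (f : E -> F) : Ck k.+1 A f -> Ck k A f.
Proof.
elim: k f => [|k IH] f /= [df Df].
  by move=> x Ax; apply: differentiable_continuous; exact: df.
by split=> // v; apply: IH.
Qed.

Lemma Ck_cst E F k (A : set E) (a : F) : Ck k A (cst a).
Proof.
elim: k a => [|k IH] a /=.
  by move=> x _; exact: cst_continuous.
split=> [x _|v]; first exact: differentiable_cst.
rewrite (_ : (fun _ => _) = cst 0) //; apply/funext => x.
by rewrite derive_cst.
Qed.

Lemma Ck_add E F k (A : set E) (f g : E -> F) : open A ->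
  Ck k A f -> Ck k A g -> Ck k A (fun x => f x + g x).
Proof.
move=> oA; elim: k f g => [|k IH] f g /=.
  by move=> cf cg x Ax; apply: continuousD; [exact: cf|exact: cg].
move=> [df Df] [dg Dg]; split=> [x Ax|v].
  by apply: differentiableD; [exact: df|exact: dg].
apply: (Ck_eq oA _ (IH _ _ (Df v) (Dg v))) => x Ax.
by rewrite [RHS]deriveD //; apply: diff_derivable; [exact: df|exact: dg].
Qed.

Lemma Ck_mul E k (A : set E) (f g : E -> R) : open A ->
  Ck k A f -> Ck k A g -> Ck k A (fun x => f x * g x).
Proof.
move=> oA; elim: k f g => [|k IH] f g.
  by move=> cf cg x Ax; apply: continuousM; [exact: cf|exact: cg].
move=> fk gk; have [df Df] := fk; have [dg Dg] := gk; split=> [x Ax|v].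
  by apply: differentiableM; [exact: df|exact: dg].
have H := Ck_add oA (IH _ _ (CkS fk) (Dg v)) (IH _ _ (CkS gk) (Df v)).
apply: (Ck_eq oA _ H) => x Ax.
by rewrite [RHS]deriveM //; apply: diff_derivable; [exact: df|exact: dg].
Qed.

Lemma Ck_inv E k (A : set E) (f : E -> R) : open A ->
  (forall x, A x -> f x != 0) -> Ck k A f -> Ck k A (fun x => (f x)^-1).
Proof.
move=> oA f0; elim: k => [|k IH].
  by move=> cf x Ax; apply: continuousV; [exact: f0|exact: cf].
move=> fk; have [df Df] := fk; have Hk := IH (CkS fk); split=> [x Ax|v].
  by apply: differentiableV; [exact: df|exact: f0].
have H := Ck_mul oA (Ck_mul oA (@Ck_cst E R k A (-1)) (Ck_mul oA Hk Hk)) (Df v).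
apply: (Ck_eq oA _ H) => x Ax.
rewrite [RHS]deriveV ?f0 //; last by apply: diff_derivable; exact: df.
by rewrite /= mulN1r -exprVn expr2.
Qed.

Lemma Ck_sum E k (A : set E) n (f : 'I_n -> E -> R) : open A ->
  (forall i, Ck k A (f i)) -> Ck k A (fun x => \sum_i f i x).
Proof.
move=> oA fk; elim: n f fk => [|n IH] f fk.
  by rewrite (_ : (fun _ => _) = cst 0); [exact: Ck_cst|apply/funext=> x; rewrite big_ord0].
rewrite (_ : (fun _ => _) = (fun x => \sum_(i < n) f (widen_ord (leqnSn n) i) x + f ord_max x)).
  by apply: Ck_add => //; apply: IH.
by apply/funext => x; rewrite big_ord_recr.
Qed.

Lemma derive_coord n (F : 'rV[R]_n) (v : 'rV[R]_n) j :
  'D_v (fun x : 'rV[R]_n => x 0 j) F = v 0 j.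
Proof.
have did : derivable (fun x : 'rV[R]_n => x) F v by apply: derivable_id.
by have := derive_mx did; rewrite derive_id => /matrixP /(_ 0 j); rewrite !mxE.
Qed.

Lemma Ck_coord n k (A : set 'rV[R]_n) j : Ck k A (fun x : 'rV[R]_n => x 0 j).
Proof.
case: k => [|k]; first by move=> x Ax; exact: coord_continuous.
split=> [x _|v]; first exact: differentiable_coord.
rewrite (_ : (fun _ => _) = cst (v 0 j)); first exact: Ck_cst.
by apply/funext => x; rewrite derive_coord.
Qed.

Lemma derive_comp E n (f : E -> 'rV[R]_n) (g : 'rV[R]_n -> R) x v :
  differentiable f x -> differentiable g (f x) ->
  'D_v (fun y => g (f y)) x =
  \sum_i 'D_v (fun y => f y 0 i) x * 'D_(delta_mx 0 i) g (f x).
Proof.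
move=> df dg; have := @deriveE R E R (g \o f) x v (differentiable_comp df dg).
rewrite /comp => ->; rewrite diff_comp //= -(@deriveE _ _ _ f) //.
rewrite [in LHS](row_sum_delta ('D_v f x)) linear_sum; apply: eq_bigr => i _.
rewrite linearZ /= -deriveE // derive_mx; last exact: diff_derivable.
by rewrite mxE.
Qed.

Lemma differentiable_rV E n (f : E -> 'rV[R]_n) x :
  (forall i, differentiable (fun y => f y 0 i) x) -> differentiable f x.
Proof.
move=> df.
rewrite (_ : f = \sum_(i < n) (fun y => f y 0 i *: delta_mx 0 i)).
  by apply: differentiable_sum => i; exact: differentiableZl.
apply/funext => y; rewrite [LHS]row_sum_delta.
by elim/big_rec2: _ => // i a b _ ->.
Qed.

Lemma Ck_rV E n k (A : set E) (f : E -> 'rV[R]_n) : open A ->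
  (forall i, Ck k A (fun x => f x 0 i)) <-> Ck k A f.
Proof.
move=> oA; elim: k f => [|k IH] f.
  split => [cf x Ax|cf i x Ax]; last first.
    by apply: (@continuous_comp _ _ _ f (fun y : 'rV[R]_n => y 0 i));
      [exact: cf|exact: coord_continuous].
  apply/cvgrPdist_le => /= e e0; near=> y.
  rewrite /Num.Def.normr/= mx_normrE (bigmax_le _ (ltW e0))//= => -[i j] _.
  rewrite !mxE/= ord1; move: j {i}; near: y; apply: filter_forall => j.
  by have /cvgrPdist_le/(_ e e0) := cf j x Ax.
split=> [fk|[df Df] i].
  have df x : A x -> differentiable f x.
    by move=> Ax; apply: differentiable_rV => i; have [+ _] := fk i; apply.
  split=> // v; apply/IH => i.
  have [_ Di] := fk i; apply: (Ck_eq oA _ (Di v)) => x Ax.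
  by rewrite derive_mx ?mxE//; apply: diff_derivable; exact: df.
split=> [x Ax|v].
  apply: (@differentiable_comp _ _ _ _ f (fun y : 'rV[R]_n => y 0 i));
   [exact: df|exact: differentiable_coord].
have /IH /(_ i) := Df v; apply: Ck_eq => // x Ax.
by rewrite derive_mx ?mxE//; apply: diff_derivable; exact: df.
Unshelve. all: by end_near. Qed.

Lemma Ck_comp E n k (A : set E) (B : set 'rV[R]_n) (f : E -> 'rV[R]_n)
    (g : 'rV[R]_n -> R) : open A -> (forall x, A x -> B (f x)) ->
  Ck k A f -> Ck k B g -> Ck k A (fun x => g (f x)).
Proof.
move=> oA AB; elim: k g => [|k IH] g.
  by move=> cf cg x Ax; apply: (@continuous_comp _ _ _ f g);
    [exact: cf|exact: cg (AB _ Ax)].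
move=> fk gk; have [df Df] := fk; have [dg Dg] := gk; split=> [x Ax|v].
  by apply: (@differentiable_comp _ _ _ _ f g); [exact: df|exact: dg (AB _ Ax)].
have H : Ck k A (fun x => \sum_i 'D_v (fun y => f y 0 i) x *
    'D_(delta_mx 0 i) g (f x)).
  apply: Ck_sum => // i; apply: Ck_mul => //.
    by have /(Ck_rV _ _ oA) /(_ i) [_] := fk; apply.
  exact: IH (CkS fk) (Dg _).
apply: (Ck_eq oA _ H) => x Ax.
by rewrite derive_comp //; [exact: df|exact: dg (AB _ Ax)].
Qed.

End Calculus.

(** * Bump functions *)

Section Bump.
Context {R : realType}.

Definition flat (p : {poly R}) (t : R) : R :=
  if 0 < t then p.[t^-1] * expR (- t^-1) else 0.

Lemma exprn_le_expR m (s : R) : 0 <= s -> s ^+ m <= m%:R ^+ m * expR s.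
Proof.
case: m => [|m] s0; first by rewrite !expr0 mul1r -expR0 ler_expR.
have m0 : 0 < m.+1%:R :> R by [].
have -> : expR s = expR (s / m.+1%:R) ^+ m.+1.
  by rewrite -expRM_natl mulrCA divff ?mulr1 // gt_eqF.
rewrite -exprMn lerXn2r ?nnegrE ?mulr_ge0 ?expR_ge0 //.
rewrite -ler_pdivrMl // mulrC (le_trans _ (expR_ge1Dx _)) //.
by rewrite lerDr ler01.
Qed.

Lemma flat_le (p : {poly R}) :
  exists2 C, 0 < C & forall t, `|flat p t| <= C * `|t| ^+ 2.
Proof.
pose C := \sum_(i < size p) `|p`_i| * (i.+2%:R ^+ i.+2).
have C0 : 0 <= C by apply: sumr_ge0 => i _; rewrite mulr_ge0 // exprn_ge0.
exists (C + 1); first by rewrite ltr_wpDl.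
move=> t; rewrite /flat; case: ltP => t0; last first.
  by rewrite normr0 mulr_ge0 ?exprn_ge0 // addr_ge0.
have s0 : 0 < t^-1 by rewrite invr_gt0.
rewrite normrM (ger0_norm (expR_ge0 _)) (gtr0_norm t0).
rewrite -[t in leRHS]invrK; set s := t^-1 in s0 *.
rewrite exprVn -ler_pdivrMr ?invr_gt0 ?exprn_gt0 // invrK expRN.
rewrite mulrAC ler_pdivrMr ?expR_gt0 // horner_coef.
apply: (@le_trans _ _ (C * expR s)); last first.
  by rewrite ler_pM2r ?expR_gt0 // lerDl.
rewrite -ler_pdivlMr ?exprn_gt0 //.
apply: le_trans (ler_norm_sum _ _ _) _.
rewrite /C -mulrA mulr_suml; apply: ler_sum => i _.
rewrite normrM -mulrA ler_wpM2l // normrX (gtr0_norm s0) mulrA.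
by rewrite ler_pdivlMr ?exprn_gt0 // -exprD addn2 exprn_le_expR // ltW.
Qed.

Lemma is_derive_flat (p : {poly R}) (t : R) :
  is_derive t (1 : R) (flat p : R -> R) (flat ('X^2 * (p - p^`())) t).
Proof.
have [t0|t0|t0] := ltgtP t 0.
- have -> : flat ('X^2 * (p - p^`())) t = 0 by rewrite /flat ltNge ltW.
  apply: (@near_eq_is_derive _ _ _ (cst (0:R)) _ _ _ 0).
  near=> y; rewrite /flat ltNge ltW //=; near: y.
  exact: lt_nbhsl.
- apply: (@near_eq_is_derive _ _ _
    ((horner p \o (fun y => y^-1)) * (expR \o (fun y => - y^-1)))).
    near=> y; rewrite /flat ifT //; near: y.
    exact: lt_nbhsr.
  have tn0 : t != 0 by rewrite gt_eqF.
  have dinv : is_derive t 1 (fun y : R => y^-1) (- t ^- 2).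
    by apply: is_derive_eq; [apply: is_deriveV => //; exact: is_derive_id|
      rewrite /= [_ *: _]mulr1].
  have dV : is_derive t 1 (fun y : R => - y^-1) (t ^- 2).
    by apply: is_derive_eq; rewrite opprK.
  have H1 : is_derive t 1 (horner p \o (fun y : R => y^-1)) (p^`().[t^-1] * - t ^- 2).
    exact: is_derive1_comp.
  have H2 : is_derive t 1 (expR \o (fun y : R => - y^-1)) (expR (- t^-1) * t ^- 2).
    exact: is_derive1_comp.
  apply: (is_derive_eq (is_deriveM H1 H2)).
  rewrite /flat t0 /= !hornerE /= ?exprVn; rewrite /GRing.scale /=.
  ring.
- rewrite t0; have -> : flat ('X^2 * (p - p^`())) 0 = 0 by rewrite /flat ltxx.
  have [C C0 HC] := flat_le p.
  have H : (fun h : R => h^-1 *: ((flat p \o shift (0:R)) (h *: (1:R)) - flat p 0)) @ 0^' --> (0:R).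
    apply/cvgrPdist_le => /= e e0; near=> h.
    rewrite sub0r normrN addr0 [h *: 1]mulr1 [X in _ - X](_ : _ = 0) ?subr0; last first.
      by rewrite /flat ltxx.
    rewrite [_ *: _]mulrC normrM normfV ler_pdivrMr; last first.
      by rewrite normr_gt0; near: h; exact: nbhs_dnbhs_neq.
    apply: le_trans (HC h) _.
    rewrite expr2 mulrA ler_wpM2r // mulrC -ler_pdivlMr //.
    by near: h; apply: dnbhs0_le; rewrite divr_gt0.
  apply: DeriveDef; first by apply/cvg_ex; exists 0.
  exact: (cvg_lim _ H).
Unshelve. all: by end_near. Qed.

Lemma derive_scale1 (f : R -> R) (x v : R) : differentiable f x ->
  'D_v f x = v * 'D_1 f x.
Proof.
move=> df; rewrite !deriveE // -[v in LHS]mulr1.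
by rewrite -[v * 1]/(v *: (1:R)) linearZ.
Qed.

Lemma Ck_flat k p (A : set R) : open A -> Ck k A (flat p).
Proof.
move=> oA; have df q x : differentiable (flat q) x.
  by apply/derivable1_diffP; have [] := is_derive_flat q x.
elim: k p => [|k IH] p.
  by move=> x _; apply: differentiable_continuous.
split=> [x _|v]; first exact: df.
apply: (Ck_eq oA _ (Ck_mul oA (@Ck_cst _ _ _ k A v) (IH ('X^2 * (p - p^`()))))).
move=> x _; rewrite derive_scale1 //.
by have [_ ->] := is_derive_flat p x.
Qed.

Lemma Ck_comp1 (E : normedModType R) k (A : set E) (f : E -> R) (g : R -> R) :
  open A -> Ck k A f -> Ck k setT g -> Ck k A (fun x => g (f x)).
Proof.
move=> oA; elim: k g => [|k IH] g.
  by move=> cf cg x Ax; apply: (@continuous_comp _ _ _ f g);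
    [exact: cf|exact: cg].
move=> fk gk; have [df Df] := fk; have [dg Dg] := gk; split=> [x Ax|v].
  by apply: (@differentiable_comp _ _ _ _ f g); [exact: df|exact: dg].
apply: (Ck_eq oA _ (Ck_mul oA (Df v) (IH _ (CkS fk) (Dg 1)))) => x Ax.
have dfx := df _ Ax; have dgx := dg (f x) I.
have := @deriveE R E R (g \o f) x v (differentiable_comp dfx dgx).
rewrite /comp => ->; rewrite diff_comp //= -(deriveE v dfx) -(deriveE _ dgx).
by rewrite [RHS]derive_scale1.
Qed.

Definition smooth_step (t : R) : R := flat 1 t / (flat 1 t + flat 1 (1 - t)).

Lemma flat1_ge0 t : 0 <= flat 1 t.
Proof. by rewrite /flat; case: ifP => // _; rewrite hornerE mul1r expR_ge0. Qed.

Lemma flat1_gt0 t : 0 < t -> 0 < flat 1 t.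
Proof. by move=> t0; rewrite /flat t0 hornerE mul1r expR_gt0. Qed.

Lemma flat_le0 p t : t <= 0 -> flat p t = 0.
Proof. by move=> t0; rewrite /flat ltNge t0. Qed.

Lemma flat1D_gt0 t : 0 < flat 1 t + flat 1 (1 - t).
Proof.
have [t0|t0] := ltP 0 t; first by rewrite ltr_pwDl ?flat1_gt0 ?flat1_ge0.
by rewrite ltr_wpDl ?flat1_ge0 // flat1_gt0 // subr_gt0 (le_lt_trans t0).
Qed.

Lemma smooth_step0 t : t <= 0 -> smooth_step t = 0.
Proof. by move=> t0; rewrite /smooth_step flat_le0 // mul0r. Qed.

Lemma smooth_step1 t : 1 <= t -> smooth_step t = 1.
Proof.
move=> t1; rewrite /smooth_step (@flat_le0 _ (1 - t)) ?subr_le0 // addr0 divff //.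
by rewrite gt_eqF // flat1_gt0 // (lt_le_trans ltr01).
Qed.

Lemma Ck_smooth_step k : Ck k setT smooth_step.
Proof.
have oT : open [set: R] := openT.
apply: Ck_mul => //; first exact: Ck_flat.
apply: Ck_inv => // [x _|]; first by rewrite gt_eqF // flat1D_gt0.
apply: Ck_add => //; first exact: Ck_flat.
apply: (@Ck_comp1 R k setT (fun t => 1 - t)) => //; last exact: Ck_flat.
apply: Ck_add => //; first exact: Ck_cst.
case: k => [|k]; first by move=> x _; exact: continuousN.
split=> [x _|v]; first exact: differentiableN.
rewrite (_ : (fun _ => _) = cst (- v)); first exact: Ck_cst.
by apply/funext => x; rewrite deriveN // derive_id.
Qed.

(* 1 on the sup-norm ball of radius r, 0 outside the one of radius 2 r *)
Definition box_bump n (u : 'rV[R]_n) (r : R) (v : 'rV[R]_n) : R :=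
  \prod_(j < n) smooth_step (2 - ((v 0 j - u 0 j) / r) ^+ 2).

Lemma Ck_prod (E : normedModType R) k (A : set E) n (f : 'I_n -> E -> R) :
  open A -> (forall i, Ck k A (f i)) -> Ck k A (fun x => \prod_i f i x).
Proof.
move=> oA; elim: n f => [|n IH] f fk.
  rewrite (_ : (fun _ => _) = cst 1); first exact: Ck_cst.
  by apply/funext=> x; rewrite big_ord0.
rewrite (_ : (fun _ => _) = (fun x =>
   (\prod_(i < n) f (widen_ord (leqnSn n) i) x) * f ord_max x)).
  by apply: Ck_mul => //; apply: IH.
by apply/funext => x; rewrite big_ord_recr.
Qed.

Lemma Cinfty_box_bump n (u : 'rV[R]_n) r A : open A -> Cinfty A (box_bump u r).
Proof.
move=> oA k; apply: Ck_prod => // j.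
apply: (@Ck_comp1 _ k A (fun v => 2 - ((v 0 j - u 0 j) / r) ^+ 2)) => //;
  last exact: Ck_smooth_step.
have Hc : Ck k A (fun v : 'rV[R]_n => (v 0 j - u 0 j) / r).
  apply: Ck_mul => //; last exact: Ck_cst.
  by apply: Ck_add => //; [exact: Ck_coord|exact: Ck_cst].
have := Ck_add oA (@Ck_cst _ _ _ k A (2 : R))
  (Ck_mul oA (@Ck_cst _ _ _ k A (-1 : R)) (Ck_mul oA Hc Hc)).
by apply: Ck_eq => // x _; rewrite /= mulN1r expr2.
Qed.

Lemma box_bump_eq1 n (u v : 'rV[R]_n) (r : R) : 0 < r ->
  (forall j, `|v 0 j - u 0 j| <= r) -> box_bump u r v = 1.
Proof.
move=> r0 H; apply: big1 => j _; apply: smooth_step1.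
suff : ((v 0 j - u 0 j) / r) ^+ 2 <= 1 by lra.
rewrite -real_normK ?num_real // -[leRHS](expr1n _ 2) lerXn2r ?nnegrE //.
by rewrite normrM normfV (gtr0_norm r0) ler_pdivrMr // mul1r.
Qed.

Lemma box_bump_eq0 n (u v : 'rV[R]_n) (r : R) j : 0 < r ->
  2 * r <= `|v 0 j - u 0 j| -> box_bump u r v = 0.
Proof.
move=> r0 H; apply/eqP; rewrite prodf_seq_eq0; apply/hasP; exists j.
  by rewrite mem_index_enum.
apply/eqP/smooth_step0.
suff : 2 <= ((v 0 j - u 0 j) / r) ^+ 2 by lra.
rewrite -real_normK ?num_real // normrM normfV (gtr0_norm r0).
have : 2 <= `|v 0 j - u 0 j| / r by rewrite ler_pdivlMr.
move: (_ / r) => s; nra.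
Qed.

End Bump.

(** * Hadamard's lemma *)

Section UnitIntegral.
Context {R : realType}.
Local Notation mu := (@lebesgue_measure R).

Definition int01 (f : R -> R) : R := \int[mu]_(s in `[0, 1]) f s.

Definition cont01 (f : R -> R) := {within `[0, 1], continuous f}.

Lemma cont01_integrable f : cont01 f -> mu.-integrable `[0, 1] (EFin \o f).
Proof.
by move=> cf; apply: continuous_compact_integrable => //; exact: segment_compact.
Qed.

Lemma cont01D f g : cont01 f -> cont01 g -> cont01 (fun s => f s + g s).
Proof. by move=> cf cg x; apply: continuousD; [exact: cf|exact: cg]. Qed.

Lemma cont01M f g : cont01 f -> cont01 g -> cont01 (fun s => f s * g s).
Proof. by move=> cf cg x; apply: continuousM; [exact: cf|exact: cg]. Qed.

Lemma cont01_cst a : cont01 (fun=> a).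
Proof. by move=> x; exact: cst_continuous. Qed.

Lemma cont01_sum n (f : 'I_n -> R -> R) :
  (forall i, cont01 (f i)) -> cont01 (fun s => \sum_i f i s).
Proof.
elim: n f => [|n IH] f cf.
  by under eq_fun do rewrite big_ord0; exact: cont01_cst.
under eq_fun do rewrite big_ord_recr; apply: cont01D => //.
exact: IH.
Qed.

Lemma int01D f g : cont01 f -> cont01 g ->
  int01 (fun s => f s + g s) = int01 f + int01 g.
Proof. by move=> cf cg; apply: RintegralD => //; exact: cont01_integrable. Qed.

Lemma int01Z a f : cont01 f -> int01 (fun s => a * f s) = a * int01 f.
Proof. by move=> cf; apply: RintegralZl => //; exact: cont01_integrable. Qed.

Lemma int01_sum n (f : 'I_n -> R -> R) : (forall i, cont01 (f i)) ->
  int01 (fun s => \sum_i f i s) = \sum_i int01 (f i).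
Proof.
elim: n f => [|n IH] f cf.
  rewrite big_ord0 /int01 (_ : (fun _ => _) = cst 0).
    by rewrite Rintegral_cst // mul0r.
  by apply/funext => s; rewrite big_ord0.
rewrite big_ord_recr /= -IH //.
rewrite -(@int01D (fun s => \sum_(i < n) f (widen_ord (leqnSn n) i) s)) //; last exact: cont01_sum.
by congr int01; apply/funext => s; rewrite big_ord_recr.
Qed.

Lemma int01_norm f e : cont01 f -> (forall s, 0 <= s <= 1 -> `|f s| <= e) ->
  `|int01 f| <= e.
Proof.
move=> cf fe; apply: le_trans (le_normr_Rintegral _ (cont01_integrable cf)) _ => //.
have <- : \int[mu]_(_ in `[0, 1]) e = e.
  rewrite Rintegral_cst // [X in fine X](_ : _ = 1%E) ?mulr1 //.
  apply: (etrans (@lebesgue_measure_itv R `[0, 1])).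
  by rewrite /= lte_fin ltr01 oppr0 adde0.
apply: le_Rintegral => //.
- apply: cont01_integrable => x; apply: (continuous_comp (cf x)); exact: norm_continuous.
- by apply: cont01_integrable; exact: cont01_cst.
Qed.

Lemma int01_derive (F f : R -> R) : cont01 f ->
  (forall s : R, 0 <= s <= 1 -> is_derive s (1:R) F (f s)) -> int01 f = F 1 - F 0.
Proof.
move=> cf dF.
have cF s : 0 <= s <= 1 -> {for s, continuous F}.
  move=> /dF [dFs _]; apply: differentiable_continuous.
  exact/derivable1_diffP.
rewrite /int01 /Rintegral (@continuous_FTC2 _ _ F) //.
- split.
  + by move=> s; rewrite in_itv /= => /andP[? ?]; have [] := dF s; rewrite ?ltW.
  + by apply: cvg_at_right_filter; apply: cF; rewrite lexx ler01.
  + by apply: cvg_at_left_filter; apply: cF; rewrite lexx ler01.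
- move=> s; rewrite in_itv /= => /andP[? ?]; rewrite derive1E.
  by have [] := dF s; rewrite ?ltW.
Qed.

End UnitIntegral.

Section Hadamard.
Context {R : realType} {n : nat}.
Implicit Types (u v w : 'rV[R]_n) (g : 'rV[R]_n -> R).

Definition scale_coord (i : 'I_n) (s : R) v : 'rV[R]_n :=
  \row_j (s ^+ (j == i) * v 0 j).

Lemma scale_coordD i s v w :
  scale_coord i s (v + w) = scale_coord i s v + scale_coord i s w.
Proof. by apply/rowP => j; rewrite !mxE mulrDr. Qed.

Lemma scale_coordZ i s a v : scale_coord i s (a *: v) = a *: scale_coord i s v.
Proof. by apply/rowP => j; rewrite !mxE mulrCA. Qed.

Lemma scale_coordE i s v :
  scale_coord i s v = scale_coord i 0 v + s *: (v 0 i *: delta_mx 0 i).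
Proof.
apply/rowP => j; rewrite !mxE eqxx /= expr0n.
by have [->|] := eqVneq j i; rewrite /= ?(expr1, mulr1, mul0r, add0r, mulr0, addr0).
Qed.

Lemma scale_coord1 i v : scale_coord i 1 v = v.
Proof. by apply/rowP => j; rewrite !mxE expr1n mul1r. Qed.

Lemma ball_rVP u r v : 0 < r -> ball u r v <-> forall j, `|u 0 j - v 0 j| < r.
Proof.
move=> r0; rewrite -ball_normE /= /Num.Def.normr /= mx_normrE.
split => [H j|H].
  apply: le_lt_trans H; apply: le_trans; last exact: (le_bigmax _ _ (0, j)).
  by rewrite !mxE.
apply: bigmax_lt => // -[k j] _; rewrite !mxE ord1; exact: H.
Qed.

Lemma norm_coord v j : `|v 0 j| <= `|v|.
Proof.
rewrite [leRHS]/Num.Def.normr /= mx_normrE.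
by apply: le_trans; last exact: (le_bigmax _ _ (0, j)).
Qed.

Lemma ball_scale_coord i u r v s : u 0 i = 0 -> 0 < r -> 0 <= s <= 1 ->
  ball u r v -> ball u r (scale_coord i s v).
Proof.
move=> ui r0 /andP[s0 s1] /(ball_rVP _ _ r0) H; apply/(ball_rVP _ _ r0) => j.
rewrite mxE; have [->|_] := eqVneq j i; last by rewrite /= mul1r.
have := H i; rewrite ui !sub0r !normrN /= expr1 normrM ger0_norm //.
by apply: le_lt_trans; rewrite -[leRHS]mul1r ler_wpM2r.
Qed.

Lemma is_derive_line g v w (t : R) : differentiable g (v + t *: w) ->
  is_derive t (1 : R) (fun s => g (v + s *: w))
    (\sum_j w 0 j * 'D_(delta_mx 0 j) g (v + t *: w)).
Proof.
move=> dg.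
have dl : is_diff t (fun s : R => v + s *: w) (fun s : R => s *: w).
  apply: is_diff_eq; apply/funext => s /=.
  by rewrite !fctE add0r.
have dgl : differentiable (fun s : R => g (v + s *: w)) t.
  by apply: (@differentiable_comp _ _ _ _ (fun s : R => v + s *: w) g).
apply: DeriveDef; first exact/derivable1_diffP.
rewrite (@derive_comp _ _ _ (fun s : R => v + s *: w)) //.
apply: eq_bigr => j _; congr (_ * _).
rewrite (_ : (fun _ => _) = (fun s : R => v 0 j + s * w 0 j)); last first.
  by apply/funext => s; rewrite !mxE.
rewrite deriveD //= derive_cst add0r.
by have [_ ->] := is_deriveM (is_derive_id t (1:R)) (is_derive_cst (w 0 j) t (1:R));
  rewrite /= scaler0 add0r [_ *: _]mulr1.
Qed.

Lemma continuous_scale_coord i :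
  continuous (fun p : R * 'rV[R]_n => scale_coord i p.1 p.2).
Proof.
move=> [s v]; apply/cvgrPdist_le => /= e e0; near=> p.
rewrite /Num.Def.normr/= mx_normrE (bigmax_le _ (ltW e0))//= => -[k j] _.
rewrite !mxE/=; move: j {k}; near: p; apply: filter_forall => j.
have cv : (fun p : R * 'rV[R]_n => p.2 0 j) @ (s, v) --> v 0 j.
  apply: (@cvg_comp _ _ _ snd (fun v : 'rV[R]_n => v 0 j) _ (nbhs v)).
    exact: cvg_snd.
  exact: coord_continuous.
have cs : (fun p : R * 'rV[R]_n => p.1 ^+ (j == i)) @ (s, v) --> s ^+ (j == i).
  case: (j == i); last exact: cvg_cst.
  by rewrite expr1; under eq_fun do rewrite expr1; exact: cvg_fst.
have csv : (fun p : R * 'rV[R]_n => p.1 ^+ (j == i) * p.2 0 j) @ (s, v) -->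
    s ^+ (j == i) * v 0 j by apply: cvgM.
by have /cvgrPdist_le/(_ e e0) := csv.
Unshelve. all: by end_near. Qed.

Lemma cvg_pair_cst (S T : topologicalType) (s : S) (v : T) :
  (fun t : S => (t, v)) @ s --> (s, v).
Proof.
move=> P [[A B] /= [As Bv] AB]; apply: filterS As => t At.
by apply: AB; split=> //=; exact: nbhs_singleton Bv.
Qed.

Section Ball.
Variables (i : 'I_n) (u : 'rV[R]_n) (r : R).
Hypotheses (ui : u 0 i = 0) (r0 : 0 < r).
Let B := ball u r.
Let oB : open B := ball_open u r.
Let nB v : B v -> \forall w \near v, B w.
Proof. by move=> Bv; apply: near_open oB Bv _. Qed.

Lemma scale_coord_tube g v e : (forall x, B x -> {for x, continuous g}) ->
  B v -> 0 < e ->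
  \forall w \near v, forall s, 0 <= s <= 1 ->
    `|g (scale_coord i s w) - g (scale_coord i s v)| <= e.
Proof.
move=> cg Bv e0.
have /compact_near_coveringP cpt := @segment_compact R 0 1.
have {}cpt := cpt _ _ (fun w s => `|g (scale_coord i s w) - g (scale_coord i s v)| <= e)
  (nbhs_filter v).
suff HH : forall s : R, `[0, 1]%classic s -> \forall t \near s & w \near v,
    `|g (scale_coord i t w) - g (scale_coord i t v)| <= e.
  apply: filterS (cpt HH) => w Hw s s01; apply: Hw.
  by rewrite /= in_itv.
move=> s; rewrite /= in_itv /= => s01.
have cgs : (fun p : R * 'rV[R]_n => g (scale_coord i p.1 p.2)) @ (s, v) -->
    g (scale_coord i s v).
  have := @continuous_scale_coord i (s, v); rewrite /continuous_at /= => H.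
  by apply: cvg_comp H _; apply: cg; exact: ball_scale_coord.
have cgv : (fun t : R => g (scale_coord i t v)) @ s --> g (scale_coord i s v).
  exact: cvg_comp (@cvg_pair_cst R 'rV[R]_n s v) cgs.
have e2 : 0 < e / 2 by rewrite divr_gt0.
have /cvgrPdist_le/(_ _ e2) H1 := cgs.
have /cvgrPdist_le/(_ _ e2) H2 := cgv.
have H3 : \forall t \near s & w \near v,
    `|g (scale_coord i s v) - g (scale_coord i t v)| <= e / 2.
  exists ([set t | `|g (scale_coord i s v) - g (scale_coord i t v)| <= e / 2], setT).
    by split=> //=; exact: filterT.
  by move=> [t w] [].
apply: filterS2 H1 H3 => -[t w] /= H1 H3.
rewrite -(subrKA (g (scale_coord i s v))) (le_trans (ler_normD _ _)) //.
by rewrite [leRHS](splitr e) lerD // distrC.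
Qed.

Lemma cont01_scale_coord g v k : (forall x, B x -> {for x, continuous g}) ->
  B v -> cont01 (fun s => s ^+ k * g (scale_coord i s v)).
Proof.
move=> cg Bv; apply: cont01M.
  by apply: continuous_subspaceT => x; exact: exprn_continuous.
apply/subspace_continuousP => s; rewrite /= in_itv /= => s01.
apply: cvg_within_filter.
have H := @cvg_pair_cst R 'rV[R]_n s v.
have := @continuous_scale_coord i (s, v); rewrite /continuous_at /= => H'.
have {}H' := cvg_comp _ _ H H'.
by apply: (cvg_comp _ _ H'); apply: cg; exact: ball_scale_coord.
Qed.

Definition coord_mean k g v : R := int01 (fun s => s ^+ k * g (scale_coord i s v)).

Lemma continuous_coord_mean k g v : (forall x, B x -> {for x, continuous g}) ->
  B v -> {for v, continuous (coord_mean k g)}.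
Proof.
move=> cg Bv; apply/(@cvgrPdist_le _ _ _ _ (nbhs_filter v)) => /= e e0.
apply: filterS2 (nB Bv) (scale_coord_tube cg Bv e0) => w Bw H.
rewrite /coord_mean -[X in _ - X]mul1r -mulN1r mul1r -int01Z; last exact: cont01_scale_coord.
rewrite -int01D; first last.
- by apply: cont01M; [exact: cont01_cst|exact: cont01_scale_coord].
- exact: cont01_scale_coord.
apply: int01_norm.
  apply: cont01D; first exact: cont01_scale_coord.
  by apply: cont01M; [exact: cont01_cst|exact: cont01_scale_coord].
move=> s s01; rewrite mulN1r -mulrBr normrM.
have /andP[s0 s1] := s01.
apply: le_trans (H s s01); rewrite distrC -[leRHS]mul1r ler_wpM2r //.
by rewrite ger0_norm ?exprn_ge0 // exprn_ile1.
Qed.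

Lemma ball_line v w (t : R) : B v -> B (v + w) -> 0 <= t <= 1 -> B (v + t *: w).
Proof.
move=> /(ball_rVP _ _ r0) Bv /(ball_rVP _ _ r0) Bw /andP[t0 t1].
apply/(ball_rVP _ _ r0) => j; have := Bv j; have := Bw j; rewrite !mxE.
move: (u 0 j) (v 0 j) (w 0 j) => a b c.
rewrite !ltr_norml => /andP[H1 H2] /andP[H3 H4].
have [->|tn0] := eqVneq t 0; first by apply/andP; split; lra.
have {tn0}tp : 0 < t by rewrite lt_neqAle eq_sym tn0.
by apply/andP; split; nra.
Qed.

Lemma line_approx g v w e : (forall x, B x -> differentiable g x) ->
  B v -> B (v + w) ->
  (forall t j, 0 <= t <= 1 ->
     `|'D_(delta_mx 0 j) g (v + t *: w) - 'D_(delta_mx 0 j) g v| <= e) ->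
  `|g (v + w) - g v - \sum_j w 0 j * 'D_(delta_mx 0 j) g v| <= n%:R * `|w| * e.
Proof.
move=> dg Bv Bvw H.
pose h (t : R) := g (v + t *: w).
pose dh (t : R) := \sum_j w 0 j * 'D_(delta_mx 0 j) g (v + t *: w).
have dhE (t : R) : 0 <= t <= 1 -> is_derive t (1:R) h (dh t).
  by move=> t01; apply: is_derive_line; apply: dg; exact: ball_line.
have [||t] := @MVT _ h dh 0 1 ltr01.
- by move=> t; rewrite in_itv /= => /andP[t0 t1]; apply: dhE; rewrite !ltW.
- apply/subspace_continuousP => t; rewrite /= in_itv /= => t01.
  apply: cvg_within_filter; apply: differentiable_continuous.
  by apply/derivable1_diffP; have [] := dhE t t01.
rewrite in_itv /= => /andP[t0 t1].
rewrite /h scale1r scale0r addr0 subr0 mulr1 => ->.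
rewrite /dh -sumrB (le_trans (ler_norm_sum _ _ _)) //.
rewrite -mulrA mulr_natl.
rewrite -[X in _ *+ X]card_ord -sumr_const; apply: ler_sum => j _.
rewrite -mulrBr normrM ler_pM // ?norm_coord // H // !ltW //.
Qed.

Lemma differentiable_coord_mean k g v : Ck 1 B g -> B v ->
  differentiable (coord_mean k g) v /\
  forall w, 'D_w (coord_mean k g) v =
    \sum_j w 0 j * coord_mean (k + (j == i)) ('D_(delta_mx 0 j) g) v.
Proof.
move=> [dg cDg] Bv.
have cg x : B x -> {for x, continuous g}.
  by move=> Bx; apply: differentiable_continuous; exact: dg.
pose Lf w := \sum_j w 0 j * coord_mean (k + (j == i)) ('D_(delta_mx 0 j) g) v.
have Ll : linear Lf.
  move=> a w1 w2; rewrite /Lf scaler_sumr -big_split; apply: eq_bigr => j _ /=.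
  by rewrite !mxE mulrDl -mulrA.
pose LL := GRing.isLinear.Build _ _ _ _ Lf Ll.
pose L : {linear 'rV[R]_n -> R} := HB.pack Lf LL.
have cL : continuous L.
  suff : Ck 0 setT Lf by move=> H w; exact: H.
  apply: Ck_sum => [|j]; first exact: openT.
  by apply: Ck_mul; [exact: openT|exact: Ck_coord|exact: Ck_cst].
suff dJ : forall e : R, 0 < e -> \forall h \near (0 : 'rV[R]_n),
    `|coord_mean k g (h + v) - coord_mean k g v - L h| <= e * `|h|.
  have [dd dE] := diff_of_linear_approx cL dJ.
  by split=> // w; rewrite deriveE // dE.
move=> e e0; pose e' := e / n.+1%:R.
have e'0 : 0 < e' by rewrite divr_gt0.
have T : \forall w \near v, forall j s, 0 <= s <= 1 ->
    `|'D_(delta_mx 0 j) g (scale_coord i s w) -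
      'D_(delta_mx 0 j) g (scale_coord i s v)| <= e'.
  have Tj j := scale_coord_tube (cDg (delta_mx 0 j)) Bv e'0.
  exact: (@filter_forall _ _ (fun j w => forall s, 0 <= s <= 1 ->
    `|'D_(delta_mx 0 j) g (scale_coord i s w) -
      'D_(delta_mx 0 j) g (scale_coord i s v)| <= e') (nbhs v) (nbhs_filter v) Tj).
have {}T : \forall w \near v, B w /\ forall j s, 0 <= s <= 1 ->
    `|'D_(delta_mx 0 j) g (scale_coord i s w) -
      'D_(delta_mx 0 j) g (scale_coord i s v)| <= e'.
  by by apply: filterS2 T (nB Bv) => w.
have /nbhs_ballP[d /= d0 Hd] := T.
apply/nbhs_ballP; exists d => //= h; rewrite -ball_normE /= sub0r normrN => hd.
have Hl (t : R) : 0 <= t <= 1 -> ball v d (v + t *: h).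
  move=> /andP[t0 t1]; rewrite -ball_normE /= opprD addNKr normrN normrZ.
  by rewrite ger0_norm // (le_lt_trans _ hd) // -[leRHS]mul1r ler_wpM2r.
have Bh : B (v + h).
  by have := Hd _ (Hl 1 _); rewrite scale1r ler01 lexx => /(_ isT) [].
rewrite [h + v]addrC.
have cDj j l := @cont01_scale_coord _ v l (cDg (delta_mx 0 j)) Bv.
have cj j : cont01 (fun s => h 0 j * (s ^+ (k + (j == i)) *
     'D_(delta_mx 0 j) g (scale_coord i s v))).
  apply: cont01M; first exact: cont01_cst.
  exact: cDj.
have -> : Lf h = int01 (fun s => \sum_j h 0 j * (s ^+ (k + (j == i)) *
     'D_(delta_mx 0 j) g (scale_coord i s v))).
  rewrite int01_sum // /Lf; apply: eq_bigr => j _.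
  by rewrite int01Z //; exact: cDj.
have c1 := @cont01_scale_coord _ _ k cg Bh.
have c2 := @cont01_scale_coord _ _ k cg Bv.
have c2' := cont01M (@cont01_cst _ (-1)) c2.
have c3 := cont01_sum cj.
have c3' := cont01M (@cont01_cst _ (-1)) c3.
rewrite /coord_mean -[X in _ - X - _]mul1r -[X in _ - _ - X]mul1r -!mulNr.
rewrite -!int01Z // -!int01D //; last exact: cont01D.
apply: int01_norm; first by apply: cont01D => //; exact: cont01D.
move=> s s01; have /andP[s0 s1] := s01.
rewrite (_ : _ + _ = s ^+ k * (g (scale_coord i s v + scale_coord i s h)
   - g (scale_coord i s v) - \sum_j scale_coord i s h 0 j *
       'D_(delta_mx 0 j) g (scale_coord i s v))); last first.
  rewrite -scale_coordD !mulrBr !mulN1r mulr_sumr; congr (_ - _).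
  by apply: eq_bigr => j _; rewrite mxE exprD; ring.
rewrite normrM; apply: (@le_trans _ _ (n%:R * `|scale_coord i s h| * e')).
  rewrite -[leRHS]mul1r ler_pM //.
    by rewrite ger0_norm ?exprn_ge0 // exprn_ile1.
  apply: line_approx => //; first exact: ball_scale_coord.
    by rewrite -scale_coordD; exact: ball_scale_coord.
  move=> t j t01; rewrite -scale_coordZ -scale_coordD.
  by have [_] := Hd _ (Hl t t01); apply.
have nh : `|scale_coord i s h| <= `|h|.
  rewrite [leLHS]/Num.Def.normr /= mx_normrE bigmax_le // => -[a j] _.
  rewrite mxE normrM ord1; apply: le_trans (norm_coord h j).
  rewrite -[leRHS]mul1r ler_wpM2r //.
  by rewrite ger0_norm ?exprn_ge0 // exprn_ile1.
apply: (@le_trans _ _ (n.+1%:R * `|h| * e')).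
  by rewrite ler_pM2r // ler_pM // ler_nat.
by rewrite mulrAC /e' mulrCA mulfV // mulr1.
Qed.

Lemma Ck_coord_mean m k g : Cinfty B g -> Ck m B (coord_mean k g).
Proof.
elim: m k g => [|m IH] k g sg.
  by move=> v Bv; apply: continuous_coord_mean => //; exact: (sg 0%N).
split=> [v Bv|w]; first by have [] := differentiable_coord_mean k (sg 1%N) Bv.
have H : Ck m B (fun v => \sum_j w 0 j *
    coord_mean (k + (j == i)) ('D_(delta_mx 0 j) g) v).
  apply: Ck_sum => // j; apply: Ck_mul => //; first exact: Ck_cst.
  by apply: IH => l; have [_] := sg l.+1; apply.
apply: (Ck_eq oB _ H) => v Bv.
by have [_ ->] := differentiable_coord_mean k (sg 1%N) Bv.
Qed.

Lemma Hadamard g : Cinfty B g -> exists2 h, Cinfty B h &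
  forall v, B v -> g v - g (scale_coord i 0 v) = v 0 i * h v.
Proof.
move=> sg; exists (coord_mean 0 ('D_(delta_mx 0 i) g)).
  by move=> m; apply: Ck_coord_mean => l; have [_] := sg l.+1; apply.
move=> v Bv; have [dg cDg] := sg 1%N.
have cs := @cont01_scale_coord _ _ 0 (cDg (delta_mx 0 i)) Bv.
have Bs (s : R) : 0 <= s <= 1 -> B (scale_coord i s v).
  by move=> s01; exact: ball_scale_coord.
rewrite /coord_mean -int01Z //.
pose F (t : R) := g (scale_coord i 0 v + t *: (v 0 i *: delta_mx 0 i)).
have cvs := cont01M (@cont01_cst _ (v 0 i)) cs.
suff dF : forall s : R, 0 <= s <= 1 -> is_derive s (1:R) F
    (v 0 i * (s ^+ 0 * 'D_(delta_mx 0 i) g (scale_coord i s v))).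
  by rewrite (int01_derive cvs dF) /F -!scale_coordE scale_coord1.
move=> s s01; rewrite scale_coordE.
have := @is_derive_line g (scale_coord i 0 v) (v 0 i *: delta_mx 0 i) s.
rewrite -scale_coordE => /(_ (dg _ (Bs s s01))).
rewrite (bigD1 i) //= big1 => [|j ji]; last by rewrite !mxE (negbTE ji) andbF mulr0 mul0r.
by rewrite !mxE !eqxx /= mulr1 addr0 expr0 mul1r.
Qed.

End Ball.

End Hadamard.

(** * Local smoothness and patching *)

Section SmoothAt.
Context {R : realType}.
Implicit Types E F : normedModType R.

Lemma Ck_local E F k (A : set E) (f : E -> F) :
  (forall x, A x -> exists2 U, U x & Ck k U f) -> Ck k A f.
Proof.
elim: k f => [|k IH] f H; first by move=> x /H [U Ox]; apply.
split=> [x Ax|v]; first by have [U Ux [dU _]] := H x Ax; exact: dU.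
by apply: IH => x Ax; have [U Ux [_ Df]] := H x Ax; exists U => //; exact: Df.
Qed.

Definition smooth_at E F (D : set E) (f : E -> F) (u : E) : Prop :=
  exists (U : set E) (G : E -> F),
    [/\ open U, U u, Cinfty U G & forall v, U v -> D v -> G v = f v].

Lemma smooth_atS E F (D D' : set E) (f f' : E -> F) u :
  (\forall v \near u, D' v -> D v /\ f v = f' v) ->
  smooth_at D f u -> smooth_at D' f' u.
Proof.
move=> /near_openE [N [oN Nu HN]] [U [G [oO Ou sG GE]]].
exists (U `&` N), G; split=> //; first exact: openI.
  by move=> k; apply: Ck_sub (sG k) => v [].
by move=> v [Ov Nv] D'v; have [Dv <-] := HN _ Nv D'v; exact: GE.
Qed.

Lemma smooth_atW E F (D D' : set E) (f f' : E -> F) u :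
  (forall v, D' v -> D v /\ f v = f' v) ->
  smooth_at D f u -> smooth_at D' f' u.
Proof. by move=> H; apply: smooth_atS; apply: filterE. Qed.

Lemma smooth_at_Cinfty E F (D A : set E) (f : E -> F) u :
  open A -> A u -> Cinfty A f -> smooth_at D f u.
Proof. by move=> oA Au sf; exists A, f. Qed.

Lemma smooth_at_cst E F (D : set E) (a : F) u : smooth_at D (cst a) u.
Proof. by apply: (smooth_at_Cinfty _ openT) => // k; exact: Ck_cst. Qed.

Lemma smooth_at_coord n (D : set 'rV[R]_n) j u :
  smooth_at D (fun v : 'rV[R]_n => v 0 j) u.
Proof. by apply: (smooth_at_Cinfty _ openT) => // k; exact: Ck_coord. Qed.

Lemma smooth_at_id n (D : set 'rV[R]_n) u :
  smooth_at D (fun v : 'rV[R]_n => v) u.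
Proof.
apply: (smooth_at_Cinfty _ openT) => // k.
by apply/Ck_rV; [exact: openT|move=> j; exact: Ck_coord].
Qed.

Lemma smooth_at_op2 E (op : R -> R -> R) (D : set E) (f g : E -> R) u :
  (forall k (A : set E) a b, open A -> Ck k A a -> Ck k A b ->
    Ck k A (fun x => op (a x) (b x))) ->
  smooth_at D f u -> smooth_at D g u -> smooth_at D (fun v => op (f v) (g v)) u.
Proof.
move=> H [U [G [oO Ou sG GE]]] [U' [G' [oO' Ou' sG' GE']]].
have oI := openI oO oO'.
exists (U `&` U'), (fun v => op (G v) (G' v)); split=> // [k|v [Ov Ov'] Dv].
  by apply: H => //; [apply: Ck_sub (sG k)|apply: Ck_sub (sG' k)] => v [].
by rewrite GE // GE'.
Qed.

Lemma smooth_atD E (D : set E) (f g : E -> R) u :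
  smooth_at D f u -> smooth_at D g u -> smooth_at D (fun v => f v + g v) u.
Proof. by apply: smooth_at_op2 => k A a b; exact: Ck_add. Qed.

Lemma smooth_atM E (D : set E) (f g : E -> R) u :
  smooth_at D f u -> smooth_at D g u -> smooth_at D (fun v => f v * g v) u.
Proof. by apply: smooth_at_op2 => k A a b; exact: Ck_mul. Qed.

Lemma smooth_at_rV E n (D : set E) (f : E -> 'rV[R]_n) u :
  (forall i, smooth_at D (fun v => f v 0 i) u) <-> smooth_at D f u.
Proof.
split=> [H|[U [G [oO Ou sG GE]]] i]; last first.
  exists U, (fun v => G v 0 i); split=> // [k|v Ov Dv]; last by rewrite GE.
  by have /(Ck_rV _ _ oO) := sG k.
have {H} /choice [U /choice [G HG]] := H.
have oI : open [set v | forall i, U i v].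
  by apply: open_forall => i; have [] := HG i.
exists [set v | forall i, U i v], (fun v => \row_i G i v); split=> //.
- by move=> i; have [] := HG i.
- move=> k; apply/Ck_rV => // i.
  have [_ _ sG _] := HG i.
  apply: (@Ck_eq _ _ _ _ _ (G i)) => //; first by move=> v _; rewrite mxE.
  by apply: Ck_sub (sG k) => v; apply.
- move=> v Ov Dv; apply/rowP => i; rewrite mxE.
  by have [_ _ _ ->] := HG i.
Qed.

Lemma smooth_at_cvg E F (D : set E) (f : E -> F) u : D u ->
  smooth_at D f u -> f @ within D (nbhs u) --> f u.
Proof.
move=> Du [U [G [oO Ou sG GE]]].
have cG : G @ within D (nbhs u) --> G u.
  by apply: cvg_within_filter; exact: (sG 0%N).
rewrite -(GE u) //; apply: cvg_trans cG; apply: near_eq_cvg.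
by apply: near_open oO Ou _ => v Ov; exact: GE.
Qed.

Lemma smooth_at_continuous E F (f : E -> F) u :
  smooth_at setT f u -> {for u, continuous f}.
Proof.
move=> sf P nP.
have H : \forall v \near u, setT v -> P (f v).
  exact: (smooth_at_cvg (I : setT u) sf nP).
suff : \forall v \near u, P (f v) by [].
by apply: filterS H => v; exact.
Qed.

Lemma smooth_at_comp_real E n (D : set E) (D' : set 'rV[R]_n) (f : E -> 'rV[R]_n)
    (g : 'rV[R]_n -> R) u :
  D u -> smooth_at D f u -> smooth_at D' g (f u) ->
  (\forall v \near u, D v -> D' (f v)) -> smooth_at D (fun v => g (f v)) u.
Proof.
move=> Du [U [G [oO Ou sG GE]]] [U' [G' [oO' Ou' sG' GE']]] DD'.
have GO' : \forall v \near u, U' (G v).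
  have := sG 0%N u Ou; apply; rewrite GE //; exact: open_nbhs_nbhs.
have [N [oN Nu HN]] := near_openE (filterI GO' DD').
have oI := openI oO oN.
exists (U `&` N), (fun v => G' (G v)); split=> // [k|v [Ov Nv] Dv].
  apply: (@Ck_comp _ _ _ _ _ U' G G') => //.
  - by move=> v [_ /HN []].
  - by apply: Ck_sub (sG k) => v [].
have [U'v /(_ Dv) D'v] := HN v Nv.
by rewrite GE // GE' // -GE.
Qed.

Lemma smooth_at_comp E n m (D : set E) (D' : set 'rV[R]_n) (f : E -> 'rV[R]_n)
    (g : 'rV[R]_n -> 'rV[R]_m) u :
  D u -> smooth_at D f u -> smooth_at D' g (f u) ->
  (\forall v \near u, D v -> D' (f v)) -> smooth_at D (fun v => g (f v)) u.
Proof.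
move=> Du sf sg DD'; apply/smooth_at_rV => i.
apply: (@smooth_at_comp_real _ _ D D' f (fun w => g w 0 i)) => //.
by move: sg => /smooth_at_rV.
Qed.

Section Patch.
Variables (n : nat).
Implicit Types (A : set 'rV[R]_n) (f : 'rV[R]_n -> R).

(* The weights chi_i * prod_(j < i) (1 - chi_j) form a partition of unity whose
   terms of index greater than i vanish on B i. *)
Lemma patch_seq A f (chi g : nat -> 'rV[R]_n -> R) (B : nat -> set 'rV[R]_n) :
  (forall i, Cinfty setT (chi i)) -> (forall i, Cinfty setT (g i)) ->
  (forall i, open (B i)) -> (forall i v, B i v -> chi i v = 1) ->
  (forall i v, A v -> g i v = chi i v * f v) ->
  exists2 f', Cinfty (\bigcup_i B i) f' &
    forall v, A v -> (\bigcup_i B i) v -> f' v = f v.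
Proof.
move=> schi sg oB chi1 gE.
pose P i v := \prod_(j < i) (1 - chi j v).
pose S N v := \sum_(i < N) g i v * P i v.
have P0 i N v : (i < N)%N -> B i v -> P N v = 0.
  move=> iN Biv; apply/eqP; rewrite /P prodf_seq_eq0; apply/hasP.
  by exists (Ordinal iN); rewrite ?mem_index_enum //= chi1 // subrr.
have SE i N v : (i < N)%N -> B i v -> S N v = S i.+1 v.
  elim: N => // N IH; rewrite ltnS leq_eqVlt => /orP[/eqP -> //|iN] Biv.
  by rewrite /S big_ord_recr /= (P0 i) // mulr0 addr0; exact: IH.
have oT : open [set: 'rV[R]_n] := openT.
have sS N k : Ck k setT (S N).
  apply: Ck_sum => // i; apply: Ck_mul => //; first exact: sg.
  apply: Ck_prod => // j.
  have := Ck_add oT (@Ck_cst _ _ _ k setT (1:R))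
    (Ck_mul oT (@Ck_cst _ _ _ k setT (-1:R)) (schi j k)).
  by apply: Ck_eq => // v _; rewrite /= mulN1r.
pose N v := (xget 0%N [set i | B i v]).+1.
have NE i v : B i v -> S (N v) v = S i.+1 v.
  move=> Biv; rewrite /N; case: xgetP => [j _ Bjv|/(_ i)] //=.
  have [ij|ij] := leqP i j; last by rewrite (@SE j i.+1) // ltnW.
  by rewrite (@SE i j.+1).
exists (fun v => S (N v) v) => [k|v Av [i _ Biv]].
  apply: Ck_local => v [i _ Biv]; exists (B i) => //.
  apply: (@Ck_eq _ _ _ _ _ (S i.+1)) => //; first by move=> w Bw; rewrite (NE i).
  exact: Ck_sub (sS _ k).
rewrite (NE i) // /S.
have -> : \sum_(j < i.+1) g j v * P j v = f v * \sum_(j < i.+1) chi j v * P j v.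
  by rewrite mulr_sumr; apply: eq_bigr => j _; rewrite gE // mulrA (mulrC (f v)).
have -> : \sum_(j < i.+1) chi j v * P j v = 1 - P i.+1 v.
  move: (i.+1); elim=> [|m IH]; first by rewrite big_ord0 /P big_ord0 subrr.
  rewrite big_ord_recr /= IH /P [in RHS]big_ord_recr /=; ring.
by rewrite (@P0 i) // subr0 mulr1.
Qed.

Lemma patch A f : (forall u, A u -> smooth_at A f u) ->
  exists A' f', [/\ open A', A `<=` A', Cinfty A' f' & forall x, A x -> f' x = f x].
Proof.
move=> sf.
pose ctr (t : 'rV[rat]_n * nat) : 'rV[R]_n := map_mx ratr t.1.
pose rad (t : 'rV[rat]_n * nat) : R := t.2.+1%:R^-1.
have rad0 t : 0 < rad t by rewrite invr_gt0.
pose valid t (G : 'rV[R]_n -> R) := Cinfty (ball (ctr t) (3 * rad t)) G /\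
  forall v, ball (ctr t) (3 * rad t) v -> A v -> G v = f v.
have r3 t : 0 < 3 * rad t by rewrite mulr_gt0.
have /choice [G HG] t : exists G, (exists G', valid t G') -> valid t G.
  by have [[G vG]|nG] := pselect (exists G, valid t G); [exists G|exists f].
pose ok i t := unpickle i = Some t /\ exists G', valid t G'.
pose chi i v : R := if unpickle i is Some t then
  (if `[< exists G', valid t G' >] then box_bump (ctr t) (rad t) v else 0) else 0.
pose g i v : R := if unpickle i is Some t then
  (if `[< exists G', valid t G' >] then box_bump (ctr t) (rad t) v * G t v else 0) else 0.
pose B i : set 'rV[R]_n := if unpickle i is Some t then
  (if `[< exists G', valid t G' >] then ball (ctr t) (rad t) else set0) else set0.
have oT : open [set: 'rV[R]_n] := openT.
have bump0 t v : ~ ball (ctr t) (3 * rad t) v ->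
    \forall w \near v, box_bump (ctr t) (rad t) w = 0.
  move=> nb; have [j Hj] : exists j, 3 * rad t <= `|ctr t 0 j - v 0 j|.
    apply: contrapT => nj; apply: nb; apply/ball_rVP => // j.
    by rewrite ltNge; apply/negP => ?; apply: nj; exists j.
  have : \forall w \near v, ball v (rad t) w by exact: nbhsx_ballx.
  apply: filterS => w /(ball_rVP _ _ (rad0 t)) /(_ j) Hw.
  apply: (@box_bump_eq0 _ _ _ _ _ j) => //.
  have := ler_distD (w 0 j) (ctr t 0 j) (v 0 j).
  rewrite (distrC (w 0 j)) (distrC (ctr t 0 j) (w 0 j)).
  move: Hj Hw; move: (`|_|) (`|_|) (`|_|) => a b c; lra.
have [||||i v Av|f' sf' f'E] := @patch_seq A f chi g B.
- move=> i k; rewrite /chi; case: unpickle => [t|]; last exact: Ck_cst.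
  by case: asboolP => _; [exact: Cinfty_box_bump|exact: Ck_cst].
- move=> i k; rewrite /g; case: unpickle => [t|]; last exact: Ck_cst.
  case: asboolP => [/HG [sG GE]|_]; last exact: Ck_cst.
  apply: Ck_local => v _.
  have [bv|nbv] := pselect (ball (ctr t) (3 * rad t) v).
    exists (ball (ctr t) (3 * rad t)) => //.
    have ob := ball_open (ctr t) (3 * rad t).
    by apply: Ck_mul => //; exact: Cinfty_box_bump.
  have [U [oO Ov HO]] := near_openE (bump0 t v nbv); exists U => //.
  apply: (@Ck_eq _ _ _ _ _ (cst 0)) => //; last exact: Ck_cst.
  by move=> w /HO ->; rewrite mul0r.
- move=> i; rewrite /B; case: unpickle => [t|]; last exact: open0.
  by case: asboolP => _; [exact: ball_open|exact: open0].
- move=> i v; rewrite /B /chi; case: unpickle => [t|//].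
  case: asboolP => // _ /(ball_rVP _ _ (rad0 t)) bv; apply: box_bump_eq1 => // j.
  by rewrite distrC ltW.
- rewrite /g /chi; case: unpickle => [t|]; last by rewrite mul0r.
  case: asboolP => [/HG [sG GE]|_]; last by rewrite mul0r.
  have [bv|nbv] := pselect (ball (ctr t) (3 * rad t) v); first by rewrite GE.
  by have /nbhs_singleton -> := bump0 t v nbv; rewrite !mul0r.
have AB : A `<=` \bigcup_i B i.
  move=> u Au; have [U [H [oO Ou sH HE]]] := sf u Au.
  have := open_nbhs_nbhs (conj oO Ou); move/nbhs_ballP => [d /= d0 dO].
  pose k := Num.bound (4 / d).
  pose rk : R := k.+1%:R^-1.
  have rk0 : 0 < rk by rewrite invr_gt0.
  have kd : 4 * rk < d.
    rewrite ltr_pdivrMr // mulrC -ltr_pdivrMr //.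
    have := archi_boundP (ltW (divr_gt0 (ltr0Sn R 3) d0)).
    by move/lt_le_trans; apply; rewrite ler_nat.
  have /choice [q Hq] j : exists q : rat, ratr q \in `]u 0 j - rk, u 0 j + rk[.
    by apply: rat_in_itvoo; lra.
  pose t : 'rV[rat]_n * nat := (\row_j q j, k).
  have Hc j : `|ctr t 0 j - u 0 j| < rk.
    rewrite !mxE; have := Hq j; rewrite in_itv /= => /andP[? ?].
    by rewrite ltr_norml; apply/andP; split; lra.
  have bO : ball (ctr t) (3 * rad t) `<=` U.
    move=> v /(ball_rVP _ _ (r3 t)) Hv; apply: dO; apply/ball_rVP => // j.
    have := Hv j; have := Hc j; rewrite distrC => H1 H2.
    apply: le_lt_trans (ler_distD (ctr t 0 j) _ _) _.
    move: H1 H2 kd; rewrite /rad /= -/rk; move: (`|_|) (`|_|) => a b; lra.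
  have vt : exists G', valid t G'.
    exists H; split; first by move=> m; apply: Ck_sub (sH m).
    by move=> v /bO Ov Av; exact: HE.
  exists (pickle t) => //; rewrite /B pickleK; case: asboolP => // _.
  by apply/(ball_rVP _ _ (rad0 t)) => j; exact: Hc.
exists (\bigcup_i B i), f'; split=> //.
- apply: bigcup_open => i _; rewrite /B; case: unpickle => [t|]; last exact: open0.
  by case: asboolP => _; [exact: ball_open|exact: open0].
- by move=> x Ax; apply: f'E => //; exact: AB.
Qed.

End Patch.

Lemma smooth_on_smooth_at n F (A : set 'rV[R]_n) (f : 'rV[R]_n -> F) u :
  smooth_on A f -> A u -> smooth_at A f u.
Proof.
move=> [_ [A' [f' [oA' AA' sf' fE]]]] Au.
by exists A', f'; split=> // [|v _]; [exact: AA'|exact: fE].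
Qed.

Lemma smooth_onP_real n (A : set 'rV[R]_n) (f : 'rV[R]_n -> R) :
  (forall u, A u -> smooth_at A f u) -> smooth_on A f.
Proof.
move=> sf; split; last exact: patch.
by apply/subspace_continuousP => u Au; apply: smooth_at_cvg => //; exact: sf.
Qed.

Lemma smooth_onP n m (A : set 'rV[R]_n) (f : 'rV[R]_n -> 'rV[R]_m) :
  (forall u, A u -> smooth_at A f u) -> smooth_on A f.
Proof.
move=> sf; split.
  by apply/subspace_continuousP => u Au; apply: smooth_at_cvg => //; exact: sf.
have /choice [A' /choice [f' H]] (j : 'I_m) : exists A' f', [/\ open A',
    A `<=` A', Cinfty A' f' & forall x, A x -> f' x = f x 0 j].
  by apply: patch => u /sf /smooth_at_rV /(_ j).
have oI : open [set v | forall i, A' i v].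
  by apply: open_forall => i; have [] := H i.
exists [set v | forall i, A' i v], (fun v => \row_i f' i v); split=> //.
- by move=> v Av i; have [_ AA' _ _] := H i; exact: AA'.
- move=> k; apply/Ck_rV => // i.
  have [_ _ sG _] := H i.
  apply: (@Ck_eq _ _ _ _ _ (f' i)) => //; first by move=> v _; rewrite mxE.
  by apply: Ck_sub (sG k) => v; apply.
- by move=> v Av; apply/rowP => i; rewrite mxE; have [_ _ _ ->] := H i.
Qed.

End SmoothAt.

(** * Charts and atlases *)

Section ChartBasics.
Context {R : realType} {n : nat} {T : topologicalType}.
Implicit Types (c d a : chart R n T) (u v : 'rV[R]_n) (x : T).

Definition active c u (i : 'I_n) : Prop := (i < corners c)%N /\ u 0 i = 0.

Lemma chart_imgE c u : chart_dom c u -> chart_img c (chart_map c u).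
Proof. by move=> cu; exists u. Qed.

Lemma chart_mapK c x : chart_img c x -> chart_map c (chart_inv c x) = x.
Proof. by move=> cx; apply: pinvK; rewrite inE. Qed.

Lemma chart_inv_dom c x : is_chart c -> chart_img c x ->
  chart_dom c (chart_inv c x).
Proof.
move=> [_ _ [[_ inj _] _ _] _ _] cx.
by have [H _ _] := injpinv_bij (fun=> 0) inj; exact: H.
Qed.

Lemma chart_invK c u : is_chart c -> chart_dom c u ->
  chart_inv c (chart_map c u) = u.
Proof.
move=> [_ _ [[_ inj _] _ _] _ _] cu.
by rewrite /chart_inv pinvKV // inE.
Qed.

Lemma chart_map_inj c u v : is_chart c -> chart_dom c u -> chart_dom c v ->
  chart_map c u = chart_map c v -> u = v.
Proof. by move=> Hc cu cv uv; rewrite -(chart_invK Hc cu) uv chart_invK. Qed.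

Lemma open_chart_img c : is_chart c -> open (chart_img c).
Proof. by case. Qed.

Lemma chart_near c u (P : T -> Prop) : is_chart c -> chart_dom c u ->
  (\forall y \near chart_map c u, P y) <->
  (\forall v \near u, chart_dom c v -> P (chart_map c v)).
Proof.
move=> Hc cu; have [_ _ [_ cf [g [gK cg]]] oi _] := Hc; split=> H.
  by have /subspace_continuousP /(_ u cu) := cf; apply.
have cx := chart_imgE cu.
have /subspace_continuousP /(_ _ cx) := cg; rewrite /from_subspace gK ?inE //.
move=> /(_ _ H) H'; have Hi := open_nbhs_nbhs (conj oi cx).
apply: filterS2 Hi H' => y cy /(_ cy).
by case: cy => w cw <-; rewrite /= gK ?inE //; apply.
Qed.

Lemma chart_near_inv c x (P : 'rV[R]_n -> Prop) : is_chart c -> chart_img c x ->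
  (\forall v \near chart_inv c x, chart_dom c v -> P v) ->
  \forall y \near x, P (chart_inv c y).
Proof.
move=> Hc cx H; have cu := chart_inv_dom Hc cx.
suff : \forall y \near chart_map c (chart_inv c x), P (chart_inv c y).
  by rewrite chart_mapK.
apply/chart_near => //.
by apply: filterS H => v H cv; rewrite chart_invK //; exact: H.
Qed.

Lemma chart_inv_continuous c x : is_chart c -> chart_img c x ->
  {for x, continuous (chart_inv c)}.
Proof.
move=> Hc cx P HP; apply: chart_near_inv => //.
exact: filterS HP.
Qed.

Lemma orthant_near k (u : 'rV[R]_n) : orthant k u ->
  \forall v \near u,
    (orthant k v <-> forall i : 'I_n, (i < k)%N -> u 0 i = 0 -> 0 <= v 0 i) /\
    forall i : 'I_n, (i < k)%N -> u 0 i <> 0 -> 0 < v 0 i.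
Proof.
move=> ou.
have H : \forall v \near u, forall i : 'I_n,
    (i < k)%N -> u 0 i <> 0 -> 0 < (v : 'rV[R]_n) 0 i.
  apply: (@filter_forall _ _ (fun (i : 'I_n) v => (i < k)%N -> u 0 i <> 0 ->
    0 < (v : 'rV[R]_n) 0 i) (nbhs u) (nbhs_filter u)) => i.
  have [ui|ui] := eqVneq (u 0 i) 0; first by apply: nearW => v _; rewrite ui.
  have [ik|ik] := boolP (i < k)%N; last by apply: nearW.
  have u0 : 0 < u 0 i by rewrite lt_neqAle eq_sym ui ou.
  have H : \forall v \near u, 0 < (v : 'rV[R]_n) 0 i.
    exact: (@coord_continuous R 1 n 0 i u _ (lt_nbhsr u0)).
  by apply: filterS H.
apply: filterS H => v Hv; split=> //; split=> [ov i ik _|H i ik]; first exact: ov.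
have [ui|/eqP ui] := eqVneq (u 0 i) 0; first exact: H.
by apply: ltW; exact: Hv.
Qed.

Lemma dom_orthant c u : is_chart c -> chart_dom c u -> orthant (corners c) u.
Proof. by move=> [_ [U _ ->] _ _ _] []. Qed.

Lemma chart_dom_near c u : is_chart c -> chart_dom c u -> \forall v \near u,
  (chart_dom c v <-> forall i, active c u i -> 0 <= v 0 i) /\
  forall i : 'I_n, (i < corners c)%N -> ~ active c u i -> 0 < v 0 i.
Proof.
move=> Hc cu; have ou := dom_orthant Hc cu.
have [_ [U oU dE] _ _ _] := Hc.
have HU : \forall v \near u, U v.
  by apply: near_open oU _ _ => //; move: cu; rewrite dE => -[].
apply: filterS2 HU (orthant_near ou) => v Uv [ov Hv]; split.
  rewrite dE; split=> [[+ _] i [ik ui]|H]; first by move/ov; exact.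
  by split=> //; apply/ov => i ik ui; apply: H.
by move=> i ik na; apply: Hv => // ui; exact: na.
Qed.

End ChartBasics.

Section MapsInCharts.
Context {R : realType}.

Lemma preimage_near m n (S T : topologicalType) (f : S -> T)
    (c : chart R m S) (d : chart R n T) u : continuous f -> is_chart c ->
  is_chart d -> chart_dom c u -> chart_img d (f (chart_map c u)) ->
  \forall v \near u, chart_dom c v -> chart_img d (f (chart_map c v)).
Proof.
move=> cf Hc Hd cu du.
have H : \forall y \near chart_map c u, chart_img d (f y).
  by apply: cf; apply: near_open (open_chart_img Hd) du _.
by move/(chart_near _ Hc cu): H.
Qed.

Lemma preimage_dom_near m n (S T : topologicalType) (f : S -> T)
    (c : chart R m S) (d : chart R n T) u : continuous f -> is_chart c ->
  is_chart d -> chart_dom c u -> chart_img d (f (chart_map c u)) ->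
  \forall v \near u, chart_dom c v ->
    chart_dom d ((chart_inv d \o f \o chart_map c) v).
Proof.
move=> cf Hc Hd cu du; apply: filterS (preimage_near cf Hc Hd cu du) => v H cv.
by apply: chart_inv_dom => //; exact: H.
Qed.

Lemma smooth_at_through m n k (S T : topologicalType) (f : S -> T)
    (c : chart R m S) (d : chart R n T) (g : T -> 'rV[R]_k) u :
  continuous f -> is_chart c -> is_chart d -> chart_dom c u ->
  chart_img d (f (chart_map c u)) ->
  smooth_at (chart_dom c) (chart_inv d \o f \o chart_map c) u ->
  smooth_at (chart_dom d) (g \o chart_map d) (chart_inv d (f (chart_map c u))) ->
  smooth_at (chart_dom c) (g \o f \o chart_map c) u.
Proof.
move=> cf Hc Hd cu du sf sg.
have := @smooth_at_comp R _ _ _ _ _ _ (g \o chart_map d) _ cu sf sg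
  (preimage_dom_near cf Hc Hd cu du).
apply: smooth_atS; apply: filterS (preimage_near cf Hc Hd cu du) => v H cv.
by split=> //=; rewrite chart_mapK //; exact: H.
Qed.

Lemma smooth_at_through_real m n (S T : topologicalType) (f : S -> T)
    (c : chart R m S) (d : chart R n T) (g : T -> R) u :
  continuous f -> is_chart c -> is_chart d -> chart_dom c u ->
  chart_img d (f (chart_map c u)) ->
  smooth_at (chart_dom c) (chart_inv d \o f \o chart_map c) u ->
  smooth_at (chart_dom d) (g \o chart_map d) (chart_inv d (f (chart_map c u))) ->
  smooth_at (chart_dom c) (g \o f \o chart_map c) u.
Proof.
move=> cf Hc Hd cu du sf sg.
have := @smooth_at_comp_real R _ _ _ _ _ (g \o chart_map d) _ cu sf sg
  (preimage_dom_near cf Hc Hd cu du).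
apply: smooth_atS; apply: filterS (preimage_near cf Hc Hd cu du) => v H cv.
by split=> //=; rewrite chart_mapK //; exact: H.
Qed.

End MapsInCharts.

Section Atlases.
Context {R : realType} {n : nat} {T : topologicalType}.
Implicit Types (c d a : chart R n T) (u v : 'rV[R]_n) (x : T).

Lemma transition_near c d u : is_chart c -> is_chart d -> chart_dom c u ->
  chart_img d (chart_map c u) ->
  \forall v \near u, chart_dom c v -> chart_img d (chart_map c v).
Proof. by move=> *; apply: (@preimage_near _ _ _ _ _ id) => // x; exact: cvg_id. Qed.

Definition smooth_transition c d : Prop :=
  forall u, chart_dom c u -> chart_img d (chart_map c u) ->
    smooth_at (chart_dom c) (chart_inv d \o chart_map c) u.

Lemma compatibleP c d : is_chart c -> is_chart d ->
  compatible c d <-> smooth_transition c d /\ smooth_transition d c.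
Proof.
move=> Hc Hd; rewrite /compatible.
set A := chart_dom c `&` _; set B := chart_dom d `&` _.
have AE u : A u <-> chart_dom c u /\ chart_img d (chart_map c u).
  by split=> [[cu [_ du]]|[cu du]] //; split=> //; split=> //; exact: chart_imgE.
have BE u : B u <-> chart_dom d u /\ chart_img c (chart_map d u).
  by split=> [[cu [du _]]|[cu du]] //; split=> //; split=> //; exact: chart_imgE.
have AB u : A u -> B (chart_inv d (chart_map c u)).
  move=> /AE [cu du]; apply/BE; split; first exact: chart_inv_dom.
  by rewrite chart_mapK //; exact: chart_imgE.
have BA u : B u -> A (chart_inv c (chart_map d u)).
  move=> /BE [cu du]; apply/AE; split; first exact: chart_inv_dom.
  by rewrite chart_mapK //; exact: chart_imgE.
have ABK u : A u -> chart_inv c (chart_map d (chart_inv d (chart_map c u))) = u.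
  by move=> /AE [cu du]; rewrite chart_mapK // chart_invK.
have BAK u : B u -> chart_inv d (chart_map c (chart_inv c (chart_map d u))) = u.
  by move=> /BE [cu du]; rewrite chart_mapK // chart_invK.
have inj : {in A &, injective (chart_inv d \o chart_map c)}.
  move=> u v; rewrite !inE => Au Av /= uv.
  by rewrite -(ABK u) // uv ABK.
have bij : set_bij A B (chart_inv d \o chart_map c).
  split=> // u Bu.
  by exists (chart_inv c (chart_map d u)); [exact: BA|exact: BAK].
have pE v : B v -> 'pinv_(fun=> 0) A (chart_inv d \o chart_map c) v =
    chart_inv c (chart_map d v).
  by move=> Bv; rewrite -[in LHS](BAK v) // pinvKV // inE; exact: BA.
have cAB : (forall u, A u -> smooth_at A (chart_inv d \o chart_map c) u) <->
    smooth_transition c d.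
  split=> H u.
    move=> cu du; have Au : A u by apply/AE.
    apply: smooth_atS (H u Au); apply: filterS (transition_near Hc Hd cu du).
    by move=> v Hv cv; split=> //; apply/AE; split=> //; exact: Hv.
  move=> /AE [cu du]; apply: smooth_atW (H u cu du).
  by move=> v /AE [].
have cBA : (forall u, B u -> smooth_at B (chart_inv c \o chart_map d) u) <->
    smooth_transition d c.
  split=> H u.
    move=> cu du; have Au : B u by apply/BE.
    apply: smooth_atS (H u Au); apply: filterS (transition_near Hd Hc cu du).
    by move=> v Hv cv; split=> //; apply/BE; split=> //; exact: Hv.
  move=> /BE [cu du]; apply: smooth_atW (H u cu du).
  by move=> v /BE [].
split=> [[_ s1 s2]|[/cAB s1 /cBA s2]].
  split; [apply/cAB|apply/cBA] => u Au; first exact: smooth_on_smooth_at.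
  apply: smooth_atW (smooth_on_smooth_at s2 Au).
  by move=> v Bv; split=> //; exact: pE.
split.
- split=> //.
    by apply/subspace_continuousP => u Au; apply: smooth_at_cvg => //; exact: s1.
  exists (chart_inv c \o chart_map d); split.
    by move=> u; rewrite inE => Au /=; exact: ABK.
  by apply/subspace_continuousP => u Bu; apply: smooth_at_cvg => //; exact: s2.
- exact: smooth_onP.
- apply: smooth_onP => u Bu; apply: smooth_atW (s2 u Bu).
  by move=> v Bv; split=> //=; rewrite pE.
Qed.

Section Rechart.
Variables (c a : chart R n T) (u : 'rV[R]_n).
Hypotheses (Hc : is_chart c) (Ha : is_chart a) (cu : chart_dom c u).
Hypothesis au : chart_img a (chart_map c u).
Hypothesis sca : smooth_at (chart_dom c) (chart_inv a \o chart_map c) u.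

Lemma smooth_at_rechart m (F : T -> 'rV[R]_m) :
  smooth_at (chart_dom a) (F \o chart_map a) (chart_inv a (chart_map c u)) ->
  smooth_at (chart_dom c) (F \o chart_map c) u.
Proof.
by apply: (@smooth_at_through _ _ _ _ _ _ id c a F) => // x; exact: cvg_id.
Qed.

Lemma smooth_at_rechart_real (F : T -> R) :
  smooth_at (chart_dom a) (F \o chart_map a) (chart_inv a (chart_map c u)) ->
  smooth_at (chart_dom c) (F \o chart_map c) u.
Proof.
by apply: (@smooth_at_through_real _ _ _ _ _ id c a F) => // x; exact: cvg_id.
Qed.

End Rechart.

Definition is_atlas (A : set (chart R n T)) : Prop :=
  [/\ forall c, A c -> is_chart c,
      forall c d, A c -> A d -> compatible c d &
      \bigcup_(c in A) chart_img c = setT].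

Lemma atlas_chart (A : set (chart R n T)) c : is_atlas A -> A c -> is_chart c.
Proof. by case=> H _ _; exact: H. Qed.

Lemma atlas_transition (A : set (chart R n T)) c d : is_atlas A ->
  A c -> A d -> smooth_transition c d.
Proof.
move=> [H1 H2 _] Ac Ad.
by have /compatibleP [] := H2 c d Ac Ad; try exact: H1.
Qed.

Lemma atlas_cover (A : set (chart R n T)) x : is_atlas A ->
  exists2 c, A c & chart_img c x.
Proof.
move=> [_ _ AT]; have : (setT : set T) x by [].
by rewrite -AT => -[c Ac cx]; exists c.
Qed.

Lemma atlas_sub_max (A : set (chart R n T)) : is_atlas A -> A `<=` max_atlas A.
Proof.
move=> [H1 H2 H3] c Ac; split; first exact: H1.
by move=> a Aa; exact: H2.
Qed.

Lemma is_atlas_max (A : set (chart R n T)) : is_atlas A -> is_atlas (max_atlas A).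
Proof.
move=> HA; have [H1 H2 H3] := HA; split=> [c [] //||].
  have tr c d : max_atlas A c -> max_atlas A d -> smooth_transition c d.
    move=> [Hc cA] [Hd dA] u cu du.
    have [a Aa au] := atlas_cover (chart_map c u) HA.
    have Ha := H1 a Aa.
    have /compatibleP [//|//|ca _] := cA a Aa.
    have /compatibleP [//|//|_ ad] := dA a Aa.
    apply: (smooth_at_rechart Hc Ha) => //; first exact: ca.
    by apply: ad; [exact: chart_inv_dom|rewrite chart_mapK].
  move=> c d Ac Ad; have [Hc _] := Ac; have [Hd _] := Ad.
  by apply/compatibleP => //; split; exact: tr.
rewrite -subTset -H3 => x [c Ac cx]; exists c => //; exact: atlas_sub_max.
Qed.

End Atlases.

(** * Tangent cones *)

Section OneSided.
Context {R : realType}.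

Lemma derive_right_cvg (E : normedModType R) (f : E -> R) u v : derivable f u v ->
  (fun t : R => t^-1 * (f (t *: v + u) - f u)) @ 0^'+ --> 'D_v f u.
Proof. by move=> df; apply: cvg_dnbhs_at_right; exact: df. Qed.

Lemma line_cvg (E : normedModType R) (u v : E) :
  (fun t : R => t *: v + u) @ 0^'+ --> u.
Proof.
apply: cvg_at_right_filter; rewrite -[X in _ --> X]add0r -(scale0r v).
apply: cvgD; last exact: cvg_cst.
by apply: cvgZr_tmp; exact: cvg_id.
Qed.

Lemma near_line (E : normedModType R) (u v : E) (P : E -> Prop) :
  (\forall w \near u, P w) -> \forall t \near 0^'+, P ((t : R) *: v + u).
Proof. by move=> H; exact: (@line_cvg E u v _ H). Qed.

Lemma derive_ge0_right (E : normedModType R) (f : E -> R) u v : derivable f u v ->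
  (\forall t \near 0^'+, f u <= f ((t : R) *: v + u)) -> 0 <= 'D_v f u.
Proof.
move=> df H; apply: (cvgr_to_ge (derive_right_cvg df)).
have H0 : \forall t \near 0^'+, 0 < (t : R) by exact: nbhs_right_gt.
by apply: filterS2 H H0 => t H t0; rewrite mulr_ge0 ?invr_ge0 ?subr_ge0 // ltW.
Qed.

Lemma derive_eq_right (E : normedModType R) (f : E -> R) u v a : derivable f u v ->
  (\forall t \near 0^'+, f ((t : R) *: v + u) = f u + t * a) -> 'D_v f u = a.
Proof.
move=> df H; have H1 := derive_right_cvg df.
have H0 : \forall t \near 0^'+, 0 < (t : R) by exact: nbhs_right_gt.
apply: (cvg_unique _ H1); first exact: Rhausdorff.
have : (fun=> a : R) @ (0 : R)^'+ --> a by exact: cvg_cst.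
apply: cvg_trans; apply: near_eq_cvg; apply: filterS2 H H0 => t -> t0.
by rewrite addrAC subrr add0r mulKf // gt_eqF.
Qed.

Lemma derive_sum_delta n (f : 'rV[R]_n -> R) u v : differentiable f u ->
  'D_v f u = \sum_i v 0 i * 'D_(delta_mx 0 i) f u.
Proof.
move=> df; rewrite deriveE // [in LHS](row_sum_delta v) linear_sum.
by apply: eq_bigr => i _; rewrite linearZ /= -deriveE.
Qed.

Definition dmat m n (F : 'rV[R]_m -> 'rV[R]_n) u : 'M[R]_(m, n) :=
  \matrix_(i, j) 'D_(delta_mx 0 i) (fun v => F v 0 j) u.

Lemma mul_dmat m n (F : 'rV[R]_m -> 'rV[R]_n) u v j :
  differentiable (fun v => F v 0 j) u ->
  (v *m dmat F u) 0 j = 'D_v (fun v => F v 0 j) u.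
Proof.
move=> dF; rewrite derive_sum_delta // mxE.
by apply: eq_bigr => i _; rewrite mxE.
Qed.

Definition cone n k (u : 'rV[R]_n) : set 'rV[R]_n :=
  [set v | forall i : 'I_n, (i < k)%N -> u 0 i = 0 -> 0 <= v 0 i].

End OneSided.

Section ChartDerivative.
Context {R : realType}.

Lemma cone_near n (T : topologicalType) (c : chart R n T) u v :
  is_chart c -> chart_dom c u -> cone (corners c) u v ->
  \forall t \near 0^'+, chart_dom c ((t : R) *: v + u).
Proof.
move=> Hc cu Cv; have H0 : \forall t \near 0^'+, 0 < (t : R) by exact: nbhs_right_gt.
apply: filterS2 H0 (near_line v (chart_dom_near Hc cu)) => t t0 [-> _] i [ik ui].
by rewrite !mxE ui addr0 mulr_ge0 ?Cv // ltW.
Qed.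

Lemma cone_subr n k (u v : 'rV[R]_n) : exists v1 v2,
  [/\ cone k u v1, cone k u v2 & v = v1 - v2].
Proof.
exists (v + const_mx `|v|), (const_mx `|v|); split.
- move=> i _ _; rewrite !mxE -lerBlDr sub0r.
  by have := norm_coord v i; rewrite ler_norml => /andP[].
- by move=> i _ _; rewrite mxE.
- by rewrite addrK.
Qed.

Lemma ext_diff m n (D : set 'rV[R]_m) (F1 : 'rV[R]_m -> 'rV[R]_n) v j :
  Cinfty D F1 -> D v -> differentiable (fun v => F1 v 0 j) v.
Proof.
move=> sF1 Dv; apply: (@differentiable_comp _ _ _ _ F1 (fun w : 'rV[R]_n => w 0 j)).
  by have [dF1 _] := sF1 1%N; exact: dF1.
exact: differentiable_coord.
Qed.

Section Pair.
Variables (m n : nat) (S T : topologicalType) (c : chart R m S) (d : chart R n T).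
Variables (F : 'rV[R]_m -> 'rV[R]_n) (G : 'rV[R]_n -> 'rV[R]_m) (u : 'rV[R]_m).
Hypotheses (Hc : is_chart c) (Hd : is_chart d) (cu : chart_dom c u).
Hypothesis sF : smooth_at (chart_dom c) F u.
Hypothesis FD : \forall v \near u, chart_dom c v -> chart_dom d (F v).
Let dFu : chart_dom d (F u). Proof. exact: (nbhs_singleton FD). Qed.

Lemma cone_dmat F1 (D : set 'rV[R]_m) v : D u -> open D -> Cinfty D F1 ->
  (forall w, D w -> chart_dom c w -> F1 w = F w) ->
  cone (corners c) u v -> cone (corners d) (F u) (v *m dmat F1 u).
Proof.
move=> Du oD sF1 F1E Cv j jk Fj.
have dF := ext_diff j sF1 Du.
rewrite mul_dmat //; apply: derive_ge0_right; first exact: diff_derivable.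
have nD : \forall w \near u, D w by exact: near_open oD Du _.
have H : \forall w \near u, D w /\ (chart_dom c w -> chart_dom d (F w)).
  exact: filterI nD FD.
apply: filterS2 (near_line v H) (cone_near Hc cu Cv) => t [Dt FDt] ct.
rewrite !F1E // Fj; apply: (dom_orthant Hd) => //; exact: FDt.
Qed.

Hypothesis sG : smooth_at (chart_dom d) G (F u).
Hypothesis GF : \forall v \near u, chart_dom c v -> G (F v) = v.

Lemma dmat_inverse F1 G1 (D : set 'rV[R]_m) (D' : set 'rV[R]_n) :
  D u -> open D -> Cinfty D F1 -> D' (F u) -> open D' -> Cinfty D' G1 ->
  (forall w, D w -> chart_dom c w -> F1 w = F w) ->
  (forall w, D' w -> chart_dom d w -> G1 w = G w) ->
  dmat F1 u *m dmat G1 (F u) = 1%:M.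
Proof.
move=> Du oD sF1 Du' oD' sG1 F1E G1E.
have F1u : F1 u = F u by exact: F1E.
have main v : cone (corners c) u v -> v *m dmat F1 u *m dmat G1 (F u) = v.
  move=> Cv; apply/rowP => i.
  have dG := ext_diff i sG1 Du'.
  have dF : differentiable F1 u by have [dF1 _] := sF1 1%N; exact: dF1.
  have dG1 : differentiable (fun w => G1 w 0 i) (F1 u) by rewrite F1u.
  rewrite mul_dmat // derive_sum_delta //.
  transitivity ('D_v (fun w => G1 (F1 w) 0 i) u).
    rewrite (derive_comp v dF dG1) F1u; apply: eq_bigr => j _.
    by rewrite mul_dmat //; exact: ext_diff sF1 _.
  apply: derive_eq_right.
    apply: diff_derivable.
    exact: (@differentiable_comp _ _ _ _ F1 (fun w => G1 w 0 i)).
  have cF1 : {for u, continuous F1} by exact: differentiable_continuous.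
  have H : \forall w \near u, [/\ D w, D' (F1 w),
      chart_dom c w -> chart_dom d (F w) & chart_dom c w -> G (F w) = w].
    have nD : \forall w \near u, D w by exact: near_open oD Du _.
    have nD' : \forall w \near u, D' (F1 w).
      by apply: cF1; rewrite F1u; exact: open_nbhs_nbhs.
    by apply: filterS2 (filterI nD nD') (filterI FD GF) => w [? ?] [].
  apply: filterS2 (near_line v H) (cone_near Hc cu Cv).
  move=> t [Dt D't FDt GFt] ct.
  have -> : G1 (F1 u) = u by rewrite F1u G1E // (nbhs_singleton GF).
  have FE : F1 (t *: v + u) = F (t *: v + u) by exact: F1E.
  have dFt := FDt ct; rewrite FE in D't *.
  by rewrite G1E // GFt // !mxE addrC.
apply/row_matrixP => i; rewrite !rowE mulmxA mulmx1.
have [v1 [v2 [C1 C2 ->]]] := cone_subr (corners c) u (delta_mx 0 i).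
by rewrite !mulmxBl !main.
Qed.

End Pair.

Section Inverse.
Variables (m n : nat) (S T : topologicalType) (c : chart R m S) (d : chart R n T).
Variables (F : 'rV[R]_m -> 'rV[R]_n) (G : 'rV[R]_n -> 'rV[R]_m) (u : 'rV[R]_m).
Hypotheses (Hc : is_chart c) (Hd : is_chart d) (cu : chart_dom c u).
Hypothesis sF : smooth_at (chart_dom c) F u.
Hypothesis sG : smooth_at (chart_dom d) G (F u).
Hypothesis FD : \forall v \near u, chart_dom c v -> chart_dom d (F v).
Hypothesis GD : \forall v \near F u, chart_dom d v -> chart_dom c (G v).
Hypothesis GF : \forall v \near u, chart_dom c v -> G (F v) = v.
Hypothesis FG : \forall v \near F u, chart_dom d v -> F (G v) = v.

Lemma tangent_cone_iso : exists (A : 'M[R]_(m, n)) (B : 'M[R]_(n, m)),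
  [/\ A *m B = 1%:M, B *m A = 1%:M,
      forall v, cone (corners c) u v -> cone (corners d) (F u) (v *m A) &
      forall w, cone (corners d) (F u) w -> cone (corners c) u (w *m B)].
Proof.
have dFu : chart_dom d (F u) by exact: (nbhs_singleton FD).
have GFu : G (F u) = u by exact: (nbhs_singleton GF).
have [D [F1 [oD Du sF1 F1E]]] := sF.
have [D' [G1 [oD' Du' sG1 G1E]]] := sG.
have GFu' : D (G (F u)) by rewrite GFu.
have cu' : chart_dom c (G (F u)) by rewrite GFu.
exists (dmat F1 u), (dmat G1 (F u)); split.
- exact: (dmat_inverse Hc cu FD GF Du oD sF1 Du' oD' sG1 F1E G1E).
- have := dmat_inverse Hd dFu GD FG Du' oD' sG1 GFu' oD sF1 G1E F1E.
  by rewrite GFu.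
- by move=> v; apply: (@cone_dmat _ _ _ _ c d F u Hc Hd cu FD F1 D).
- move=> w Cw; have := @cone_dmat _ _ _ _ d c G (F u) Hd Hc dFu GD G1 D'.
  by rewrite GFu; apply.
Qed.

Lemma dim_eq : m = n.
Proof.
have [A [B [AB BA _ _]]] := tangent_cone_iso.
by apply/eqP; rewrite eqn_leq (mulmx1_min AB) (mulmx1_min BA).
Qed.

Definition sole_active n' (T' : topologicalType) (e : chart R n' T') v i :=
  active e v i /\ forall j, active e v j -> j = i.

Lemma sole_active_transfer i : sole_active c u i ->
  exists j, sole_active d (F u) j.
Proof.
move=> [[ik ui] iU]; have [A [B [AB BA CA CB]]] := tangent_cone_iso.
have half v : cone (corners c) u v <-> 0 <= v 0 i.
  split=> [|vi j jk uj]; first exact.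
  by rewrite (iU j).
have [j aj] : exists j, active d (F u) j.
  apply: contrapT => nj.
  have : cone (corners d) (F u) (- delta_mx 0 i *m A).
    by move=> j jk uj; exfalso; apply: nj; exists j.
  move/CB/half; rewrite -mulmxA AB mulmx1 !mxE !eqxx /=; lra.
exists j; split=> // j' aj'; apply: contrapT => jj'.
have nj : (j == j') = false by apply/eqP => E; apply: jj'.
pose w : 'rV[R]_n := delta_mx 0 j - delta_mx 0 j'.
have wA : w *m B *m A = w by rewrite -mulmxA BA mulmx1.
have [wi|wi] := leP 0 ((w *m B) 0 i).
  have /CA := (half _).2 wi; rewrite wA => /(_ j' aj'.1 aj'.2).
  by rewrite !mxE !eqxx eq_sym nj /=; lra.
have /CA : cone (corners c) u (- w *m B).
  by apply/half; rewrite mulNmx mxE; lra.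
rewrite -mulmxA BA mulmx1 => /(_ j aj.1 aj.2).
by rewrite !mxE !eqxx nj /=; lra.
Qed.

End Inverse.
End ChartDerivative.

(** * The depth-one stratum in a chart *)

Lemma open_coord_gt0 (R : realType) n j : open [set v : 'rV[R]_n | 0 < v 0 j].
Proof.
rewrite openE => v v0.
exact: (@coord_continuous R 1 n 0 j v _ (lt_nbhsr v0)).
Qed.

Section Components.
Context {R : realType} (X : charted R).
Hypothesis HX : is_atlas (atlas X).
Implicit Types (c d : chart R (dim X) X) (u v : 'rV[R]_(dim X)) (x y : X).

Let ac c : atlas X c -> is_chart c. Proof. exact: atlas_chart. Qed.

Lemma atlas_transfer c d u (F := chart_inv d \o chart_map c)
    (G := chart_inv c \o chart_map d) :
  atlas X c -> atlas X d -> chart_dom c u -> chart_img d (chart_map c u) ->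
  [/\ smooth_at (chart_dom c) F u, smooth_at (chart_dom d) G (F u),
      \forall v \near u, chart_dom c v -> chart_dom d (F v) &
      \forall v \near u, chart_dom c v -> G (F v) = v].
Proof.
move=> Ac Ad cu du; have Hc := ac Ac; have Hd := ac Ad.
have tn := transition_near Hc Hd cu du; split.
- exact: (atlas_transition HX).
- apply: (atlas_transition HX) => //=; first exact: chart_inv_dom.
  by rewrite chart_mapK //; exact: chart_imgE.
- by apply: filterS tn => v H cv; apply: chart_inv_dom => //; exact: H.
- apply: filterS tn => v H cv; rewrite /F /G /= chart_mapK ?chart_invK //.
  exact: H.
Qed.

Lemma stratum1P c u : atlas X c -> chart_dom c u ->
  depth_stratum 1 (chart_map c u) <-> exists i, sole_active c u i.
Proof.
have E e v : #|[set i : 'I_(dim X) | (i < corners e)%N && (v 0 i == 0)]%SET| = 1%N <->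
    exists i, sole_active (e : chart R (dim X) X) v i.
  split=> [/eqP/cards1P [i /setP iE]|[i [[ik vi] iU]]].
    have iE' j : active e v j <-> j = i.
      have := iE j; rewrite !inE => jE; split=> [[jk /eqP vj]|->].
        by move: jE; rewrite jk vj => /esym /eqP.
      by move: (iE i); rewrite !inE eqxx => /andP[ik /eqP].
    by exists i; split=> [|j /iE' //]; apply/iE'.
  apply/eqP/cards1P; exists i; apply/setP => j; rewrite !inE.
  apply/andP/eqP => [[jk /eqP vj]|->]; last by rewrite ik vi.
  exact: iU.
move=> Ac cu; split=> [[d [v [Ad dv vu /E [i Hi]]]]|H]; last first.
  by exists c, u; split=> //; apply/E.
have cv : chart_img c (chart_map d v) by rewrite vu; exact: chart_imgE.
have [sF sG FD GF] := atlas_transfer Ad Ac dv cv.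
have FE : (chart_inv c \o chart_map d) v = u by rewrite /= vu chart_invK //; exact: ac.
have du : chart_img d (chart_map c u) by rewrite -vu; exact: chart_imgE.
have [_ _ GD FG] := atlas_transfer Ac Ad cu du.
have := sole_active_transfer (ac Ad) (ac Ac) dv sF sG FD _ GF _ Hi.
by rewrite FE; apply.
Qed.

Definition adapted c u (r : R) : Prop :=
  0 < r /\ forall v, ball u r v ->
    (chart_dom c v <-> forall i, active c u i -> 0 <= v 0 i) /\
    (forall i : 'I_(dim X), (i < corners c)%N -> ~ active c u i -> 0 < v 0 i).

Lemma adapted_ex c u (P : X -> Prop) : is_chart c -> chart_dom c u ->
  (\forall y \near chart_map c u, P y) -> exists r, adapted c u r /\
    forall v, ball u r v -> chart_dom c v -> P (chart_map c v).
Proof.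
move=> Hc cu /(chart_near _ Hc cu) H.
have H' : \forall v \near u, (chart_dom c v -> P (chart_map c v)) /\
    ((chart_dom c v <-> forall i, active c u i -> 0 <= v 0 i) /\
    (forall i : 'I_(dim X), (i < corners c)%N -> ~ active c u i -> 0 < v 0 i)).
  exact: filterI H (chart_dom_near Hc cu).
have /nbhs_ballP[r /= r0 Hr] := H'.
by exists r; split; [split=> // v /Hr []|move=> v /Hr []].
Qed.

Lemma adapted_le c u r r' : 0 < r' -> r' <= r -> adapted c u r -> adapted c u r'.
Proof.
move=> r0 rr [_ H]; split=> // v bv; apply: H; exact: le_ball bv.
Qed.

Definition facet c u r i : set 'rV[R]_(dim X) :=
  [set v | [/\ ball u r v, chart_dom c v & sole_active c v i]].

Lemma active_adapted c u r v i : adapted c u r -> ball u r v -> active c v i ->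
  active c u i.
Proof.
move=> [_ H] bv [ik vi]; apply: contrapT => na.
by have [_ /(_ i ik na)] := H v bv; rewrite vi ltxx.
Qed.

Lemma facetP c u r i v : adapted c u r -> active c u i ->
  facet c u r i v <->
  [/\ ball u r v, v 0 i = 0 & forall j, active c u j -> j <> i -> 0 < v 0 j].
Proof.
move=> Hr [ik ui]; split=> [[bv cv [[_ vi] iU]]|[bv vi H]].
  split=> // j [jk uj] ji; rewrite lt_neqAle; apply/andP; split.
    by apply/eqP => vj; apply: ji; apply: iU; split.
  by apply: (((proj2 Hr) v bv).1.1 cv).
split=> //.
  apply/((proj2 Hr) v bv).1 => j aj; have [->|/eqP ji] := eqVneq j i.
    by rewrite vi.
  by apply: ltW; exact: H.
split=> [|j [jk vj]]; first by split.
apply: contrapT => ji; have aj := active_adapted Hr bv (conj jk vj).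
by have := H j aj ji; rewrite vj ltxx.
Qed.

Lemma star_connected n (K : set 'rV[R]_n) :
  (forall (v w : 'rV[R]_n) (t : R), K v -> K w -> 0 <= t <= 1 -> K (v + t *: (w - v))) ->
  connected K.
Proof.
move=> H; have [->|/set0P [v Kv]] := eqVneq K set0; first exact: connected0.
have -> : K = \bigcup_(w in K) [set v + t *: (w - v) | t in `[0, 1]].
  apply/seteqP; split=> [w Kw|w [w' Kw' [t]]].
    exists w => //; exists 1; first by rewrite /= in_itv /= ler01 lexx.
    by rewrite scale1r addrC subrK.
  by rewrite /= in_itv /= => t01 <-; exact: H.
apply: bigcup_connected.
  by exists v => w Kw; exists 0; [rewrite /= in_itv /= ler01 lexx|rewrite scale0r addr0].
move=> w Kw; apply: connected_continuous_connected; first exact: segment_connected.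
apply: continuous_subspaceT => t; apply: cvgD; first exact: cvg_cst.
by apply: cvgZr_tmp; exact: cvg_id.
Qed.

Lemma facet_connected c u r i : adapted c u r -> active c u i ->
  connected (facet c u r i).
Proof.
move=> Hr ai; have [r0 _] := Hr; apply: star_connected => v w t.
move=> /(facetP _ Hr ai) [bv vi Hv] /(facetP _ Hr ai) [bw wi Hw] t01.
apply/facetP => //; split.
- by apply: (ball_line r0) => //; rewrite addrC subrK.
- by rewrite !mxE vi wi subr0 mulr0 addr0.
- move=> j aj ji; have := Hv j aj ji; have := Hw j aj ji; rewrite !mxE.
  move: (v 0 j) (w 0 j) t01 => a b /andP[t0 t1] b0 a0.
  have [->|tn0] := eqVneq t 0; first by lra.
  have {tn0}tp : 0 < t by rewrite lt_neqAle eq_sym tn0.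
  by nra.
Qed.

Lemma facet_image_connected c u r i : is_chart c -> adapted c u r ->
  active c u i -> connected (chart_map c @` facet c u r i).
Proof.
move=> Hc Hr ai; apply: connected_continuous_connected.
  exact: facet_connected.
have [_ _ [_ + _] _ _] := Hc; apply: continuous_subspaceW.
by move=> v [].
Qed.

Lemma facet_dense c u r i v (e : R) : adapted c u r -> active c u i -> 0 < e ->
  ball u r v -> chart_dom c v -> v 0 i = 0 -> exists w, facet c u r i w /\ ball v e w.
Proof.
move=> Hr ai e0 bv cv vi; have [r0 _] := Hr.
have : \forall w \near v, ball u r w by apply: near_open (ball_open u r) bv _.
move=> /nbhs_ballP [e1 /= e10 He1].
pose e2 := Num.min e e1 / 2.
have m0 : 0 < Num.min e e1 by rewrite lt_min e0.
have e20 : 0 < e2 by rewrite divr_gt0.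
pose w : 'rV[R]_(dim X) := \row_j (if j == i then 0 else v 0 j + e2).
have bw : ball v (Num.min e e1) w.
  apply/ball_rVP => // j; rewrite mxE; case: eqP => [->|_].
    by rewrite vi subrr normr0.
  rewrite opprD addNKr normrN gtr0_norm // /e2.
  by rewrite ltr_pdivrMr // ltr_pMr // ltr1n.
exists w; split; last by apply: le_ball bw; rewrite ge_min lexx.
apply/facetP => //; split.
- by apply: He1; apply: le_ball bw; rewrite ge_min lexx orbT.
- by rewrite mxE eqxx.
- move=> j aj /eqP ji; rewrite mxE (negbTE ji).
  by rewrite ltr_wpDl // ((proj2 Hr) v bv).1.1.
Qed.

Lemma facet_nonempty c u r i : adapted c u r -> active c u i -> chart_dom c u ->
  exists v, facet c u r i v.
Proof.
move=> Hr ai cu; have [r0 _] := Hr; have [_ ui] := ai.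
have [w [? _]] := facet_dense Hr ai ltr01 (ballxx u r0) cu ui.
by exists w.
Qed.

Lemma facet_le c u r r' i : r <= r' -> facet c u r i `<=` facet c u r' i.
Proof. by move=> rr v [bv cv sv]; split=> //; exact: le_ball bv. Qed.

Lemma open_chart_preimage c (U : set 'rV[R]_(dim X)) : is_chart c -> open U ->
  open [set y | chart_img c y /\ U (chart_inv c y)].
Proof.
move=> Hc oU; rewrite openE => y [cy Uy].
have H1 : \forall z \near y, U (chart_inv c z).
  by apply: (chart_inv_continuous Hc cy); exact: open_nbhs_nbhs.
have H2 : \forall z \near y, chart_img c z.
  exact: near_open (open_chart_img Hc) cy _.
exact: filterI H2 H1.
Qed.

Lemma component_facet c u r (V : set X) y : atlas X c -> adapted c u r ->
  chart_dom c u ->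
  V `<=` chart_map c @` (chart_dom c `&` ball u r) ->
  (V `&` depth_stratum 1) y ->
  exists2 i, active c u i &
    connected_component (V `&` depth_stratum 1) y `<=` chart_map c @` facet c u r i.
Proof.
move=> Ac Hr cu VB Sy; have Hc := ac Ac.
have E z : (V `&` depth_stratum 1) z -> exists v i, facet c u r i v /\ chart_map c v = z.
  move=> [Vz S1]; have [v [cv bv] vz] := VB z Vz.
  move: S1; rewrite -vz => /(stratum1P Ac cv) [i Hi].
  by exists v, i.
have [v0 [i [[bv cv [[ik vi] iU]] vy]]] := E y Sy.
exists i; first by apply: active_adapted Hr bv _; split.
set W := connected_component _ _.
pose U1 := [set v : 'rV[R]_(dim X) |
  forall j : 'I_(dim X), (j < corners c)%N && (j != i) ==> (0 < v 0 j)].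
have oU1 : open U1.
  apply: (@open_forall _ _ (fun (j : 'I_(dim X)) =>
    [set v : 'rV[R]_(dim X) | (j < corners c)%N && (j != i) ==> (0 < v 0 j)])) => j.
  case: (_ && _); last first.
    by rewrite (_ : mkset _ = setT); [exact: openT|apply/seteqP; split].
  exact: (@open_coord_gt0 R _ j).
pose U2 := [set v : 'rV[R]_(dim X) | 0 < v 0 i].
have oU2 : open U2 by exact: open_coord_gt0.
pose C1 := [set y | chart_img c y /\ U1 (chart_inv c y)].
pose C2 := [set y | chart_img c y /\ U2 (chart_inv c y)].
have WS z : W z -> (V `&` depth_stratum 1) z by exact: connected_component_sub.
have CC : W `&` C1 = W `&` ~` C2.
  apply/seteqP; split=> z [Wz Cz]; split=> //;
    have [v [j [[bv' cv' [[jk vj] jU]] vz]]] := E z (WS z Wz);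
    have zc : chart_img c z by rewrite -vz; exact: chart_imgE.
    move: Cz => [_]; rewrite -vz chart_invK // => Uv [_].
    rewrite chart_invK //; rewrite /U2 /=; have [ji|ji] := eqVneq j i.
      by rewrite -ji vj ltxx.
    by have := Uv j; rewrite jk ji vj ltxx.
  split=> //; rewrite -vz chart_invK // => l; apply/implyP => /andP[lk li].
  have vi0 : v 0 i = 0.
    apply/eqP; rewrite eq_le (dom_orthant Hc cv') // andbT leNgt; apply/negP => vi0.
    by apply: Cz; split=> //; rewrite -vz chart_invK.
  have ij : i = j by apply: jU.
  rewrite lt_neqAle (dom_orthant Hc cv') // andbT eq_sym.
  by apply/eqP => vl; move/eqP: li; apply; rewrite ij; apply: jU.
have BW : W `&` C1 = W.
  apply: (@component_connected X (V `&` depth_stratum 1) y).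
  - exists y; split; first exact: connected_component_refl.
    split; first by rewrite -vy; exact: chart_imgE.
    rewrite -vy chart_invK // => l; apply/implyP => /andP[lk /eqP li].
    rewrite lt_neqAle (dom_orthant Hc cv) // andbT eq_sym.
    by apply/eqP => vl; apply: li; exact: iU.
  - by exists C1 => //; apply: open_chart_preimage.
  - exists (~` C2) => //; apply: open_closedC; exact: open_chart_preimage.
move=> z Wz; have [v [j [fv vz]]] := E z (WS z Wz).
have [bv' cv' [[jk vj] jU]] := fv.
have : (W `&` C1) z by rewrite BW.
move=> [_ [_]]; rewrite -vz chart_invK // => /(_ j); rewrite jk vj ltxx implybF /=.
by rewrite negbK => /eqP ji; exists v => //; rewrite -ji.
Qed.

End Components.

(** * Local boundary components and faces *)

Section Faces.
Context {R : realType} (X : charted R).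
Hypothesis HX : is_atlas (atlas X).
Implicit Types (c d : chart R (dim X) X) (u v : 'rV[R]_(dim X)) (x y : X).
Implicit Types (w : set X -> set X) (i j : 'I_(dim X)).

Let ac c : atlas X c -> is_chart c. Proof. exact: atlas_chart. Qed.

Definition in_face c u i w : Prop := exists V0,
  [/\ open V0, V0 (chart_map c u) &
      forall V, small_nbhd (chart_map c u) V0 V ->
        w V `<=` chart_map c @` (chart_dom c `&` [set v | v 0 i = 0])].

Lemma small_nbhdI x V0 V1 V : small_nbhd x (V0 `&` V1) V ->
  small_nbhd x V0 V /\ small_nbhd x V1 V.
Proof. by move=> [oV Vx VV]; split; split=> // y /VV []. Qed.

Lemma image_ball_open c u r : is_chart c -> chart_dom c u -> 0 < r ->
  exists V, [/\ open V, V (chart_map c u) &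
    V = chart_map c @` (chart_dom c `&` ball u r)].
Proof.
move=> Hc cu r0; exists [set y | chart_img c y /\ ball u r (chart_inv c y)]; split.
- by apply: open_chart_preimage => //; exact: ball_open.
- by split; [exact: chart_imgE|rewrite chart_invK //; exact: ballxx].
- apply/seteqP; split=> [y [cy by_]|y [v [cv bv] <-]].
    by exists (chart_inv c y); [split=> //; exact: chart_inv_dom|exact: chart_mapK].
  by split; [exact: chart_imgE|rewrite chart_invK].
Qed.

Lemma sole_activeP c v i z : atlas X c -> depth_stratum 1 z ->
  (chart_map c @` (chart_dom c `&` [set v | v 0 i = 0])) z -> (i < corners c)%N ->
  chart_dom c v -> chart_map c v = z -> sole_active c v i.
Proof.
move=> Ac Sz [v' [cv' vi'] vz'] ik cv vz.
have vv : v = v' by apply: (chart_map_inj (ac Ac)) => //; rewrite vz vz'.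
move: Sz; rewrite -vz => /(stratum1P HX Ac cv) [j [aj jU]].
have ij : i = j by apply: jU; split=> //; rewrite vv.
by rewrite ij.
Qed.

Lemma facet_sub_choice c u i w : atlas X c -> chart_dom c u -> active c u i ->
  component_choice (chart_map c u) w -> in_face c u i w ->
  exists V0, [/\ open V0, V0 (chart_map c u) & forall V,
    small_nbhd (chart_map c u) V0 V -> forall r, adapted c u r ->
    (forall v, ball u r v -> chart_dom c v -> V (chart_map c v)) ->
    chart_map c @` facet c u r i `<=` w V].
Proof.
move=> Ac cu ai [V0 [oV0 V0x comp _]] [V1 [oV1 V1x face]]; have Hc := ac Ac.
exists (V0 `&` V1); split=> //; first exact: openI.
move=> V /small_nbhdI [sV0 sV1] r Hr rV.
have [[y Sy wE] clw] := comp V sV0; have wface := face V sV1.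
have [r0 _] := Hr; have [B [oB Bx BE]] := image_ball_open Hc cu r0.
have [z [wz]] := clw B (open_nbhs_nbhs (conj oB Bx)).
rewrite BE => -[v [cv bv] vz].
have [_ Sz] : (V `&` depth_stratum 1) z.
  by move: wz; rewrite wE; exact: connected_component_sub.
have sv : sole_active c v i.
  by apply: sole_activeP Sz (wface z wz) _ cv vz => //; case: ai.
have Kz : (chart_map c @` facet c u r i) z by exists v.
have KS : chart_map c @` facet c u r i `<=` V `&` depth_stratum 1.
  move=> _ [v' [bv' cv' sv'] <-]; split; first exact: rV.
  by apply/(stratum1P HX) => //; exists i.
rewrite wE; rewrite wE in wz; rewrite (same_connected_component wz).
by apply: connected_component_max => //; exact: facet_image_connected.
Qed.

Lemma in_face_ex c u w : atlas X c -> chart_dom c u ->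
  component_choice (chart_map c u) w -> exists2 i, active c u i & in_face c u i w.
Proof.
move=> Ac cu [V0 [oV0 V0x comp meet]]; have Hc := ac Ac.
have [r [Hr rV0]] := adapted_ex Hc cu (open_nbhs_nbhs (conj oV0 V0x)).
have [r0 _] := Hr; have [B [oB Bx BE]] := image_ball_open Hc cu r0.
have BV0 : B `<=` V0 by rewrite BE => _ [v [cv bv] <-]; exact: rV0.
have sB V : small_nbhd (chart_map c u) B V -> small_nbhd (chart_map c u) V0 V.
  by move=> [oV Vx VB]; split=> // y /VB /BV0.
have H V : small_nbhd (chart_map c u) B V -> exists2 i, active c u i &
    w V `<=` chart_map c @` facet c u r i.
  move=> sV; have [[y Sy ->] _] := comp V (sB V sV); have [_ _ VB] := sV.
  by apply: component_facet => //; rewrite -BE.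
have sBB : small_nbhd (chart_map c u) B B by split.
have [i ai wB] := H B sBB; exists i => //; exists B; split=> // V sV.
have [j aj wV] := H V sV.
have [z [[wz wz'] _]] := meet V B (sB V sV) (sB B sBB) setT filterT.
have ji : j = i.
  have [v [bv cv [av vU]] vz] := wV z wz.
  have [v' [bv' cv' [av' vU']] vz'] := wB z wz'.
  have vv : v' = v by apply: (chart_map_inj Hc) => //; rewrite vz vz'.
  by apply: vU'; rewrite vv.
move=> y /wV [v [bv cv [[_ vj] _]] <-]; exists v => //; split=> //=.
by rewrite -ji.
Qed.

Lemma choice_point x w V0 : component_choice x w -> open V0 -> V0 x ->
  exists V z, [/\ small_nbhd x V0 V, w V z & depth_stratum 1 z].
Proof.
move=> [V1 [oV1 V1x comp _]] oV0 V0x.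
have sV : small_nbhd x (V0 `&` V1) (V0 `&` V1) by split=> //; exact: openI.
have [sV0 sV1] := small_nbhdI sV.
have [[y Sy wE] clw] := comp _ sV1.
have [z [wz _]] := clw setT filterT.
exists (V0 `&` V1), z; split=> //.
by have : (V0 `&` V1 `&` depth_stratum 1) z;
  [move: wz; rewrite wE; exact: connected_component_sub|case].
Qed.

Lemma in_face_inj c u w i j : atlas X c -> chart_dom c u ->
  component_choice (chart_map c u) w -> (i < corners c)%N -> (j < corners c)%N ->
  in_face c u i w -> in_face c u j w -> i = j.
Proof.
move=> Ac cu cw ik jk [V1 [oV1 V1x H1]] [V2 [oV2 V2x H2]].
have [V [z [sV wz Sz]]] := choice_point cw (openI oV1 oV2) (conj V1x V2x).
have [sV1 sV2] := small_nbhdI sV.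
have [v [cv _] vz] := H1 V sV1 z wz.
have [ai _] := sole_activeP Ac Sz (H1 V sV1 z wz) ik cv vz.
have [_ jU] := sole_activeP Ac Sz (H2 V sV2 z wz) jk cv vz.
exact: jU.
Qed.

Lemma in_face_germ c u w w' i : atlas X c -> chart_dom c u -> active c u i ->
  component_choice (chart_map c u) w -> component_choice (chart_map c u) w' ->
  in_face c u i w -> in_face c u i w' -> same_germ (chart_map c u) w w'.
Proof.
move=> Ac cu ai cw cw' fw fw'; have Hc := ac Ac.
have [V0 [oV0 V0x H0]] := facet_sub_choice Ac cu ai cw fw.
have [V1 [oV1 V1x H1]] := facet_sub_choice Ac cu ai cw' fw'.
have [V2 [oV2 V2x H2 _]] := cw; have [V3 [oV3 V3x H3 _]] := cw'.
exists ((V0 `&` V1) `&` (V2 `&` V3)); split=> //; first by do !apply: openI.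
move=> V /small_nbhdI [/small_nbhdI [s0 s1] /small_nbhdI [s2 s3]].
have [oV Vx _] := s0.
have [r [Hr rV]] := adapted_ex Hc cu (open_nbhs_nbhs (conj oV Vx)).
have [v fv] := facet_nonempty Hr ai cu.
have K0 := H0 V s0 r Hr rV; have K1 := H1 V s1 r Hr rV.
have [[y Sy E] _] := H2 V s2; have [[y' Sy' E'] _] := H3 V s3.
have wz : w V (chart_map c v) by apply: K0; exists v.
have wz' : w' V (chart_map c v) by apply: K1; exists v.
rewrite E in wz *; rewrite E' in wz' *.
by rewrite (same_connected_component wz) (same_connected_component wz').
Qed.

Lemma choice_ex c u i : atlas X c -> chart_dom c u -> active c u i ->
  exists2 w, component_choice (chart_map c u) w & in_face c u i w.
Proof.
move=> Ac cu ai; have Hc := ac Ac.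
have [r [Hr _]] := adapted_ex Hc cu (@filterT _ (nbhs (chart_map c u)) _).
have [r0 _] := Hr; have [B [oB Bx BE]] := image_ball_open Hc cu r0.
have /choice [w Hw] (V : set X) : exists W, small_nbhd (chart_map c u) B V ->
    is_component (V `&` depth_stratum 1) W /\
    exists2 r', adapted c u r' & chart_map c @` facet c u r' i `<=` W.
  have [sV|nsV] := pselect (small_nbhd (chart_map c u) B V); last by exists set0.
  have [oV Vx _] := sV.
  have [r' [Hr' rV]] := adapted_ex Hc cu (open_nbhs_nbhs (conj oV Vx)).
  have [v fv] := facet_nonempty Hr' ai cu.
  have KS : chart_map c @` facet c u r' i `<=` V `&` depth_stratum 1.
    move=> _ [v' [bv' cv' sv'] <-]; split; first exact: rV.
    by apply/(stratum1P HX) => //; exists i.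
  have Kv : (chart_map c @` facet c u r' i) (chart_map c v) by exists v.
  exists (connected_component (V `&` depth_stratum 1) (chart_map c v)) => _; split.
    by exists (chart_map c v) => //; exact: KS.
  exists r' => //; apply: connected_component_max => //.
  exact: facet_image_connected.
have clo (r1 r2 : R) (W : set X) : adapted c u r1 -> adapted c u r2 ->
    (forall r', adapted c u r' -> r' <= r1 -> r' <= r2 ->
       chart_map c @` facet c u r' i `<=` W) -> closure W (chart_map c u).
  move=> H1 H2 HW N nN; have [r3 [H3 rN]] := adapted_ex Hc cu nN.
  pose r' := Num.min r3 (Num.min r1 r2).
  have H' : adapted c u r'.
    apply: (@adapted_le _ _ _ _ r3) => //; last by rewrite ge_min lexx.
    by rewrite !lt_min (proj1 H1) (proj1 H2) (proj1 H3).
  have [v fv] := facet_nonempty H' ai cu.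
  exists (chart_map c v); split.
    by apply: (HW r') => //;
      rewrite !ge_min lexx ?orbT.
  have [bv cv _] := fv; apply: rN => //; apply: le_ball bv.
  by rewrite ge_min lexx.
exists w.
  exists B; split=> // [V sV|V V' sV sV'].
    have [cV [r' Hr' KV]] := Hw V sV; split=> //.
    by apply: (clo r' r') => // r'' _ rr _; apply: subset_trans KV;
      apply: image_subset; exact: facet_le.
  have [_ [r1 H1 K1]] := Hw V sV; have [_ [r2 H2 K2]] := Hw V' sV'.
  apply: (clo r1 r2) => // r' _ rr1 rr2 y Ky; split.
    by apply: K1; apply: image_subset Ky; exact: facet_le.
  by apply: K2; apply: image_subset Ky; exact: facet_le.
exists B; split=> // V sV.
have [[y Sy wE] [r' Hr' KV]] := Hw V sV; have [_ _ VB] := sV.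
have [j aj wV] : exists2 j, active c u j & w V `<=` chart_map c @` facet c u r j.
  by rewrite wE; apply: component_facet => //; rewrite -BE.
have [v fv] := facet_nonempty Hr' ai cu.
have [v' [bv' cv' [av' vU']] vv'] : (chart_map c @` facet c u r j) (chart_map c v).
  by apply: wV; apply: KV; exists v.
have ij : i = j.
  have [bv cv [av vU]] := fv.
  by have E : v' = v; [exact: (chart_map_inj Hc)|apply: vU'; rewrite E].
move=> z /wV [v2 [bv2 cv2 [[_ v2j] _]] <-]; exists v2 => //; split=> //=.
by rewrite ij.
Qed.

Lemma same_germ_sym x w w' : same_germ x w w' -> same_germ x w' w.
Proof. by move=> [V0 [? ? H]]; exists V0; split=> // V /H. Qed.

Lemma same_germ_trans x w1 w2 w3 :
  same_germ x w1 w2 -> same_germ x w2 w3 -> same_germ x w1 w3.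
Proof.
move=> [V0 [oV0 V0x H0]] [V1 [oV1 V1x H1]]; exists (V0 `&` V1).
split=> //; first exact: openI.
by move=> V /small_nbhdI [s0 s1]; rewrite H0 // H1.
Qed.

Lemma in_face_same_germ c u i w w' : same_germ (chart_map c u) w w' ->
  in_face c u i w -> in_face c u i w'.
Proof.
move=> [V0 [oV0 V0x H0]] [V1 [oV1 V1x H1]]; exists (V0 `&` V1).
split=> //; first exact: openI.
by move=> V /small_nbhdI [s0 s1]; rewrite -H0 //; exact: H1.
Qed.

Lemma local_bdry_comp_germ x beta w w' : local_bdry_comp x beta ->
  beta w -> beta w' -> same_germ x w w'.
Proof.
move=> [w0 _ ->] [_ g] [_ g']; apply: same_germ_trans g'; exact: same_germ_sym.
Qed.

Lemma local_bdry_comp_choice x beta w : local_bdry_comp x beta -> beta w ->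
  component_choice x w.
Proof. by move=> [w0 _ ->] []. Qed.

Lemma face_comp_ex c u i : atlas X c -> chart_dom c u -> active c u i ->
  exists beta, face_comp c i u beta.
Proof.
move=> Ac cu ai; have [w cw fw] := choice_ex Ac cu ai.
exists [set w' | component_choice (chart_map c u) w' /\
  same_germ (chart_map c u) w w']; split; first by exists w.
exists w => //; split=> //; exists setT; split=> //; exact: openT.
Qed.

Lemma local_bdry_face c u beta : atlas X c -> chart_dom c u ->
  local_bdry_comp (chart_map c u) beta ->
  exists2 i, active c u i & face_comp c i u beta.
Proof.
move=> Ac cu lb; have [w cw bE] := lb.
have [i ai fw] := in_face_ex Ac cu cw; exists i => //; split=> //.
exists w => //; rewrite bE; split=> //; exists setT; split=> //; exact: openT.
Qed.

Lemma face_comp_eq c u i beta beta' : atlas X c -> chart_dom c u ->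
  active c u i -> face_comp c i u beta -> face_comp c i u beta' -> beta = beta'.
Proof.
move=> Ac cu ai [lb [w bw fw]] [lb' [w' bw' fw']].
have cw := local_bdry_comp_choice lb bw.
have cw' := local_bdry_comp_choice lb' bw'.
have g := in_face_germ Ac cu ai cw cw' fw fw'.
move: lb lb' bw bw' => [w1 _ ->] [w2 _ ->] [_ g1] [_ g2].
have {g1 g2}g : same_germ (chart_map c u) w1 w2.
  apply: same_germ_trans g1 _; apply: same_germ_trans g _; exact: same_germ_sym.
apply/seteqP; split=> w'' [c'' g'']; split=> //.
  by apply: same_germ_trans g''; exact: same_germ_sym.
exact: same_germ_trans g''.
Qed.

Lemma face_comp_inj c u i j beta : atlas X c -> chart_dom c u ->
  (i < corners c)%N -> (j < corners c)%N ->
  face_comp c i u beta -> face_comp c j u beta -> i = j.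
Proof.
move=> Ac cu ik jk [lb [w bw fw]] [_ [w' bw' fw']].
have cw := local_bdry_comp_choice lb bw.
apply: (in_face_inj Ac cu cw) => //.
by apply: in_face_same_germ fw'; exact: (local_bdry_comp_germ lb).
Qed.

Lemma bdry_eq (p q : bdry X) : bdry_pt p = bdry_pt q ->
  bdry_comp p = bdry_comp q -> p = q.
Proof.
case: p q => [x b H] [x' b' H'] /= xx bb; move: H H'; rewrite xx bb => H H'.
by rewrite (Prop_irrelevance H H').
Qed.

Lemma face_transition c d u i j beta : atlas X c -> atlas X d -> chart_dom c u ->
  chart_img d (chart_map c u) -> active c u i ->
  active d (chart_inv d (chart_map c u)) j ->
  face_comp c i u beta -> face_comp d j (chart_inv d (chart_map c u)) beta ->
  exists N, [/\ open N, N (chart_map c u) & forall v, chart_dom c v -> v 0 i = 0 ->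
    N (chart_map c v) -> chart_img d (chart_map c v) /\
    chart_inv d (chart_map c v) 0 j = 0].
Proof.
move=> Ac Ad cu du ai aj [lb [w bw fw]] [_ [w' bw' fw']].
have Hc := ac Ac; have Hd := ac Ad.
set u' := chart_inv d (chart_map c u) in aj fw'.
have u'E : chart_map d u' = chart_map c u by exact: chart_mapK.
have cw := local_bdry_comp_choice lb bw.
have {w' bw'}fw' : in_face d u' j w.
  apply: in_face_same_germ fw'; rewrite u'E.
  exact: (local_bdry_comp_germ lb).
have [V0 [oV0 V0x H0]] := facet_sub_choice Ac cu ai cw fw.
have [V1 [oV1 V1x H1]] := fw'; rewrite u'E in V1x H1.
pose V := V0 `&` V1 `&` chart_img d.
have oV : open V by apply: openI; [exact: openI|exact: open_chart_img].
have Vx : V (chart_map c u) by [].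
have s : small_nbhd (chart_map c u) (V0 `&` V1) V by split=> // y [].
have [s0 s1] := small_nbhdI s.
have [r [Hr rV]] := adapted_ex Hc cu (open_nbhs_nbhs (conj oV Vx)).
have KV := H0 V s0 r Hr rV.
have fj v : facet c u r i v -> chart_inv d (chart_map c v) 0 j = 0.
  move=> fv; have [v' [dv' vj'] vv'] : (chart_map d @` (chart_dom d `&`
      [set v | v 0 j = 0])) (chart_map c v).
    by apply: (H1 V s1); apply: KV; exists v.
  by rewrite -vv' chart_invK.
have [r0 _] := Hr; have [B [oB Bx BE]] := image_ball_open Hc cu r0.
exists B; split=> // v cv vi; rewrite {1}BE => -[v1 [cv1 bv1] vv1].
have {v1 cv1 bv1 vv1}bv : ball u r v by rewrite -(chart_map_inj Hc cv1 cv vv1).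
have [_ dv] := rV v bv cv; split=> //.
have Tv0 : 0 <= chart_inv d (chart_map c v) 0 j.
  by apply: (dom_orthant Hd (chart_inv_dom Hd dv)); case: aj.
apply/eqP; rewrite eq_le Tv0 andbT leNgt; apply/negP => Tv.
have H : \forall y \near chart_map c v, 0 < chart_inv d y 0 j.
  have Hn : \forall w \near chart_inv d (chart_map c v), 0 < (w : 'rV[R]_(dim X)) 0 j.
    exact: (@coord_continuous R 1 _ 0 j _ _ (lt_nbhsr Tv)).
  exact: (chart_inv_continuous Hd dv Hn).
move: H => /(chart_near _ Hc cv) /nbhs_ballP [e /= e0 He].
have [v2 [fv2 bv2]] := facet_dense Hr ai e0 bv cv vi.
have [_ cv2 _] := fv2.
by have := He v2 bv2 cv2; rewrite fj // ltxx.
Qed.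

Lemma face_comp_transfer c d i j (N : set X) v beta : atlas X c -> atlas X d ->
  open N -> (forall v, chart_dom c v -> v 0 i = 0 ->
    N (chart_map c v) -> chart_img d (chart_map c v) /\
    chart_inv d (chart_map c v) 0 j = 0) ->
  chart_dom c v -> N (chart_map c v) -> chart_img d (chart_map c v) ->
  face_comp c i v beta -> face_comp d j (chart_inv d (chart_map c v)) beta.
Proof.
move=> Ac Ad oN HN cv Nv dv [lb [w bw [V0 [oV0 V0x H0]]]].
rewrite /face_comp chart_mapK //; split=> //; exists w => //.
have [V1 [oV1 V1x comp _]] := local_bdry_comp_choice lb bw.
exists ((V0 `&` V1) `&` N); split=> //; first by do !apply: openI.
move=> V /small_nbhdI [/small_nbhdI [s0 s1] [_ _ VN]] y wy.
have [v' [cv' vi'] vy'] := H0 V s0 y wy.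
have Vy : V y.
  have [[z Sz wE] _] := comp V s1.
  by move: wy; rewrite wE => /connected_component_sub [].
have [dy y0] : chart_img d (chart_map c v') /\
    chart_inv d (chart_map c v') 0 j = 0.
  by apply: HN => //; rewrite vy'; exact: VN.
rewrite vy' in dy y0; exists (chart_inv d y); last exact: chart_mapK.
by split=> //; apply: chart_inv_dom => //; exact: ac.
Qed.

End Faces.

(** * The atlas of the boundary *)

Section Insert.
Context {R : realType} {n : nat}.
Implicit Types (i : 'I_n) (v : 'rV[R]_n.-1) (w : 'rV[R]_n).

Definition remove i w : 'rV[R]_n.-1 := \row_j w 0 (lift i j).

Lemma insert0_eq i v : insert0 i v 0 i = 0.
Proof. by rewrite mxE unlift_none. Qed.

Lemma insert0_lift i v j : insert0 i v 0 (lift i j) = v 0 j.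
Proof. by rewrite mxE liftK. Qed.

Lemma insert0K i : cancel (insert0 i) (remove i : 'rV[R]_n -> _).
Proof. by move=> v; apply/rowP => j; rewrite mxE insert0_lift. Qed.

Lemma removeK i w : w 0 i = 0 -> insert0 i (remove i w) = w.
Proof.
move=> wi; apply/rowP => j; rewrite mxE.
by case: unliftP => [j' ->|->]; rewrite ?mxE.
Qed.

Lemma smooth_insert0 i D v : smooth_at D (insert0 i : 'rV[R]_n.-1 -> _) v.
Proof.
apply/smooth_at_rV => j; case: (unliftP i j) => [j' ->|->].
  apply: smooth_atW (smooth_at_coord D j' v) => w Dw.
  by rewrite insert0_lift.
apply: smooth_atW (smooth_at_cst D (0 : R) v) => w Dw.
by rewrite insert0_eq.
Qed.

Lemma smooth_remove i D w : smooth_at D (remove i : 'rV[R]_n -> _) w.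
Proof.
apply/smooth_at_rV => j.
by apply: smooth_atW (smooth_at_coord D (lift i j) w) => v Dv; rewrite mxE.
Qed.

Lemma insert0_continuous i : continuous (insert0 i : 'rV[R]_n.-1 -> 'rV[R]_n).
Proof. by move=> v; apply: smooth_at_continuous; exact: smooth_insert0. Qed.

Lemma remove_continuous i : continuous (remove i : 'rV[R]_n -> 'rV[R]_n.-1).
Proof. by move=> w; apply: smooth_at_continuous; exact: smooth_remove. Qed.

Lemma lift_lt i j k : (i < k)%N -> (lift i j < k)%N = (j < k.-1)%N.
Proof.
move=> ik; rewrite /= /bump; case: (leqP i j) => ij; first by case: k ik.
rewrite add0n; case: k ik => // k ik /=; rewrite ltnS.
have -> : (j <= k)%N by apply: leq_trans (ltnW ij) _.
by rewrite (leq_trans ij).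
Qed.

Lemma orthant_insert0 i v k : (i < k)%N ->
  orthant k (insert0 i v) <-> orthant k.-1 v.
Proof.
move=> ik; split=> [H j jk|H j].
  by rewrite -(insert0_lift i) H // lift_lt.
case: (unliftP i j) => [j' ->|-> _]; last by rewrite insert0_eq.
by rewrite lift_lt // insert0_lift; exact: H.
Qed.

End Insert.

Lemma rel_openP (T : topologicalType) (D P : set T) :
  (forall x, D x -> P x -> \forall y \near x, D y -> P y) ->
  rel_open D (D `&` P).
Proof.
move=> H; exists (interior [set y | D y -> P y]); first exact: open_interior.
apply/seteqP; split=> x [Dx]; first by move=> Px; split=> //; exact: H.
by move=> /interior_subset /(_ Dx).
Qed.

Section BoundaryAtlas.
Context {R : realType} (X : charted R).
Hypothesis HX : is_atlas (atlas X).
Implicit Types (c d : chart R (dim X) X) (u : 'rV[R]_(dim X)) (p q : bdry X).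
Implicit Types (i j : 'I_(dim X)) (b e : chart R (dim X).-1 (bdry X)).
Implicit Types (v : 'rV[R]_(dim X).-1).

Let ac c : atlas X c -> is_chart c. Proof. exact: atlas_chart. Qed.

Definition facet_chart c i (b : chart R (dim X).-1 (bdry X)) : Prop :=
  [/\ atlas X c, (i < corners c)%N, corners b = (corners c).-1,
      chart_dom b = [set v | chart_dom c (insert0 i v)] /\
        chart_dom b !=set0 &
      forall v, chart_dom b v ->
        bdry_pt (chart_map b v) = chart_map c (insert0 i v) /\
        face_comp c i (insert0 i v) (bdry_comp (chart_map b v))].

Section OneChart.
Variables (c : chart R (dim X) X) (i : 'I_(dim X)) (b : chart R (dim X).-1 (bdry X)).
Hypothesis fc : facet_chart c i b.

Lemma facet_domE v : chart_dom b v <-> chart_dom c (insert0 i v).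
Proof. by have [_ _ _ [-> _] _] := fc. Qed.

Lemma facet_active v : active c (insert0 i v) i.
Proof. by have [_ ik _ _ _] := fc; split=> //; exact: insert0_eq. Qed.

Lemma facet_mapE v p : chart_dom b v -> bdry_pt p = chart_map c (insert0 i v) ->
  face_comp c i (insert0 i v) (bdry_comp p) -> chart_map b v = p.
Proof.
move=> cv pE fp; have [Ac ik _ _ H] := fc; have [qE fq] := H v cv.
apply: bdry_eq; first by rewrite qE.
apply: (face_comp_eq HX Ac _ (facet_active v) fq fp).
exact/facet_domE.
Qed.

Lemma facet_map_inj v w : chart_dom b v -> chart_dom b w ->
  chart_map b v = chart_map b w -> v = w.
Proof.
move=> cv cw vw; have [Ac _ _ _ H] := fc.
have [vE _] := H v cv; have [wE _] := H w cw.
rewrite -(insert0K i v) -(insert0K i w); congr remove.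
by apply: (chart_map_inj (ac Ac)); rewrite -?vE -?wE ?vw //; exact/facet_domE.
Qed.

End OneChart.

Lemma facet_chart_ex p c u i : atlas X c -> chart_dom c u ->
  chart_map c u = bdry_pt p -> active c u i -> face_comp c i u (bdry_comp p) ->
  exists b, [/\ facet_chart c i b, chart_dom b (remove i u) &
    chart_map b (remove i u) = p].
Proof.
move=> Ac cu up ai fp; have [ik ui] := ai.
have /choice [m Hm] (v : 'rV[R]_(dim X).-1) : exists q : bdry X,
    chart_dom c (insert0 i v) -> bdry_pt q = chart_map c (insert0 i v) /\
    face_comp c i (insert0 i v) (bdry_comp q).
  have [cv|ncv] := pselect (chart_dom c (insert0 i v)); last by exists p.
  have aiv : active c (insert0 i v) i by split=> //; exact: insert0_eq.
  have [beta fb] := face_comp_ex HX Ac cv aiv.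
  have [lb _] := fb; exists (Bdry lb) => _; split=> //.
pose b := Chart (corners c).-1 [set v | chart_dom c (insert0 i v)] m.
have cu' : chart_dom b (remove i u) by rewrite /= removeK.
have fc : facet_chart c i b.
  by split=> //; split=> //; exists (remove i u).
exists b; split=> //; apply: (facet_mapE fc) => //; rewrite removeK //.
Qed.

Lemma facet_overlap c d i j b e v w : facet_chart c i b -> facet_chart d j e ->
  chart_dom b v -> chart_dom e w -> chart_map b v = chart_map e w ->
  let tau v2 := remove j (chart_inv d (chart_map c (insert0 i v2))) in
  [/\ tau v = w, smooth_at (chart_dom b) tau v & \forall v2 \near v,
    chart_dom b v2 -> chart_dom e (tau v2) /\
    chart_map e (tau v2) = chart_map b v2].
Proof.
move=> fc fd cv dw vw tau.
have [Ac ik _ _ Hc'] := fc; have [Ad jk _ _ Hd'] := fd.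
have Hc := ac Ac; have Hd := ac Ad.
have [vE fv] := Hc' v cv; have [wE fw] := Hd' w dw.
set u := insert0 i v in vE fv.
have cu : chart_dom c u by exact/(facet_domE fc).
have dw' : chart_dom d (insert0 j w) by exact/(facet_domE fd).
have uw : chart_map c u = chart_map d (insert0 j w) by rewrite -vE vw.
have du : chart_img d (chart_map c u) by rewrite uw; exact: chart_imgE.
have uwE : chart_inv d (chart_map c u) = insert0 j w by rewrite uw chart_invK.
have aj : active d (chart_inv d (chart_map c u)) j by rewrite uwE; exact: (facet_active fd).
have fw' : face_comp d j (chart_inv d (chart_map c u)) (bdry_comp (chart_map b v)).
  by rewrite uwE vw.
have [N [oN Nu HN]] := face_transition HX Ac Ad cu du (facet_active fc v) aj fv fw'.
split.
- by rewrite /tau -/u uwE insert0K.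
- have s1 := smooth_insert0 i (chart_dom b) v.
  have s2 : smooth_at (chart_dom c) (chart_inv d \o chart_map c) (insert0 i v).
    exact: (atlas_transition HX).
  have s12 := smooth_at_comp cv s1 s2.
  have {}s12 : smooth_at (chart_dom b) (fun v2 => (chart_inv d \o chart_map c) (insert0 i v2)) v.
    by apply: s12; apply: filterE => v2 /(facet_domE fc).
  apply: (smooth_at_comp cv s12 (smooth_remove j setT _)).
  by apply: filterE.
have NN : \forall v2 \near v, chart_dom c (insert0 i v2) ->
    N (chart_map c (insert0 i v2)).
  have : \forall u2 \near u, chart_dom c u2 -> N (chart_map c u2).
    by apply/chart_near => //; exact: open_nbhs_nbhs.
  exact: (@insert0_continuous R _ i v).
apply: filterS NN => v2 NN cv2.
have cu2 : chart_dom c (insert0 i v2) by exact/(facet_domE fc).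
have {}NN := NN cu2.
have [dv2 dj] := HN _ cu2 (insert0_eq i v2) NN.
have [v2E fv2] := Hc' v2 cv2.
have insE : insert0 j (tau v2) = chart_inv d (chart_map c (insert0 i v2)).
  by rewrite /tau removeK.
have dt : chart_dom e (tau v2).
  by apply/(facet_domE fd); rewrite insE; exact: chart_inv_dom.
split=> //; apply: (facet_mapE fd) => //; rewrite insE.
  by rewrite chart_mapK.
exact: (face_comp_transfer HX Ac Ad oN HN).
Qed.

Lemma facet_map_open c i b (U : set 'rV[R]_(dim X).-1) : facet_chart c i b ->
  open U -> open (chart_map b @` (chart_dom b `&` U)).
Proof.
move=> fc oU; suff : bdry_open (chart_map b @` (chart_dom b `&` U)) by [].
move=> e [d [j fd]]; apply: rel_openP => w dw [v [cv Uv] vw].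
have [tE st near_t] := facet_overlap fd fc dw cv (esym vw).
set tau := fun _ => _ in st; rewrite -/tau in near_t.
have ct := smooth_at_cvg dw st; rewrite [tau w]tE in ct.
have nU : \forall w2 \near w, chart_dom e w2 -> U (tau w2).
  exact: (ct _ (open_nbhs_nbhs (conj oU Uv))).
apply: filterS2 nU near_t => w2 Uw2 Hw2 dw2; have [bt tw2] := Hw2 dw2.
by exists (tau w2) => //; split=> //; exact: Uw2.
Qed.

Lemma facet_is_chart c i b : facet_chart c i b -> is_chart b.
Proof.
move=> fc; have [Ac ik kE [dE ne] Hm] := fc; have Hc := ac Ac.
have [kn [U oU cE] _ _ _] := Hc.
have inj : {in chart_dom b &, injective (chart_map b)}.
  by move=> v w; rewrite !inE; exact: (facet_map_inj fc).
have io U' : open U' -> open (chart_map b @` (chart_dom b `&` U')).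
  exact: (facet_map_open fc).
split.
- by rewrite kE -!subn1 leq_sub2r.
- exists (insert0 i @^-1` U).
    by apply: open_comp => // v _; exact: insert0_continuous.
  rewrite dE kE cE; apply/seteqP; split=> v /=.
    by move=> [/orthant_insert0 ov Uv]; split=> //; exact: ov.
  by move=> [ov Uv]; split=> //; apply/orthant_insert0.
- split; first by split=> //; exact: imageP.
    apply/subspace_continuousP => v cv A.
    rewrite nbhsE => -[B [oB Bv] BA].
    have [U1 oO OE] := (oB : bdry_open B) b (ex_intro _ c (ex_intro _ i fc)).
    have Ov : U1 v by have : (chart_dom b `&` U1) v; [rewrite -OE|case].
    have nO : \forall w \near v, U1 w by exact: open_nbhs_nbhs.
    apply: filterS nO => w Ow cw; apply: BA.
    by have : (chart_dom b `&` chart_map b @^-1` B) w; [rewrite OE|case].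
  exists (chart_inv b); split.
    by move=> v cv; rewrite /chart_inv pinvKV.
  apply/subspace_continuousP => p [v cv vp].
  have vE : chart_inv b p = v by rewrite -vp /chart_inv pinvKV ?inE.
  rewrite /from_subspace vE => A nA.
  move: nA; rewrite nbhsE => -[B [oB Bv] BA].
  have nB : \forall q \near p, (chart_map b @` (chart_dom b `&` B)) q.
    apply: open_nbhs_nbhs; split; first exact: io.
    by exists v.
  apply: filterS nB => q [w [cw Bw] wq] _; apply: BA.
  by rewrite -wq /chart_inv pinvKV ?inE.
- by have := io setT openT; rewrite setIT.
- by have [v cv] := ne; exists (chart_map b v); exists v.
Qed.

Lemma is_atlas_bdry : is_atlas (@bdry_chart R X).
Proof.
have ch b : bdry_chart b -> is_chart b by move=> [c [i]]; exact: facet_is_chart.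
have tr b e : bdry_chart b -> bdry_chart e -> smooth_transition b e.
  move=> Bc Bd v cv [w dw wv]; have [c [i fc]] := Bc; have [d [j fd]] := Bd.
  have [tE st near_t] := facet_overlap fc fd cv dw (esym wv).
  apply: smooth_atS st; apply: filterS near_t => v2 H cv2; split=> //=.
  by have [dt <-] := H cv2; rewrite chart_invK //; exact: ch.
split=> //.
  by move=> b e Bc Bd; apply/compatibleP; [exact: ch|exact: ch|split; exact: tr].
rewrite -subTset => p _.
have [c Ac [u cu up]] := atlas_cover (bdry_pt p) HX.
have lb : local_bdry_comp (chart_map c u) (bdry_comp p) by rewrite up; exact: bdryP.
have [i ai fp] := local_bdry_face HX Ac cu lb.
have [b [fc cu' pE]] := facet_chart_ex Ac cu up ai fp.
by exists b; [exists c, i|exists (remove i u)].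
Qed.

Lemma is_atlas_boundary : is_atlas (atlas (boundary X)).
Proof. exact: is_atlas_max is_atlas_bdry. Qed.

Lemma bdry_facet p : exists c u i b, [/\ facet_chart c i b, chart_dom c u,
  active c u i, face_comp c i u (bdry_comp p) & [/\ chart_map c u = bdry_pt p,
  chart_dom b (remove i u) & chart_map b (remove i u) = p]].
Proof.
have [c Ac [u cu up]] := atlas_cover (bdry_pt p) HX.
have lb : local_bdry_comp (chart_map c u) (bdry_comp p) by rewrite up; exact: bdryP.
have [i ai fp] := local_bdry_face HX Ac cu lb.
have [b [fc cu' pE]] := facet_chart_ex Ac cu up ai fp.
by exists c, u, i, b; split.
Qed.

Lemma bdry_pt_continuous : continuous (@bdry_pt R X).
Proof.
apply/continuousP => V oV; suff : bdry_open (@bdry_pt R X @^-1` V) by [].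
move=> b [c [i fc]]; apply: rel_openP => v cv /=.
have [Ac _ _ _ Hm] := fc; have [-> _] := Hm v cv => Vv.
have cu := (facet_domE fc v).1 cv.
have H : \forall u2 \near insert0 i v, chart_dom c u2 -> V (chart_map c u2).
  by apply/(chart_near _ (ac Ac) cu); exact: open_nbhs_nbhs.
have {}H : \forall v2 \near v, chart_dom c (insert0 i v2) -> V (chart_map c (insert0 i v2)).
  exact: (@insert0_continuous R _ i v _ H).
apply: filterS H => v2 H cv2; have [-> _] := Hm v2 cv2.
by apply: H; apply/(facet_domE fc).
Qed.

Lemma bdry_hausdorff : hausdorff_space X -> hausdorff_space (bdry X).
Proof.
move=> hX; rewrite open_hausdorff => p q pq.
have [ptE|ptN] := pselect (bdry_pt p = bdry_pt q); last first.
  move: hX; rewrite open_hausdorff => /(_ _ _ (introN eqP ptN)).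
  move=> [[A B] /= [pA qB] [oA oB AB]].
  exists (@bdry_pt R X @^-1` A, @bdry_pt R X @^-1` B) => /=.
    by rewrite !inE; rewrite !inE in pA qB.
  split; try (apply: open_comp => // x _; exact: bdry_pt_continuous).
  by apply/eqP; rewrite -preimage_setI (eqP AB) preimage_set0.
have [c [u [i [b [fc cu ai fp [up cu' pE]]]]]] := bdry_facet p.
have [Ac ik _ _ Hm] := fc; have uq : chart_map c u = bdry_pt q by rewrite up.
have lb : local_bdry_comp (chart_map c u) (bdry_comp q) by rewrite uq; exact: bdryP.
have [j aj fq] := local_bdry_face HX Ac cu lb.
have [e [fd cu2 qE]] := facet_chart_ex Ac cu uq aj fq.
exists (chart_img b, chart_img e) => /=.
  by rewrite !inE; split; [exists (remove i u)|exists (remove j u)].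
split; try (apply: open_chart_img; apply: facet_is_chart; eassumption).
apply/eqP/seteqP; split=> // r [[v cv vr] [w dw wr]].
have [_ jk _ _ Hm'] := fd.
have [vE fv] := Hm v cv; have [wE fw] := Hm' w dw.
have vw : insert0 i v = insert0 j w.
  by apply: (chart_map_inj (ac Ac)); rewrite -?vE -?wE ?vr ?wr //;
    [exact/(facet_domE fc)|exact/(facet_domE fd)].
have ij : i = j.
  apply: (face_comp_inj HX Ac _ ik jk fv); first exact/(facet_domE fc).
  by rewrite vw vr -wr.
move/eqP: pq; apply; apply: bdry_eq => //.
by apply: (face_comp_eq HX Ac cu ai fp); rewrite ij.
Qed.

End BoundaryAtlas.

(** * The atlas of a product *)

Section Coord.
Context {R : realType}.

Lemma coord_ord n (w : 'rV[R]_n) (j : 'I_n) : coord w j = w 0 j.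
Proof.
rewrite /coord; case: insubP => [k _ kj|]; last by rewrite ltn_ord.
by congr (w 0 _); exact: val_inj.
Qed.

Lemma coord_row n (f : nat -> R) i :
  coord (\row_(j < n) f j) i = if (i < n)%N then f i else 0.
Proof.
rewrite /coord; case: insubP => [k -> <-|/negbTE ->] //.
by rewrite mxE.
Qed.

Lemma coord_out n (w : 'rV[R]_n) i : (n <= i)%N -> coord w i = 0.
Proof. by move=> ni; rewrite /coord insubF // ltnNge ni. Qed.

Lemma eq_coord n (v w : 'rV[R]_n) : (forall i, (i < n)%N -> coord v i = coord w i) -> v = w.
Proof.
by move=> H; apply/rowP => j; rewrite -!coord_ord; apply: H.
Qed.

Lemma orthant_coord n k (w : 'rV[R]_n) :
  orthant k w <-> forall i, (i < k)%N -> 0 <= coord w i.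
Proof.
split=> [H i ik|H i ik]; last by rewrite -coord_ord; exact: H.
have [i_n|/coord_out -> //] := ltnP i n.
have -> : i = Ordinal i_n by [].
by rewrite coord_ord; apply: H.
Qed.

Lemma smooth_at_coord_nat (E : normedModType R) n D (f : E -> 'rV[R]_n) u l :
  smooth_at D f u -> smooth_at D (fun v => coord (f v) l) u.
Proof.
move=> /smooth_at_rV sf; have [ln|nl] := ltnP l n.
  apply: smooth_atW (sf (Ordinal ln)) => v Dv; split=> //.
  exact: (esym (coord_ord (f v) (Ordinal ln))).
by apply: smooth_atW (smooth_at_cst D (0 : R) u) => v Dv; rewrite coord_out.
Qed.

Lemma cvg_rV (T : Type) (F : set_system T) n (f : T -> 'rV[R]_n) (l : 'rV[R]_n) :
  Filter F -> (forall j, (fun x => f x 0 j) @ F --> l 0 j) -> f @ F --> l.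
Proof.
move=> FF H; apply/cvgrPdist_le => /= e e0; near=> y.
rewrite /Num.Def.normr/= mx_normrE (bigmax_le _ (ltW e0))//= => -[i j] _.
rewrite !mxE/= ord1; move: j {i}; near: y; apply: filter_forall => j.
by have /cvgrPdist_le/(_ e e0) := H j.
Unshelve. all: by end_near. Qed.

Lemma coord_nat_continuous n l : continuous (fun w : 'rV[R]_n => coord w l).
Proof.
move=> w; apply: smooth_at_continuous.
exact: smooth_at_coord_nat (smooth_at_id setT w).
Qed.

Section Join.
Variables (m n a b : nat).
Hypotheses (am : (a <= m)%N) (bn : (b <= n)%N).
Implicit Types (u : 'rV[R]_m) (v : 'rV[R]_n) (w : 'rV[R]_(m + n)).

Definition join_coord u v l : R :=
  if (l < a)%N then coord u l
  else if (l < a + b)%N then coord v (l - a)%N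
  else if (l < b + m)%N then coord u (l - b)%N else coord v (l - m)%N.

(* The inverse of (split_fst, split_snd). *)
Definition join_rV u v : 'rV[R]_(m + n) := \row_(l < m + n) join_coord u v l.

Lemma coord_split_fst w j : (j < m)%N ->
  coord (@split_fst R m n a b w) j = coord w (if (j < a)%N then j else b + j)%N.
Proof.
move=> jm; rewrite /split_fst.
by rewrite (coord_row _ (fun j => coord w (if (j < a)%N then j else (b + j)%N))) jm.
Qed.

Lemma coord_split_snd w j : (j < n)%N ->
  coord (@split_snd R m n a b w) j = coord w (if (j < b)%N then a + j else m + j)%N.
Proof.
move=> jm; rewrite /split_snd.
by rewrite (coord_row _ (fun j => coord w (if (j < b)%N then (a + j)%N else (m + j)%N))) jm.
Qed.

Lemma coord_join u v l : (l < m + n)%N ->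
  coord (join_rV u v) l = join_coord u v l.
Proof. by move=> lmn; rewrite (coord_row _ (join_coord u v)) lmn. Qed.

Lemma split_fst_join u v : @split_fst R m n a b (join_rV u v) = u.
Proof.
apply: eq_coord => j jm.
rewrite coord_split_fst // coord_join /join_coord; last by case: ifP => ?; lia.
case: (ltnP j a) => ja; first by rewrite ja.
rewrite ifF; last lia.
rewrite ifF; last lia.
by rewrite ifT; [congr coord; lia|lia].
Qed.

Lemma split_snd_join u v : @split_snd R m n a b (join_rV u v) = v.
Proof.
apply: eq_coord => j jm.
rewrite coord_split_snd // coord_join /join_coord; last by case: ifP => ?; lia.
case: (ltnP j b) => ja.
  rewrite ifF; last lia.
  by rewrite ifT; [congr coord; lia|lia].
rewrite ifF; last lia.
rewrite ifF; last lia.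
by rewrite ifF; [congr coord; lia|lia].
Qed.

Lemma join_split w : join_rV (@split_fst R m n a b w) (@split_snd R m n a b w) = w.
Proof.
apply: eq_coord => l lmn; rewrite coord_join // /join_coord.
case: (ltnP l a) => la; first by rewrite coord_split_fst ?la //; lia.
case: (ltnP l (a + b)) => lab.
  rewrite coord_split_snd; last lia.
  by rewrite ifT; [congr coord; lia|lia].
case: (ltnP l (b + m)) => lbm.
  rewrite coord_split_fst; last lia.
  by rewrite ifF; [congr coord; lia|lia].
rewrite coord_split_snd; last lia.
by rewrite ifF; [congr coord; lia|lia].
Qed.

Lemma orthant_split w : orthant (a + b) w <->
  orthant a (@split_fst R m n a b w) /\ orthant b (@split_snd R m n a b w).
Proof.
split=> [/orthant_coord H|[/orthant_coord H1 /orthant_coord H2]].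
  split; apply/orthant_coord => i ia.
    by rewrite coord_split_fst ?ia; [apply: H; lia|lia].
  by rewrite coord_split_snd ?ia; [apply: H; lia|lia].
apply/orthant_coord => l lab; case: (ltnP l a) => la.
  by have := H1 l la; rewrite coord_split_fst ?la //; lia.
have := H2 (l - a)%N; rewrite coord_split_snd; last lia.
rewrite ifT; last lia.
by rewrite subnKC //; apply; lia.
Qed.

Lemma smooth_split_fst D w : smooth_at D (@split_fst R m n a b : 'rV[R]_(m + n) -> _) w.
Proof.
apply/smooth_at_rV => j.
apply: smooth_atW (smooth_at_coord_nat (if (j < a)%N then j : nat else (b + j)%N)
  (smooth_at_id D w)) => v Dv.
by rewrite mxE.
Qed.

Lemma smooth_split_snd D w : smooth_at D (@split_snd R m n a b : 'rV[R]_(m + n) -> _) w.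
Proof.
apply/smooth_at_rV => j.
apply: smooth_atW (smooth_at_coord_nat (if (j < b)%N then (a + j)%N else (m + j)%N)
  (smooth_at_id D w)) => v Dv.
by rewrite mxE.
Qed.

Lemma smooth_join (E : normedModType R) D (f : E -> 'rV[R]_m) (g : E -> 'rV[R]_n) x :
  smooth_at D f x -> smooth_at D g x -> smooth_at D (fun y => join_rV (f y) (g y)) x.
Proof.
move=> sf sg; apply/smooth_at_rV => l.
have E1 y : (join_rV (f y) (g y)) 0 l = join_coord (f y) (g y) l by rewrite mxE.
under eq_fun do rewrite E1 /join_coord.
case: (l < a)%N; first exact: smooth_at_coord_nat.
case: (l < a + b)%N; first exact: smooth_at_coord_nat.
by case: (l < b + m)%N; exact: smooth_at_coord_nat.
Qed.

Lemma split_fst_continuous : continuous (@split_fst R m n a b : 'rV[R]_(m + n) -> _).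
Proof. by move=> w; apply: smooth_at_continuous; exact: smooth_split_fst. Qed.

Lemma split_snd_continuous : continuous (@split_snd R m n a b : 'rV[R]_(m + n) -> _).
Proof. by move=> w; apply: smooth_at_continuous; exact: smooth_split_snd. Qed.

Lemma join_continuous (T : topologicalType) (f : T -> 'rV[R]_m) (g : T -> 'rV[R]_n) x :
  {for x, continuous f} -> {for x, continuous g} ->
  {for x, continuous (fun y => join_rV (f y) (g y))}.
Proof.
move=> cf cg; apply: (@cvg_rV _ (nbhs x) _ _ _ (nbhs_filter x)) => l.
under eq_fun do rewrite mxE /join_coord; rewrite mxE /join_coord.
have Cf k : (fun y => coord (f y) k) @ x --> coord (f x) k.
  exact: (cvg_comp _ _ cf (@coord_nat_continuous m k (f x))).
have Cg k : (fun y => coord (g y) k) @ x --> coord (g x) k.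
  exact: (cvg_comp _ _ cg (@coord_nat_continuous n k (g x))).
case: (l < a)%N; first exact: Cf.
case: (l < a + b)%N; first exact: Cg.
by case: (l < b + m)%N; [exact: Cf|exact: Cg].
Qed.

End Join.
End Coord.

Section Product.
Context {R : realType}.

Section ProdChart.
Variables (m n : nat) (S T : topologicalType) (c : chart R m S) (d : chart R n T).
Hypotheses (Hc : is_chart c) (Hd : is_chart d).
Local Notation P := (prod_chart c d).
Local Notation fst' := (@split_fst R m n (corners c) (corners d)).
Local Notation snd' := (@split_snd R m n (corners c) (corners d)).
Local Notation join' := (@join_rV R m n (corners c) (corners d)).

Let am : (corners c <= m)%N. Proof. by case: Hc. Qed.
Let bn : (corners d <= n)%N. Proof. by case: Hd. Qed.

Lemma prod_chart_img p : chart_img P p <-> chart_img c p.1 /\ chart_img d p.2.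
Proof.
split=> [[w [cw dw] <-]|[[u cu up] [v dv vp]]].
  by split; [exists (fst' w)|exists (snd' w)].
exists (join' u v).
  by rewrite /= split_fst_join // split_snd_join.
by rewrite /= split_fst_join // split_snd_join // up vp; case: p {up vp}.
Qed.

Lemma prod_chart_inj : {in chart_dom P &, injective (chart_map P)}.
Proof.
move=> v w; rewrite !inE => -[cv dv] [cw dw] [/(chart_map_inj Hc cv cw) e1].
move=> /(chart_map_inj Hd dv dw) e2.
by rewrite -(join_split am bn v) e1 e2 join_split.
Qed.

Lemma prod_chart_invE p : chart_img P p ->
  chart_inv P p = join' (chart_inv c p.1) (chart_inv d p.2).
Proof.
move=> [w [cw dw] wp]; rewrite -wp /chart_inv pinvKV ?inE //; last exact: prod_chart_inj.
by rewrite /= -/(chart_inv c _) -/(chart_inv d _) !chart_invK // join_split.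
Qed.

Lemma prod_is_chart : is_chart P.
Proof.
have [_ [U1 oU1 cE] _ _ [x cx]] := Hc; have [_ [U2 oU2 dE] _ _ [y dy]] := Hd.
split.
- exact: leq_add.
- exists (fst' @^-1` U1 `&` snd' @^-1` U2).
    apply: openI; apply: open_comp => // w _.
      exact: split_fst_continuous.
    exact: split_snd_continuous.
  apply/seteqP; split=> w /=; rewrite cE dE.
    move=> [[h1 H1] [h2 H2]]; split=> //; exact/orthant_split.
  by move=> [/(orthant_split am bn) [h1 h2] [H1 H2]]; split.
- split; first by split; [exact: imageP|exact: prod_chart_inj|].
    apply/subspace_continuousP => w [cw dw] A [[A1 A2] /= [H1 H2] HA].
    have H1' : \forall v \near w, chart_dom c (fst' v) -> A1 (chart_map c (fst' v)).
      exact: (@split_fst_continuous R m n _ _ w _ ((chart_near _ Hc cw).1 H1)).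
    have H2' : \forall v \near w, chart_dom d (snd' v) -> A2 (chart_map d (snd' v)).
      exact: (@split_snd_continuous R m n _ _ w _ ((chart_near _ Hd dw).1 H2)).
    apply: filterS2 H1' H2' => v H1' H2' [cv dv].
    by apply: HA; split=> /=; [exact: H1'|exact: H2'].
  exists (fun p => join' (chart_inv c p.1) (chart_inv d p.2)); split.
    by move=> w; rewrite inE => -[cw dw] /=; rewrite !chart_invK // join_split.
  apply/subspace_continuousP => p /prod_chart_img [cp dp].
  have cj : {for p, continuous (fun q => join' (chart_inv c q.1) (chart_inv d q.2))}.
    apply: join_continuous.
      exact: (cvg_comp _ _ (@cvg_fst _ _ (nbhs p.1) (nbhs p.2) _) (chart_inv_continuous Hc cp)).
    exact: (cvg_comp _ _ (@cvg_snd _ _ (nbhs p.1) (nbhs p.2) _) (chart_inv_continuous Hd dp)).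
  exact: cvg_within_filter cj.
- have -> : chart_img P = (fst @^-1` chart_img c) `&` (snd @^-1` chart_img d).
    by apply/seteqP; split=> p /prod_chart_img.
  apply: openI; apply: open_comp; try exact: open_chart_img.
    by move=> p _; exact: cvg_fst.
  by move=> p _; exact: cvg_snd.
- by exists (x, y); apply/prod_chart_img.
Qed.

End ProdChart.

Variables X Y : charted R.
Hypotheses (HX : is_atlas (atlas X)) (HY : is_atlas (atlas Y)).

Definition product_charts : set (chart R (dim X + dim Y) (X * Y)%type) :=
  [set e | exists c d, [/\ atlas X c, atlas Y d & e = prod_chart c d]].

Lemma is_atlas_product_charts : is_atlas product_charts.
Proof.
have tr P Q : product_charts P -> product_charts Q -> smooth_transition P Q.
  move=> [c [d [Ac Ad ->]]] [c' [d' [Ac' Ad' ->]]] w [cw dw].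
  have Hc := atlas_chart HX Ac; have Hd := atlas_chart HY Ad.
  have Hc' := atlas_chart HX Ac'; have Hd' := atlas_chart HY Ad'.
  move=> Iw; have /(prod_chart_img Hc' Hd') [/= c'w d'w] := Iw.
  have HP := prod_is_chart Hc Hd; have HQ := prod_is_chart Hc' Hd'.
  have s1 := atlas_transition HX Ac Ac' cw c'w.
  have s2 := atlas_transition HY Ad Ad' dw d'w.
  have domw : chart_dom (prod_chart c d) w by [].
  have t1 := smooth_at_comp domw (@smooth_split_fst R (dim X) (dim Y) (corners c)
    (corners d) (chart_dom (prod_chart c d)) w) s1.
  have t2 := smooth_at_comp domw (@smooth_split_snd R (dim X) (dim Y) (corners c)
    (corners d) (chart_dom (prod_chart c d)) w) s2.
  have D1 : \forall v \near w, chart_dom (prod_chart c d) v ->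
      chart_dom c (split_fst (corners c) (corners d) v).
    by apply: filterE => v [].
  have D2 : \forall v \near w, chart_dom (prod_chart c d) v ->
      chart_dom d (split_snd (corners c) (corners d) v).
    by apply: filterE => v [].
  have {D1}t1 := t1 D1; have {D2}t2 := t2 D2.
  have t := @smooth_join R _ _ (corners c') (corners d') _ _ _ _ _ t1 t2.
  refine (smooth_atS _ t).
  apply: filterS (transition_near HP HQ domw Iw) => v H domv; split=> //.
  by rewrite [in RHS]/= (prod_chart_invE Hc' Hd') //; exact: H.
have ch P : product_charts P -> is_chart P.
  move=> [c [d [Ac Ad ->]]]; apply: prod_is_chart.
    exact: (atlas_chart HX).
  exact: (atlas_chart HY).
split=> //.
  by move=> P Q HP HQ; apply/compatibleP; [exact: ch|exact: ch|split; exact: tr].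
rewrite -subTset => p _.
have [c Ac cp] := atlas_cover p.1 HX; have [d Ad dp] := atlas_cover p.2 HY.
exists (prod_chart c d); first by exists c, d.
by apply/prod_chart_img => //; [exact: (atlas_chart HX)|exact: (atlas_chart HY)].
Qed.

Lemma is_atlas_product : is_atlas (atlas (product X Y)).
Proof. exact: is_atlas_max is_atlas_product_charts. Qed.

Lemma prod_chart_atlas c d : atlas X c -> atlas Y d ->
  atlas (product X Y) (prod_chart c d).
Proof.
move=> Ac Ad; apply: (atlas_sub_max is_atlas_product_charts).
by exists c, d.
Qed.

Lemma product_hausdorff : hausdorff_space X -> hausdorff_space Y ->
  hausdorff_space (product X Y).
Proof.
move=> hX hY [x y] [x' y'] H; congr pair.
  apply: hX => A B nA nB.
  have n1 : nbhs (x, y) (A `*` [set: Y]).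
    by exists (A, setT) => //; split=> //; exact: filterT.
  have n2 : nbhs (x', y') (B `*` [set: Y]).
    by exists (B, setT) => //; split=> //; exact: filterT.
  by have [[z t] [[/= Az _] [/= Bz _]]] := H _ _ n1 n2; exists z.
apply: hY => A B nA nB.
have n1 : nbhs (x, y) ([set: X] `*` A).
  by exists (setT, A) => //; split=> //; exact: filterT.
have n2 : nbhs (x', y') ([set: X] `*` B).
  by exists (setT, B) => //; split=> //; exact: filterT.
by have [[z t] [[/= _ Az] [/= _ Bz]]] := H _ _ n1 n2; exists t.
Qed.

End Product.

(** * Smooth functions and derivations *)

Section SmoothFun.
Context {R : realType} (X : charted R).
Hypothesis HX : is_atlas (atlas X).
Implicit Types (c d : chart R (dim X) X) (u v : 'rV[R]_(dim X)) (x y : X).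
Implicit Types (V : set X) (a b h : X -> R) (i : 'I_(dim X)).

Let ac c : atlas X c -> is_chart c. Proof. exact: atlas_chart. Qed.

Lemma smooth_fun_at V h c u : open V -> smooth_fun V h -> atlas X c ->
  chart_dom c u -> V (chart_map c u) -> smooth_at (chart_dom c) (h \o chart_map c) u.
Proof.
move=> oV sh Ac cu Vu; have Hc := ac Ac.
have := smooth_on_smooth_at (sh c Ac) (conj cu Vu : (_ `&` _) u).
apply: smooth_atS.
have : \forall v \near u, chart_dom c v -> V (chart_map c v).
  by apply/chart_near => //; exact: open_nbhs_nbhs.
by apply: filterS => v H cv; split=> //; split=> //; exact: H.
Qed.

Lemma smooth_funI V h : (forall x, V x -> exists c u, [/\ atlas X c,
    chart_dom c u, chart_map c u = x &
    smooth_at (chart_dom c) (h \o chart_map c) u]) -> smooth_fun V h.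
Proof.
move=> H d Ad; apply: smooth_onP_real => w [dw Vw].
have [c [u [Ac cu uw sh]]] := H _ Vw; have Hc := ac Ac; have Hd := ac Ad.
have cw : chart_img c (chart_map d w) by rewrite -uw; exact: chart_imgE.
have sd : smooth_at (chart_dom d) (h \o chart_map d) w.
  apply: (smooth_at_rechart_real Hd Hc) => //; first exact: (atlas_transition HX).
  by rewrite -uw chart_invK.
by apply: smooth_atW sd => v [].
Qed.

Lemma atlas_point x : exists c u, [/\ atlas X c, chart_dom c u & chart_map c u = x].
Proof. by have [c Ac [u cu ux]] := atlas_cover x HX; exists c, u. Qed.

Lemma smooth_funD V a b : open V -> smooth_fun V a -> smooth_fun V b ->
  smooth_fun V (fun y => a y + b y).
Proof.
move=> oV sa sb; apply: smooth_funI => x Vx.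
have [c [u [Ac cu ux]]] := atlas_point x; exists c, u; split=> //.
have Vu : V (chart_map c u) by rewrite ux.
by apply: smooth_atD; [exact: (smooth_fun_at oV sa)|exact: (smooth_fun_at oV sb)].
Qed.

Lemma smooth_funM V a b : open V -> smooth_fun V a -> smooth_fun V b ->
  smooth_fun V (fun y => a y * b y).
Proof.
move=> oV sa sb; apply: smooth_funI => x Vx.
have [c [u [Ac cu ux]]] := atlas_point x; exists c, u; split=> //.
have Vu : V (chart_map c u) by rewrite ux.
by apply: smooth_atM; [exact: (smooth_fun_at oV sa)|exact: (smooth_fun_at oV sb)].
Qed.

Lemma smooth_fun_cst V (l : R) : smooth_fun V (fun=> l).
Proof.
apply: smooth_funI => x Vx.
have [c [u [Ac cu ux]]] := atlas_point x; exists c, u; split=> //.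
exact: smooth_at_cst.
Qed.

Lemma smooth_funW V V' h : open V -> V' `<=` V -> smooth_fun V h -> smooth_fun V' h.
Proof.
move=> oV VV sh; apply: smooth_funI => x /VV Vx.
have [c [u [Ac cu ux]]] := atlas_point x; exists c, u; split=> //.
by apply: (smooth_fun_at oV) => //; rewrite ux.
Qed.

Section Cutoff.
Hypothesis hX : hausdorff_space X.

Definition cutoff V (chi : X -> R) : Prop :=
  smooth_fun setT chi /\
  exists K, [/\ closed K, K `<=` V & forall y, ~ K y -> chi y = 0].

Lemma cutoffM V chi a : open V -> cutoff V chi -> smooth_fun V a ->
  smooth_fun setT (fun y => chi y * a y).
Proof.
move=> oV [schi [K [cK KV chi0]]] sa; apply: smooth_funI => x _.
have [c [u [Ac cu ux]]] := atlas_point x; exists c, u; split=> //.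
have [Kx|nKx] := pselect (K x).
  apply: smooth_atM; first by apply: (smooth_fun_at openT schi).
  by apply: (smooth_fun_at oV sa) => //; rewrite ux; exact: KV.
apply: smooth_atS (smooth_at_cst (chart_dom c) (0 : R) u).
have : \forall y \near chart_map c u, (~` K) y.
  by rewrite ux; apply: open_nbhs_nbhs; split=> //; exact: closed_openC.
move/(chart_near _ (ac Ac) cu); apply: filterS => v H cv; split=> //.
by rewrite /= chi0 ?mul0r //; exact: H.
Qed.

Lemma cutoff_ex V x : open V -> V x ->
  exists chi, cutoff V chi /\ \forall y \near x, chi y = 1.
Proof.
move=> oV Vx; have [c [u [Ac cu ux]]] := atlas_point x; have Hc := ac Ac.
have nV : \forall y \near chart_map c u, V y by rewrite ux; exact: open_nbhs_nbhs.
have [r [Hr rV]] := adapted_ex Hc cu nV; have [r0 adr] := Hr.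
pose s := r / 3; have s0 : 0 < s by rewrite divr_gt0.
pose chi y : R := if `[< chart_img c y >] then box_bump u s (chart_inv c y) else 0.
pose seg (j : 'I_(dim X)) : set R := if `[< active c u j >] then `[0, 2 * s]%classic
  else `[u 0 j - 2 * s, u 0 j + 2 * s]%classic.
pose K' : set 'rV[R]_(dim X) := [set v | forall j, seg j (v 0 j)].
have cK' : compact K'.
  apply: rV_compact => j; rewrite /seg; case: asboolP => _; exact: segment_compact.
have segP j (t : R) : seg j t <-> `|u 0 j - t| <= 2 * s /\ (active c u j -> 0 <= t).
  rewrite /seg; case: asboolP => [aj|naj] /=; rewrite in_itv /=.
    have [_ ->] := aj; rewrite sub0r normrN; split=> [/andP[t0 t1]|[t1 t0]].
      by rewrite ger0_norm.
    by rewrite t0 //= (le_trans (ler_norm t)).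
  rewrite ler_distlC; split=> [/andP[H1 H2]|[/andP[H1 H2] _]].
    by split=> //; apply/andP; split; lra.
  by apply/andP; split; lra.
have K'b v : K' v -> ball u r v.
  move=> Kv; apply/ball_rVP => // j; have [H _] := (segP j _).1 (Kv j).
  apply: le_lt_trans H _; rewrite /s; lra.
have K'dom v : K' v -> chart_dom c v.
  move=> Kv; apply/(proj1 (adr v (K'b v Kv))) => j aj.
  by have [_] := (segP j _).1 (Kv j); apply.
have domK' v : chart_dom c v -> (forall j, `|u 0 j - v 0 j| <= 2 * s) -> K' v.
  move=> cv Hv j; apply/segP; split=> // aj.
  have bv : ball u r v.
    apply/ball_rVP => // l; apply: le_lt_trans (Hv l) _; rewrite /s; lra.
  exact: (proj1 (proj1 (adr v bv)) cv).
pose K := chart_map c @` K'.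
have clK : closed K.
  apply: compact_closed => //; apply: continuous_compact => //.
  have [_ _ [_ + _] _ _] := Hc; apply: continuous_subspaceW; exact: K'dom.
have chi0 y : ~ K y -> chi y = 0.
  move=> nK; rewrite /chi; case: asboolP => // cy.
  have [j Hj] : exists j, 2 * s <= `|chart_inv c y 0 j - u 0 j|.
    apply: contrapT => nj; apply: nK; exists (chart_inv c y); last exact: chart_mapK.
    apply: domK'; first exact: chart_inv_dom.
    move=> j; rewrite distrC leNgt; apply/negP => /ltW Hj; apply: nj.
    by exists j.
  exact: box_bump_eq0 s0 Hj.
exists chi; split; last first.
  rewrite -ux; apply/(chart_near _ Hc cu).
  have : \forall v \near u, ball u s v by exact: nbhsx_ballx.
  apply: filterS => v /(ball_rVP _ _ s0) bv cv.
  rewrite /chi; case: asboolP => [_|[]]; last exact: chart_imgE.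
  rewrite chart_invK //; apply: box_bump_eq1 => // j.
  by rewrite distrC ltW.
split; last first.
  exists K; split=> // y [v Kv <-]; apply: rV; [exact: K'b|exact: K'dom].
apply: smooth_funI => y _.
have [cy|ncy] := pselect (chart_img c y).
  exists c, (chart_inv c y); split=> //; [exact: chart_inv_dom|exact: chart_mapK|].
  have sb : smooth_at (chart_dom c) (box_bump u s) (chart_inv c y).
    by apply: (smooth_at_Cinfty _ openT) => //; apply: Cinfty_box_bump; exact: openT.
  apply: smooth_atW sb => v cv; split=> //.
  by rewrite /= /chi chart_invK //; case: asboolP => // -[]; exact: chart_imgE.
have [d [w [Ad dw wy]]] := atlas_point y; exists d, w; split=> //.
apply: smooth_atS (smooth_at_cst (chart_dom d) (0 : R) w).
have : \forall z \near chart_map d w, (~` K) z.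
  rewrite wy; apply: open_nbhs_nbhs; split; first exact: closed_openC.
  by move=> [v Kv vy]; apply: ncy; exists v => //; exact: K'dom.
move/(chart_near _ (ac Ad) dw); apply: filterS => v H dv; split=> //.
by rewrite /= chi0 //; exact: H.
Qed.

Section Derivation.
Variables (V : set X) (x : X) (D : (X -> R) -> R).
Hypotheses (oV : open V) (Vx : V x) (HD : derivation V x D).

Lemma derivation0 : D (fun=> 0) = 0.
Proof.
have [_ lin _] := HD.
have := lin 1 (fun=> 0) (fun=> 0) (smooth_fun_cst V 0) (smooth_fun_cst V 0).
rewrite (_ : (fun _ => _) = (fun=> 0)); last first.
  by apply/funext => y; rewrite mulr0 addr0.
by lra.
Qed.

Lemma derivation_local k : smooth_fun V k -> (\forall y \near x, k y = 0) -> D k = 0.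
Proof.
move=> sk /near_openE [N [oN Nx kN]]; have [wd _ leib] := HD.
have [chi [[schi [K [cK KN chi0]]] chi1]] := cutoff_ex oN Nx.
have schiV : smooth_fun V chi by apply: smooth_funW schi => //; exact: openT.
have := leib chi k schiV sk.
rewrite (kN x Nx) mul0r addr0 (nbhs_singleton chi1) mul1r => <-.
rewrite -derivation0; apply: wd.
- exact: smooth_funM.
- exact: smooth_fun_cst.
move=> y _; have [/KN /kN ->|/chi0 ->] := pselect (K y); first by rewrite mulr0.
by rewrite mul0r.
Qed.

Lemma derivation_germ a b : smooth_fun V a -> smooth_fun V b ->
  (\forall y \near x, a y = b y) -> D a = D b.
Proof.
move=> sa sb ab; have [_ lin _] := HD.
have sk : smooth_fun V (fun y => -1 * a y + b y).
  by apply: smooth_funD => //; apply: smooth_funM => //; exact: smooth_fun_cst.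
have := lin (-1) a b sa sb; rewrite derivation_local //; first by lra.
by apply: filterS ab => y ->; lra.
Qed.

End Derivation.
End Cutoff.
End SmoothFun.

(** * Boundary defining functions *)

Section LocalForm.
Context {R : realType} {n : nat}.

Definition coord_multiple (D : set 'rV[R]_n) u (i : 'I_n) (F : 'rV[R]_n -> R) : Prop :=
  exists h : 'rV[R]_n -> R, [/\ 0 < h u, h @ within D (nbhs u) --> h u &
    \forall v \near u, D v -> F v = v 0 i * h v].

Lemma coord_multiple_pos D u i F : D u -> coord_multiple D u i F ->
  exists h : 'rV[R]_n -> R, \forall v \near u, D v -> 0 < h v /\ F v = v 0 i * h v.
Proof.
move=> Du [h [h0 ch FE]]; exists h.
have H : \forall v \near u, D v -> 0 < h v by exact: (ch _ (lt_nbhsr h0)).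
by apply: filterS2 H FE => v H FE Dv; split; [exact: H|exact: FE].
Qed.

Lemma eq_coord_multiple D u i F F' : (\forall v \near u, D v -> F v = F' v) ->
  coord_multiple D u i F -> coord_multiple D u i F'.
Proof.
move=> FF [h [h0 ch FE]]; exists h; split=> //.
by apply: filterS2 FF FE => v H FE Dv; rewrite -H // FE.
Qed.

Lemma coord_multiple_coord D u i : D u -> coord_multiple D u i (fun v => v 0 i).
Proof.
move=> Du; exists (fun=> 1); split=> //; first exact: cvg_cst.
by apply: filterE => v _; rewrite mulr1.
Qed.

End LocalForm.

Section BoundaryDefining.
Context {R : realType} (X : charted R).
Hypotheses (HX : is_atlas (atlas X)) (hX : hausdorff_space X).
Implicit Types (c d : chart R (dim X) X) (u v : 'rV[R]_(dim X)) (x y : X).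
Implicit Types (V : set X) (b : X -> R) (i j : 'I_(dim X)) (p q : bdry X).

Let ac c : atlas X c -> is_chart c. Proof. exact: atlas_chart. Qed.

Lemma bdf_vanish p V b c u i : bdry_def_fun p V b -> atlas X c -> chart_dom c u ->
  chart_map c u = bdry_pt p -> active c u i -> face_comp c i u (bdry_comp p) ->
  \forall v \near u, chart_dom c v -> v 0 i = 0 -> b (chart_map c v) = 0.
Proof.
move=> [_ _ _ [V' [oV' V'p _ b0 _]]] Ac cu up ai fp.
have [e [fe eu ep]] := facet_chart_ex HX Ac cu up ai fp.
have He := facet_is_chart HX fe; have [_ _ _ _ Hm] := fe.
have H : \forall w \near remove i u, chart_dom e w -> V' (chart_map e w).
  by apply/(chart_near _ He eu); rewrite ep; exact: open_nbhs_nbhs.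
have {}H : \forall v \near u, chart_dom e (remove i v) -> V' (chart_map e (remove i v)).
  exact: (@remove_continuous R _ i u _ H).
apply: filterS H => v H cv vi.
have ev : chart_dom e (remove i v) by apply/(facet_domE fe); rewrite removeK.
have [vE _] := Hm _ ev; rewrite removeK // in vE.
by rewrite -vE; apply: b0; exact: H.
Qed.

Lemma bdf_coord_multiple p V b c u i : bdry_def_fun p V b -> atlas X c ->
  chart_dom c u -> chart_map c u = bdry_pt p -> active c u i ->
  face_comp c i u (bdry_comp p) ->
  coord_multiple (chart_dom c) u i (b \o chart_map c).
Proof.
move=> bdf Ac cu up ai fp; have Hc := ac Ac.
have vanish := bdf_vanish bdf Ac cu up ai fp.
have [[oV Vp] [b_ge0 sb] [D HD Db] _] := bdf.
have Vu : V (chart_map c u) by rewrite up.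
have [G0 [G [oG0 G0u sG GE]]] := smooth_fun_at HX oV sb Ac cu Vu.
have H : \forall v \near u, [/\ G0 v, chart_dom c v -> V (chart_map c v),
    chart_dom c v -> v 0 i = 0 -> b (chart_map c v) = 0 &
    (chart_dom c v <-> forall i, active c u i -> 0 <= v 0 i)].
  have n1 : \forall v \near u, G0 v by exact: open_nbhs_nbhs.
  have n2 : \forall v \near u, chart_dom c v -> V (chart_map c v).
    by apply/(chart_near _ Hc cu); exact: open_nbhs_nbhs.
  apply: filterS2 (filterI n1 n2) (filterI vanish (chart_dom_near Hc cu)).
  by move=> v [? ?] [? []].
have /nbhs_ballP[r /= r0 Hr] := H.
have ui : u 0 i = 0 by case: ai.
have sGb : Cinfty (ball u r) G by move=> k; apply: Ck_sub (sG k) => v /Hr [].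
have [h sh hE] := Hadamard ui r0 sGb.
have bE v : ball u r v -> chart_dom c v -> b (chart_map c v) = v 0 i * h v.
  move=> bv cv; have [Gv _ _ dv] := Hr v bv.
  have b0v : ball u r (scale_coord i 0 v).
    by apply: ball_scale_coord => //; rewrite lexx ler01.
  have [G0v _ van dv0] := Hr _ b0v.
  have c0v : chart_dom c (scale_coord i 0 v).
    apply/dv0 => j aj; rewrite mxE.
    by case: (j == i); rewrite /= ?expr1 ?mul0r // expr0 mul1r; apply: (dv.1 cv).
  have z0 : scale_coord i 0 v 0 i = 0 by rewrite mxE eqxx expr1 mul0r.
  by rewrite -hE // -[in LHS]/((b \o chart_map c) v) -GE // [G (scale_coord _ _ _)]GE //=
    van // subr0.
have ch : {for u, continuous h} by apply: (sh 0%N); exact: ballxx.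
have nb : \forall v \near u, ball u r v by exact: nbhsx_ballx.
have Ci : cone (corners c) u (delta_mx 0 i).
  by move=> j jk _; rewrite mxE eqxx /=; case: (j == i).
have hu0 : 0 <= h u.
  have chl : (fun t : R => h (t *: delta_mx 0 i + u)) @ (0 : R)^'+ --> h u.
    move=> P nP; have Hn : \forall v \near u, P (h v) by exact: (ch _ nP).
    suff : \forall t \near (0 : R)^'+, P (h (t *: delta_mx 0 i + u)) by [].
    exact: near_line Hn.
  apply: (cvgr_to_ge chl).
  have t0 : \forall t \near 0^'+, 0 < (t : R) by exact: nbhs_right_gt.
  have nl : \forall t \near 0^'+, ball u r ((t : R) *: delta_mx 0 i + u) /\
      chart_dom c (t *: delta_mx 0 i + u).
    exact: filterI (near_line (delta_mx 0 i) nb) (cone_near Hc cu Ci).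
  apply: filterS2 t0 nl => t t0 [bt ct].
  have [_ Vt _ _] := Hr _ bt; have := b_ge0 _ (Vt ct).
  by rewrite (bE _ bt ct) !mxE !eqxx /= mulr1 ui addr0 pmulr_rge0.
exists h; split; last first.
- by apply: filterS nb => v bv cv; exact: bE.
- exact: cvg_within_filter ch.
rewrite lt_neqAle hu0 andbT eq_sym; apply/eqP => hu; apply: Db.
have [B [oB Bu BE]] := image_ball_open Hc cu r0.
pose N := B `&` V.
have oN : open N by exact: openI.
have [chi [cchi chi1]] := cutoff_ex HX hX oN (conj Bu Vu : N (chart_map c u)).
have NE y : N y -> exists v, [/\ chart_dom c v, ball u r v, chart_map c v = y & chart_inv c y = v].
  rewrite /N BE => -[[v [cv bv] vy] _]; exists v; split=> //.
  by rewrite -vy chart_invK.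
have sxi : smooth_fun N (fun y => chart_inv c y 0 i).
  apply: smooth_funI => // y /NE [v [cv bv vy _]]; exists c, v; split=> //.
  apply: smooth_atW (smooth_at_coord (chart_dom c) i v) => w cw; split=> //.
  by rewrite /= chart_invK.
have sh' : smooth_fun N (fun y => h (chart_inv c y)).
  apply: smooth_funI => // y /NE [v [cv bv vy _]]; exists c, v; split=> //.
  have : smooth_at (chart_dom c) h v.
    by apply: (smooth_at_Cinfty _ (ball_open u r)).
  by apply: smooth_atW => w cw; split=> //=; rewrite chart_invK.
have sT W (g : X -> R) : smooth_fun setT g -> smooth_fun W g.
  by apply: smooth_funW => //; exact: openT.
have sA := cutoffM HX oN cchi sxi; have sB := cutoffM HX oN cchi sh'.
have [_ _ leib] := HD; have schi := cchi.1.
have chix : chi (chart_map c u) = 1 by exact: (nbhs_singleton chi1).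
have := leib _ _ (sT V _ sA) (sT V _ sB); rewrite -up chart_invK // chix ui hu.
rewrite !(mulr0, mul0r) addr0 => <-.
apply: (derivation_germ HX hX oV HD) => //.
  by apply: smooth_funM => //; exact: sT.
rewrite -up; have nN : \forall y \near chart_map c u, N y by exact: open_nbhs_nbhs.
apply: filterS2 chi1 nN => y -> /NE [v [cv bv <- ->]].
by rewrite !mul1r bE.
Qed.

Lemma coord_multiple_inj c u i j b : atlas X c -> chart_dom c u ->
  active c u i -> active c u j ->
  coord_multiple (chart_dom c) u i (b \o chart_map c) ->
  (\forall v \near u, chart_dom c v -> v 0 j = 0 -> b (chart_map c v) = 0) -> i = j.
Proof.
move=> Ac cu ai aj /(coord_multiple_pos cu) [h hb] b0.
have [r [Hr rP]] : exists r, adapted c u r /\ forall v, ball u r v -> chart_dom c v ->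
    (0 < h v /\ b (chart_map c v) = v 0 i * h v) /\
    (v 0 j = 0 -> b (chart_map c v) = 0).
  have [r1 [[r10 Hr1] _]] := adapted_ex (ac Ac) cu (@filterT _ (nbhs (chart_map c u)) _).
  have /nbhs_ballP[r2 /= r20 Hr2] : \forall v \near u,
      (chart_dom c v -> 0 < h v /\ b (chart_map c v) = v 0 i * h v) /\
      (chart_dom c v -> v 0 j = 0 -> b (chart_map c v) = 0).
    exact: filterI hb b0.
  exists (Num.min r1 r2); split.
    by apply: (@adapted_le _ _ _ _ r1) => //; rewrite ?ge_min ?lexx // lt_min r10.
  move=> v bv cv; have bv2 : ball u r2 v by apply: le_ball bv; rewrite ge_min lexx orbT.
  have [H1 H2] := Hr2 v bv2; split; [exact: H1|exact: H2].
have [v [bv cv [[jk vj] vU]]] := facet_nonempty Hr aj cu.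
have [[hv bE] bj] := rP v bv cv; apply: vU; split; first by case: ai.
by have /eqP := bj vj; rewrite bE mulf_eq0 (gt_eqF hv) orbF => /eqP.
Qed.

Lemma right_derivative c u (w : 'rV[R]_(dim X)) (F : 'rV[R]_(dim X) -> R) :
  is_chart c -> chart_dom c u ->
  cone (corners c) u w -> smooth_at (chart_dom c) F u ->
  exists l : R, (fun t : R => t^-1 * (F (t *: w + u) - F u)) @ (0 : R)^'+ --> l.
Proof.
move=> Hc cu Cw [G0 [G [oG0 G0u sG GE]]].
have dG : derivable G u w by apply: diff_derivable; have [+ _] := sG 1%N; exact.
exists ('D_w G u); have := derive_right_cvg dG; apply: cvg_trans.
apply: near_eq_cvg; have nG : \forall v \near u, G0 v by exact: open_nbhs_nbhs.
apply: filterS2 (near_line w nG) (cone_near Hc cu Cw) => t Gt ct.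
by rewrite !GE.
Qed.

Lemma bdf_intro p V b c u i : open V -> (forall x, V x -> 0 <= b x) ->
  smooth_fun V b -> atlas X c -> chart_dom c u -> V (chart_map c u) ->
  chart_map c u = bdry_pt p -> active c u i -> face_comp c i u (bdry_comp p) ->
  coord_multiple (chart_dom c) u i (b \o chart_map c) -> bdry_def_fun p V b.
Proof.
move=> oV b_ge0 sb Ac cu Vu up ai fp cm; have Hc := ac Ac; have [ik ui] := ai.
have nV : \forall v \near u, chart_dom c v -> V (chart_map c v).
  by apply/(chart_near _ Hc cu); exact: open_nbhs_nbhs.
split; rewrite -?up //.
  have Ci : cone (corners c) u (delta_mx 0 i).
    by move=> j jk _; rewrite mxE eqxx /=; case: (j == i).
  pose x_ (t : R) := chart_map c (t *: delta_mx 0 i + u).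
  pose q (a : X -> R) (t : R) := t^-1 * (a (x_ t) - a (chart_map c u)).
  pose D a : R := lim (q a @ (0 : R)^'+).
  have qcvg a : smooth_fun V a -> q a @ (0 : R)^'+ --> D a.
    move=> sa; apply/cvg_ex.
    exact: (right_derivative Hc cu Ci (smooth_fun_at HX oV sa Ac cu Vu)).
  have DE a (l : R) : q a @ (0 : R)^'+ --> l -> D a = l by apply: cvg_lim; exact: Rhausdorff.
  have ct := cone_near Hc cu Ci.
  have Vt : \forall t \near 0^'+, V (x_ t).
    by apply: filterS2 (near_line (delta_mx 0 i) nV) ct => t; exact.
  exists D.
    split.
    - move=> a a' sa sa' aa; apply: DE; apply: cvg_trans (qcvg a' sa').
      apply: near_eq_cvg; apply: filterS Vt => t Vt.
      by rewrite /q !aa.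
    - move=> l a a' sa sa'; apply: DE.
      have : (fun t => l * q a t + q a' t) @ (0 : R)^'+ --> l * D a + D a'.
        by apply: cvgD; [apply: cvgMl_tmp; exact: qcvg|exact: qcvg].
      apply: cvg_trans; apply: near_eq_cvg; apply: filterE => t.
      by rewrite /q /=; ring.
    - move=> a a' sa sa'; apply: DE.
      have ca : (fun t => a (x_ t)) @ (0 : R)^'+ --> a (chart_map c u).
        have sca := smooth_fun_at HX oV sa Ac cu Vu.
        have cc := smooth_at_cvg cu sca.
        move=> P nP; have H : \forall v \near u, chart_dom c v -> P (a (chart_map c v)).
          exact: (cc _ nP).
        suff : \forall t \near (0 : R)^'+, P (a (x_ t)) by [].
        by apply: filterS2 (near_line (delta_mx 0 i) H) ct => t; exact.
      have : (fun t => a (x_ t) * q a' t + a' (chart_map c u) * q a t) @ (0 : R)^'+ -->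
          a (chart_map c u) * D a' + a' (chart_map c u) * D a.
        apply: cvgD; first by apply: cvgM => //; exact: qcvg.
        by apply: cvgMl_tmp; exact: qcvg.
      apply: cvg_trans; apply: near_eq_cvg; apply: filterE => t.
      by rewrite /q /=; ring.
  have [h [h0 ch bE]] := cm.
  suff -> : D b = h u by apply/eqP; rewrite gt_eqF.
  apply: DE.
  have chl : (fun t : R => h (t *: delta_mx 0 i + u)) @ (0 : R)^'+ --> h u.
    move=> P nP; have H : \forall v \near u, chart_dom c v -> P (h v) by exact: (ch _ nP).
    suff : \forall t \near (0 : R)^'+, P (h (t *: delta_mx 0 i + u)) by [].
    by apply: filterS2 (near_line (delta_mx 0 i) H) ct => t; exact.
  apply: cvg_trans chl; apply: near_eq_cvg.
  have t0 : \forall t \near 0^'+, 0 < (t : R) by exact: nbhs_right_gt.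
  have bu : b (chart_map c u) = 0.
    by have /= -> := nbhs_singleton bE cu; rewrite ui mul0r.
  apply: filterS2 t0 (filterI (near_line (delta_mx 0 i) bE) ct) => t t0 [bt ctt].
  rewrite /q bu subr0 /x_; have /= -> := bt ctt.
  by rewrite !mxE !eqxx mulr1 ui addr0 mulKf // gt_eqF.
have [h hb] := coord_multiple_pos cu cm.
have [e [fe eu ep]] := facet_chart_ex HX Ac cu up ai fp.
have He := facet_is_chart HX fe; have [_ _ _ _ Hm] := fe.
have /nbhs_ballP[r /= r0 Hr] : \forall v \near u,
    (chart_dom c v -> V (chart_map c v)) /\
    (chart_dom c v -> 0 < h v /\ b (chart_map c v) = v 0 i * h v).
  exact: filterI nV hb.
have bins (w : 'rV[R]_(dim X).-1) : ball (remove i u) r w <-> ball u r (insert0 i w).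
  split=> /(ball_rVP _ _ r0) H; apply/ball_rVP => // j.
    case: (unliftP i j) => [j' ->|->]; last by rewrite ui insert0_eq subrr normr0.
    by have := H j'; rewrite insert0_lift mxE.
  by have := H (lift i j); rewrite insert0_lift mxE.
pose V' := chart_map e @` (chart_dom e `&` ball (remove i u) r).
have V'E q : V' q -> exists w, [/\ chart_dom e w, ball u r (insert0 i w),
    chart_dom c (insert0 i w), chart_map e w = q & bdry_pt q = chart_map c (insert0 i w)].
  move=> [w [ew bw] wq]; exists w; split=> //; first exact/bins.
    exact/(facet_domE fe).
  by rewrite -wq; have [] := Hm w ew.
have bq q : V' q -> b (bdry_pt q) = 0.
  move=> /V'E [w [ew bw cw _ ->]]; have [_ H] := Hr _ bw; have [_ ->] := H cw.
  by rewrite insert0_eq mul0r.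
exists V'; split=> //.
- exact: (facet_map_open HX fe (ball_open _ _)).
- by exists (remove i u) => //; split=> //; exact: ballxx.
- by move=> q /V'E [w [ew bw cw _ qE]]; rewrite /preimage /= qE; have [H _] := Hr _ bw; exact: H.
have [B [oB Bu BE]] := image_ball_open Hc cu r0.
exists ((V `&` [set x | b x = 0]) `&` B); first by exists B.
have OE y : ((V `&` [set x | b x = 0]) `&` B) y -> exists v, [/\ chart_dom c v,
    ball u r v, v 0 i = 0, chart_map c v = y & chart_dom e (remove i v)].
  move=> [[Vy by0]]; rewrite BE => -[v [cv bv] vy]; exists v.
  have [_ H] := Hr v bv; have [hv bE] := H cv.
  have vi : v 0 i = 0.
    move: by0 => /= /eqP; rewrite -vy bE mulf_eq0 (gt_eqF hv) orbF.
    by move/eqP.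
  by split=> //; apply/(facet_domE fe); rewrite removeK.
split.
- split.
  + move=> q V'q; have [w [ew bw cw wq qE]] := V'E q V'q; split.
      split; last exact: bq.
      by rewrite qE; have [H _] := Hr _ bw; exact: H.
    by rewrite BE qE; exists (insert0 i w).
  + move=> q1 q2; rewrite !inE => /V'E [w1 [ew1 bw1 cw1 wq1 qE1]].
    move=> /V'E [w2 [ew2 bw2 cw2 wq2 qE2]]; rewrite qE1 qE2 => wE.
    have ww := chart_map_inj Hc cw1 cw2 wE.
    by rewrite -wq1 -wq2; congr chart_map; rewrite -(insert0K i w1) ww insert0K.
  + move=> y /OE [v [cv bv vi vy ev]]; exists (chart_map e (remove i v)).
      by exists (remove i v) => //; split=> //; apply/bins; rewrite removeK.
    by have [-> _] := Hm _ ev; rewrite removeK.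
- by apply: continuous_subspaceT; exact: bdry_pt_continuous.
exists (fun y => chart_map e (remove i (chart_inv c y))); split.
  move=> q; rewrite inE => /V'E [w [ew bw cw wq qE]].
  by rewrite qE chart_invK // insert0K.
apply/subspace_continuousP => y Oy P nP.
have [v [cv bv vi vy ev]] := OE y Oy.
have yE : chart_inv c y = v by rewrite -vy chart_invK.
rewrite /from_subspace yE in nP.
have H : \forall w \near remove i v, chart_dom e w -> P (chart_map e w).
  by apply/(chart_near _ He ev).
have {}H : \forall v2 \near v, chart_dom e (remove i v2) -> P (chart_map e (remove i v2)).
  exact: (@remove_continuous R _ i v _ H).
have {}H : \forall z \near y, chart_dom e (remove i (chart_inv c z)) ->
    P (chart_map e (remove i (chart_inv c z))).
  have cy : chart_img c y by rewrite -vy; exact: chart_imgE.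
  have H2 : \forall w \near chart_inv c y, chart_dom e (remove i w) ->
    P (chart_map e (remove i w)) by rewrite yE.
  exact: (chart_inv_continuous Hc cy H2).
apply: filterS H => z H Oz; apply: H.
by have [v2 [cv2 _ _ vz ev2]] := OE z Oz; rewrite -vz chart_invK.
Qed.

Lemma bdf_facet p V b c u : bdry_def_fun p V b -> atlas X c -> chart_dom c u ->
  chart_map c u = bdry_pt p -> exists i, [/\ active c u i,
    face_comp c i u (bdry_comp p) & coord_multiple (chart_dom c) u i (b \o chart_map c)].
Proof.
move=> bdf Ac cu up.
have lb : local_bdry_comp (chart_map c u) (bdry_comp p) by rewrite up; exact: bdryP.
have [i ai fp] := local_bdry_face HX Ac cu lb; exists i; split=> //.
exact: (bdf_coord_multiple bdf Ac cu up ai fp).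
Qed.

Lemma bdf_exists_unique V b c u i : open V -> (forall x, V x -> 0 <= b x) ->
  smooth_fun V b -> atlas X c -> chart_dom c u -> V (chart_map c u) ->
  active c u i -> coord_multiple (chart_dom c) u i (b \o chart_map c) ->
  exists! q : bdry X, bdry_pt q = chart_map c u /\ bdry_def_fun q V b.
Proof.
move=> oV b_ge0 sb Ac cu Vu ai cm.
have [beta fb] := face_comp_ex HX Ac cu ai; have [lb _] := fb.
exists (Bdry lb); split.
  by split=> //; apply: (@bdf_intro (Bdry lb) V b c u i).
move=> q [qE bdf].
have [j [aj fq cmj]] := bdf_facet bdf Ac cu (esym qE).
have ij := coord_multiple_inj Ac cu ai aj cm (bdf_vanish bdf Ac cu (esym qE) aj fq).
apply: bdry_eq => //=.
by apply: (face_comp_eq HX Ac cu ai fb); rewrite ij.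
Qed.

End BoundaryDefining.

(** * Smooth maps in charts *)

Lemma coord_multiple_comp (R : realType) m n (D : set 'rV[R]_m) (D' : set 'rV[R]_n)
    (F : 'rV[R]_m -> 'rV[R]_n) (G : 'rV[R]_n -> R) u i j :
  D u -> smooth_at D F u -> (\forall v \near u, D v -> D' (F v)) ->
  coord_multiple D u i (fun v => F v 0 j) -> coord_multiple D' (F u) j G ->
  coord_multiple D u i (fun v => G (F v)).
Proof.
move=> Du sF DD' [h [h0 ch FE]] [h' [h'0 ch' GE]].
have cF := smooth_at_cvg Du sF.
have cF' (P : set 'rV[R]_n) : (\forall w \near F u, D' w -> P w) ->
    \forall v \near u, D v -> P (F v).
  move=> HP; have H : \forall v \near u, D v -> D' (F v) -> P (F v) by exact: (cF _ HP).
  by apply: filterS2 H DD' => v H DD' Dv; apply: H => //; exact: DD'.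
exists (fun v => h v * h' (F v)); split.
- exact: mulr_gt0.
- apply: cvgM => // P nP.
  have HP : \forall w \near F u, D' w -> P (h' w) by exact: (ch' _ nP).
  exact: (cF' _ HP).
- have := cF' _ GE; apply: filterS2 FE => v FE GE' Dv.
  by rewrite GE' // FE // mulrA.
Qed.

Section ChartCriterion.
Context {R : realType}.

Definition smooth_in_charts m n (S T : topologicalType) (f : S -> T)
    (c : chart R m S) (d : chart R n T) (u : 'rV[R]_m) : Prop :=
  let F := chart_inv d \o f \o chart_map c in
  smooth_at (chart_dom c) F u /\
  forall j, active d (F u) j ->
    (\forall v \near u, chart_dom c v -> F v 0 j = 0) \/
    exists2 i, active c u i & coord_multiple (chart_dom c) u i (fun v => F v 0 j).

Lemma smooth_in_charts_id n (S T : topologicalType) (f : S -> T)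
    (c : chart R n S) (d : chart R n T) u :
  chart_dom c u -> corners c = corners d ->
  (forall v, chart_dom c v -> chart_inv d (f (chart_map c v)) = v) ->
  smooth_in_charts f c d u.
Proof.
move=> cu cd FE; split.
  by apply: smooth_atW (smooth_at_id (chart_dom c) u) => v cv; rewrite /= FE.
move=> j [jd /=]; rewrite FE // => uj; right; exists j; first by split; rewrite // cd.
apply: eq_coord_multiple (coord_multiple_coord j cu); apply: filterE => v cv.
by rewrite FE.
Qed.

Section TwoManifolds.
Variables X Y : charted R.
Hypotheses (HX : is_atlas (atlas X)) (HY : is_atlas (atlas Y)).
Hypotheses (hX : hausdorff_space X) (hY : hausdorff_space Y).

Let acX c : atlas X c -> is_chart c. Proof. exact: atlas_chart. Qed.
Let acY c : atlas Y c -> is_chart c. Proof. exact: atlas_chart. Qed.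

Lemma weakly_smooth_at f c d u : @weakly_smooth R X Y f -> atlas X c -> atlas Y d ->
  chart_dom c u -> chart_img d (f (chart_map c u)) ->
  smooth_at (chart_dom c) (chart_inv d \o f \o chart_map c) u.
Proof.
move=> [cf sf] Ac Ad cu du.
have := smooth_on_smooth_at (sf c d Ac Ad) (conj cu du : (_ `&` _) u).
apply: smooth_atS.
by apply: filterS (preimage_near cf (acX Ac) (acY Ad) cu du) => v H cv;
  split=> //; split=> //; exact: H.
Qed.

Lemma smooth_fun_comp (f : X -> Y) V b : @weakly_smooth R X Y f -> open V ->
  smooth_fun V b -> smooth_fun (f @^-1` V) (b \o f).
Proof.
move=> wf oV sb; apply: (smooth_funI HX) => x Vx.
have [c [u [Ac cu ux]]] := atlas_point HX x.
have [d [w [Ad dw wy]]] := atlas_point HY (f x).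
have du : chart_img d (f (chart_map c u)) by rewrite ux -wy; exact: chart_imgE.
exists c, u; split=> //.
apply: (smooth_at_through_real wf.1 (acX Ac) (acY Ad)) => //.
  exact: weakly_smooth_at.
apply: (smooth_fun_at HY oV sb Ad); first exact: (chart_inv_dom (acY Ad)).
by rewrite chart_mapK // ux.
Qed.

Lemma smooth_mapI (f : X -> Y) : continuous f ->
  (forall x, exists c d u, [/\ atlas X c, atlas Y d, chart_dom c u &
     [/\ chart_map c u = x, chart_img d (f x) & smooth_in_charts f c d u]]) ->
  smooth_map f.
Proof.
move=> cf H; have wf : weakly_smooth f.
  split=> // c2 d2 Ac2 Ad2; apply: smooth_onP => u2 [cu2 du2].
  have [c [d [u [Ac Ad cu [ux du [sF _]]]]]] := H (chart_map c2 u2).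
  have Hc := acX Ac; have Hd := acY Ad; have Hc2 := acX Ac2; have Hd2 := acY Ad2.
  have du' : chart_img d (f (chart_map c u)) by rewrite ux.
  have c2u : chart_img c (chart_map c2 u2) by rewrite -ux; exact: chart_imgE.
  have s1 : smooth_at (chart_dom c) (chart_inv d2 \o f \o chart_map c) u.
    apply: (smooth_at_through cf Hc Hd) => //.
    apply: (atlas_transition HY) => //; first exact: chart_inv_dom.
    by rewrite chart_mapK // ux.
  have s2 : smooth_at (chart_dom c2) ((chart_inv d2 \o f) \o chart_map c2) u2.
    apply: (smooth_at_rechart Hc2 Hc) => //; first exact: (atlas_transition HX).
    by rewrite -ux chart_invK.
  by apply: smooth_atW s2 => v [].
split=> // x p V b pE bdf.
have [c [d [u [Ac Ad cu [ux du [sF cF]]]]]] := H x.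
have Hc := acX Ac; have Hd := acY Ad.
set F := _ \o _ in sF cF; set w := F u.
have wE : chart_map d w = f x by rewrite /w /F /= ux chart_mapK.
have dw : chart_dom d w by rewrite /w /F /= ux; exact: chart_inv_dom.
have [[oV Vp] [b_ge0 sb] _ _] := bdf.
have wp : chart_map d w = bdry_pt p by rewrite wE pE.
have [j [aj fj cmj]] := bdf_facet HY hY bdf Ad dw wp.
have du' : chart_img d (f (chart_map c u)) by rewrite ux.
have FD := preimage_dom_near cf Hc Hd cu du'; rewrite -/F in FD.
have FE := preimage_near cf Hc Hd cu du'.
have oW : open (f @^-1` V) by apply: open_comp => // y _; exact: cf.
have Wx : (f @^-1` V) x by rewrite /preimage /= -pE.
case: (cF j aj) => [F0|[i ai cmi]].
  left; have [h bE] := coord_multiple_pos dw cmj.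
  have cFu := smooth_at_cvg cu sF.
  have bE' : \forall v \near u, chart_dom c v -> chart_dom d (F v) ->
      0 < h (F v) /\ b (chart_map d (F v)) = F v 0 j * h (F v).
    exact: (cFu _ bE).
  have Z : \forall v \near u, chart_dom c v -> b (f (chart_map c v)) = 0.
    apply: filterS2 (filterI bE' F0) (filterI FD FE) => v [bEv F0v] [FDv FEv] cv.
    have [_] := bEv cv (FDv cv); rewrite F0v // mul0r => <-.
    by rewrite /F /= chart_mapK //; exact: FEv.
  have {}Z : \forall y \near x, b (f y) = 0.
    by rewrite -ux; apply/(chart_near _ Hc cu).
  have nW : \forall y \near x, (f @^-1` V) y by exact: open_nbhs_nbhs.
  have [N [oN Nx HN]] := near_openE (filterI nW Z).
  by exists N; split=> // y /HN [].
right.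
have cm : coord_multiple (chart_dom c) u i ((b \o f) \o chart_map c).
  have := coord_multiple_comp cu sF FD cmi cmj; apply: eq_coord_multiple.
  by apply: filterS FE => v FEv cv; rewrite /F /= chart_mapK //; exact: FEv.
have := @bdf_exists_unique R X HX hX (f @^-1` V) (b \o f) c u i oW.
rewrite ux; apply=> //; first by move=> y /b_ge0.
exact: smooth_fun_comp.
Qed.

Lemma smooth_map_charts (f : X -> Y) c d u : smooth_map f -> atlas X c -> atlas Y d ->
  chart_dom c u -> chart_img d (f (chart_map c u)) -> smooth_in_charts f c d u.
Proof.
move=> [wf bf] Ac Ad cu du; have Hc := acX Ac; have Hd := acY Ad.
have cf := wf.1; split; first exact: weakly_smooth_at.
move=> j; set F := _ \o _ => aj.
have dw : chart_dom d (F u) by exact: chart_inv_dom.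
have wE : chart_map d (F u) = f (chart_map c u) by exact: chart_mapK.
have [beta fb] := face_comp_ex HY Ad dw aj; have [lb _] := fb.
pose p := Bdry lb; pose b (y : Y) := chart_inv d y 0 j.
have pE : bdry_pt p = f (chart_map c u) by [].
have bdf : bdry_def_fun p (chart_img d) b.
  apply: (@bdf_intro R Y HY p (chart_img d) b d (F u) j) => //.
  - exact: open_chart_img.
  - move=> y dy; apply: (dom_orthant Hd (chart_inv_dom Hd dy)).
    by case: aj.
  - apply: (smooth_funI HY) => y [v dv vy]; exists d, v; split=> //.
    apply: smooth_atW (smooth_at_coord (chart_dom d) j v) => v' dv'; split=> //.
    by rewrite /b /= chart_invK.
  - by rewrite wE.
  - apply: eq_coord_multiple (coord_multiple_coord j dw); apply: filterE => v dv.
    by rewrite /b /= chart_invK.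
case: (bf _ p (chart_img d) b pE bdf) => [[N [oN Nx NV N0]]|[q [[qE bdfq] _]]].
  left; have : \forall y \near chart_map c u, N y by exact: open_nbhs_nbhs.
  by move/(chart_near _ Hc cu); apply: filterS => v H cv; apply: N0; exact: H.
right; have [i [ai _ cm]] := bdf_facet HX hX bdfq Ac cu (esym qE).
by exists i.
Qed.

End TwoManifolds.

Lemma smooth_map_id (X : charted R) : is_atlas (atlas X) -> hausdorff_space X ->
  smooth_map (fun x : X => x).
Proof.
move=> HX hX; apply: smooth_mapI => // [x|x]; first exact: cvg_id.
have [c [u [Ac cu ux]]] := atlas_point HX x.
exists c, c, u; split=> //; split=> //; first by rewrite -ux; exact: chart_imgE.
apply: smooth_in_charts_id => // v cv.
by rewrite chart_invK //; exact: (atlas_chart HX).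
Qed.

Lemma smooth_map_comp (X Y Z : charted R) (f : X -> Y) (g : Y -> Z) :
  is_atlas (atlas X) -> is_atlas (atlas Y) -> is_atlas (atlas Z) ->
  hausdorff_space X -> hausdorff_space Y -> hausdorff_space Z ->
  smooth_map f -> smooth_map g -> smooth_map (fun x => g (f x)).
Proof.
move=> HX HY HZ hX hY hZ sf sg; have cf := sf.1.1; have cg := sg.1.1.
apply: smooth_mapI => //.
  by move=> x; exact: (continuous_comp (cf x) (cg (f x))).
move=> x.
have [c [u [Ac cu ux]]] := atlas_point HX x.
have [d [w [Ad dw wy]]] := atlas_point HY (f x).
have [e [t [Ae et tz]]] := atlas_point HZ (g (f x)).
have Hc := atlas_chart HX Ac; have Hd := atlas_chart HY Ad.
have He := atlas_chart HZ Ae.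
have du : chart_img d (f (chart_map c u)) by rewrite ux -wy; exact: chart_imgE.
have ew : chart_img e (g (chart_map d w)) by rewrite wy -tz; exact: chart_imgE.
have [sF cF] := smooth_map_charts HX HY hX sf Ac Ad cu du.
have [sG cG] := smooth_map_charts HY HZ hY sg Ad Ae dw ew.
exists c, e, u; split=> //; split=> //; first by rewrite -tz; exact: chart_imgE.
set F := _ \o _ in sF cF; set G := _ \o _ in sG cG.
have FuE : F u = w by rewrite /F /= ux -wy chart_invK.
have FD := preimage_dom_near cf Hc Hd cu du; rewrite -/F in FD.
have FE := preimage_near cf Hc Hd cu du.
have GFE : \forall v \near u, chart_dom c v ->
    G (F v) = chart_inv e (g (f (chart_map c v))).
  by apply: filterS FE => v FEv cv; rewrite /G /F /= chart_mapK //; exact: FEv.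
rewrite -FuE in sG cG.
split.
  apply: smooth_atS (smooth_at_comp cu sF sG FD).
  by apply: filterS GFE => v GFEv cv; split=> //; exact: GFEv.
move=> l; rewrite /= -(nbhs_singleton GFE) // => al.
case: (cG l al) => [G0|[j aj cmj]].
  left; have cFu := smooth_at_cvg cu sF.
  have G0' : \forall v \near u, chart_dom c v -> chart_dom d (F v) -> G (F v) 0 l = 0.
    exact: (cFu _ G0).
  apply: filterS2 G0' (filterI GFE FD) => v G0v [GFEv FDv] cv.
  by rewrite -GFEv // G0v //; exact: FDv.
case: (cF j aj) => [F0|[i ai cmi]].
  left; rewrite FuE in cmj; have [h GE] := coord_multiple_pos dw cmj.
  have cFu := smooth_at_cvg cu sF; rewrite FuE in cFu.
  have GE' : \forall v \near u, chart_dom c v -> chart_dom d (F v) ->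
      0 < h (F v) /\ G (F v) 0 l = F v 0 j * h (F v).
    exact: (cFu _ GE).
  apply: filterS2 (filterI GE' F0) (filterI GFE FD) => v [GEv F0v] [GFEv FDv] cv.
  rewrite -GFEv //; have [_ ->] := GEv cv (FDv cv).
  by rewrite F0v // mul0r.
right; exists i => //.
have := coord_multiple_comp cu sF FD cmi cmj; apply: eq_coord_multiple.
by apply: filterS GFE => v GFEv cv; rewrite -GFEv.
Qed.

End ChartCriterion.

(** * The theorem *)

Section Isomorphisms.
Context {R : realType}.

Lemma smooth_pair_dim (X Y : charted R) (f : X -> Y) (g : Y -> X) (x : X) :
  is_atlas (atlas X) -> is_atlas (atlas Y) -> weakly_smooth f -> weakly_smooth g ->
  cancel f g -> cancel g f -> dim X = dim Y.
Proof.
move=> HX HY wf wg fK gK.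
have [c [u [Ac cu ux]]] := atlas_point HX x.
have [d [w [Ad dw wy]]] := atlas_point HY (f x).
have Hc := atlas_chart HX Ac; have Hd := atlas_chart HY Ad.
have du : chart_img d (f (chart_map c u)) by rewrite ux -wy; exact: chart_imgE.
have cw : chart_img c (g (chart_map d w)) by rewrite wy fK -ux; exact: chart_imgE.
pose F := chart_inv d \o f \o chart_map c; pose G := chart_inv c \o g \o chart_map d.
have FuE : F u = w by rewrite /F /= ux -wy chart_invK.
have FE := preimage_near wf.1 Hc Hd cu du; have GE := preimage_near wg.1 Hd Hc dw cw.
apply: (@dim_eq R _ _ X Y c d F G u) => //.
- exact: (weakly_smooth_at HX HY wf).
- by rewrite FuE; exact: (weakly_smooth_at HY HX wg).
- exact: (preimage_dom_near wf.1).
- by rewrite FuE; exact: (preimage_dom_near wg.1).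
- by apply: filterS FE => v H cv; rewrite /F /G /= chart_mapK ?fK ?chart_invK //; exact: H.
- rewrite FuE; apply: filterS GE => v H cv.
  by rewrite /F /G /= chart_mapK ?gK ?chart_invK //; exact: H.
Qed.

(* The chart is indexed by an arbitrary m so that m = dim Y can be eliminated. *)
Lemma tagged_atlasI (Y : mwc R) m (c : chart R m Y) : m = dim Y -> is_chart c ->
  (forall d, atlas Y d ->
     (forall u, chart_dom c u -> chart_img d (chart_map c u) ->
        smooth_at (chart_dom c) (chart_inv d \o chart_map c) u) /\
     (forall u, chart_dom d u -> chart_img c (chart_map d u) ->
        smooth_at (chart_dom d) (chart_inv c \o chart_map d) u)) ->
  @tagged_atlas R Y (existT (fun n => chart R n Y) m c).
Proof.
move=> e Hc H; subst m; exists c => //.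
have [_ _ [HY _] _ mx] := mwcP Y; apply: mx; split=> // d Ad.
by apply/compatibleP => //; [exact: HY|exact: H].
Qed.

Lemma mwc_atlas (X : mwc R) : is_atlas (atlas X).
Proof. by have [_ _ [? ?] ? _] := mwcP X; split. Qed.

Lemma mwc_hausdorff (X : mwc R) : hausdorff_space X.
Proof. by have [] := mwcP X. Qed.

Lemma push_chart_tagged (X Y : mwc R) (f : X -> Y) (g : Y -> X) c :
  weakly_smooth f -> weakly_smooth g -> cancel f g -> cancel g f ->
  atlas X c -> @tagged_atlas R Y (push_chart f (existT (fun n => chart R n X) (dim X) c)).
Proof.
move=> wf wg fK gK Ac; have HX := mwc_atlas X; have HY := mwc_atlas Y.
have Hc := atlas_chart HX Ac; have [kn rel [[_ inj _] cphi _] oi [x [u cu ux]]] := Hc.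
have e := smooth_pair_dim x HX HY wf wg fK gK.
pose c' := Chart (corners c) (chart_dom c) (f \o chart_map c).
have imgE y : chart_img c' y <-> chart_img c (g y).
  split=> [[v cv <-]|[v cv vy]]; first by rewrite /= fK; exact: chart_imgE.
  by exists v => //=; rewrite vy gK.
have inj' : {in chart_dom c' &, injective (chart_map c')}.
  by move=> v w cv cw /= /(can_inj fK) /inj; apply.
have invE y : chart_img c' y -> chart_inv c' y = chart_inv c (g y).
  move=> [v cv <-]; rewrite /chart_inv pinvKV ?inE //= fK.
  by rewrite -/(chart_inv c _) chart_invK.
have oi' : open (chart_img c').
  have -> : chart_img c' = g @^-1` chart_img c by apply/seteqP; split=> y /imgE.
  by apply: open_comp => // y _; exact: wg.1.
have Hc' : is_chart c'.
  split=> //; last by exists (f x); apply/imgE; rewrite fK -ux; exact: chart_imgE.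
  split; first by split=> //; exact: imageP.
    apply/subspace_continuousP => v cv P nP.
    have nP' : \forall y \near chart_map c v, P (f y) by exact: (wf.1 _ _ nP).
    by move/(chart_near _ Hc cv): nP'.
  exists (chart_inv c \o g); split.
    by move=> v; rewrite inE => cv /=; rewrite fK chart_invK.
  apply/subspace_continuousP => y /imgE cy; apply: cvg_within_filter.
  exact: (continuous_comp (wg.1 y) (chart_inv_continuous Hc cy)).
apply: tagged_atlasI => // d Ad; have Hd := atlas_chart HY Ad; split=> v.
  exact: (weakly_smooth_at HX HY wf).
move=> dv cv; have cv' : chart_img c (g (chart_map d v)) by apply/imgE.
apply: smooth_atS (weakly_smooth_at HY HX wg Ad Ac dv cv').
apply: filterS (preimage_near wg.1 Hd Hc dv cv') => w H dw; split=> //=.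
by rewrite invE //; apply/imgE; exact: H.
Qed.

Lemma diffeomorphism_iso (X Y : mwc R) (f : X -> Y) :
  diffeomorphism f -> manifold_iso f.
Proof.
move=> [[wf _] [g [fK gK [wg _]]]]; split.
  split; first split=> //.
  - by move=> x y _ _; exact: (can_inj fK).
  - by move=> y _; exists (g y).
  - exact: continuous_subspaceT wf.1.
  - by exists g; split=> [x _|]; [exact: fK|exact: continuous_subspaceT wg.1].
apply/seteqP; split=> [_ [_ [c Ac <-] <-]|_ [d Ad <-]].
  exact: push_chart_tagged wf wg fK gK Ac.
exists (push_chart g (existT (fun n => chart R n Y) (dim Y) d)).
  exact: push_chart_tagged wg wf gK fK Ad.
rewrite /push_chart /=; congr existT; case: d Ad => k D m Ad /=; congr Chart.
by apply/funext => v /=; rewrite gK.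
Qed.

Lemma iso_smooth (X Y : mwc R) (f : X -> Y) (g : Y -> X) :
  continuous f -> continuous g -> cancel f g -> cancel g f ->
  push_chart f @` @tagged_atlas R X = @tagged_atlas R Y -> smooth_map f /\ smooth_map g.
Proof.
move=> cf cg fK gK fXY; have HX := mwc_atlas X; have HY := mwc_atlas Y.
have hX := @mwc_hausdorff X; have hY := @mwc_hausdorff Y.
have key c : atlas X c -> let s := existT (fun n => chart R n X) (dim X) c in
    forall t, t = push_chart f s ->
    (forall u, chart_dom c u -> [/\ chart_img (projT2 t) (f (chart_map c u)) &
      smooth_in_charts f c (projT2 t) u]) /\
    (forall w, chart_dom (projT2 t) w -> [/\ chart_img c (g (chart_map (projT2 t) w)) &
      smooth_in_charts g (projT2 t) c w]).
  move=> Ac s t ->; have Hc := atlas_chart HX Ac; rewrite /push_chart /=.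
  split=> u cu; split.
  - by exists u.
  - apply: smooth_in_charts_id => // v cv.
    rewrite /chart_inv pinvKV ?inE //= => v1 v2; rewrite !inE => c1 c2.
    by move=> /(can_inj fK) /(chart_map_inj Hc c1 c2).
  - by rewrite /= fK; exact: chart_imgE.
  - by apply: smooth_in_charts_id => // v cv; rewrite /= fK chart_invK.
split; apply: smooth_mapI => // x.
  have [c [u [Ac cu ux]]] := atlas_point HX x.
  have [d Ad dE] : @tagged_atlas R Y (push_chart f (existT (fun n => chart R n X) (dim X) c)).
    by rewrite -fXY; exists (existT (fun n => chart R n X) (dim X) c) => //; exists c.
  have [/(_ u cu) [/= du sd] _] := key c Ac _ dE.
  by exists c, d, u; split=> //; split=> //; rewrite -ux.
have [d [w [Ad dw wx]]] := atlas_point HY x.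
have [s [c Ac cE] sE] : (push_chart f @` @tagged_atlas R X)
    (existT (fun n => chart R n Y) (dim Y) d) by rewrite fXY; exists d.
rewrite -cE in sE.
have [_ /(_ w dw) [/= cw sc]] := key c Ac _ (esym sE).
by exists d, c, w; split=> //; split=> //; rewrite -wx.
Qed.

Lemma iso_diffeomorphism (X Y : mwc R) (f : X -> Y) :
  manifold_iso f -> diffeomorphism f.
Proof.
move=> [[[_ _ surj] cf [g [fK cg]]] fXY].
have {}fK : cancel f g by move=> x; apply: fK; rewrite inE.
have gK : cancel g f.
  by move=> y; have [x _ <-] := surj y I; rewrite fK.
have {}cf : continuous f by exact/continuous_subspace_setT.
have {}cg : continuous g by exact/continuous_subspace_setT.
have [sf sg] := iso_smooth cf cg fK gK fXY.
by split=> //; exists g.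
Qed.

End Isomorphisms.

Section BoundaryInclusion.
Context {R : realType} (X : charted R).
Hypotheses (HX : is_atlas (atlas X)) (hX : hausdorff_space X).

Let HB := is_atlas_boundary HX.
Let hB : hausdorff_space (boundary X) := bdry_hausdorff HX hX.

Lemma facet_atlas c i e : facet_chart c i e -> atlas (boundary X) e.
Proof.
move=> fe; apply: (atlas_sub_max (is_atlas_bdry HX)).
by exists c, i.
Qed.

Lemma bdry_pt_smooth : smooth_map (fun p : boundary X => bdry_pt p : X).
Proof.
apply: smooth_mapI => //; first exact: (bdry_pt_continuous HX).
move=> p; have [c [u [i [e [fe cu ai fp [up eu ep]]]]]] := bdry_facet HX p.
have [Ac ik kE _ Hm] := fe; have Hc := atlas_chart HX Ac; have [_ ui] := ai.
have FE v : chart_dom e v ->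
    chart_inv c (bdry_pt (chart_map e v)) = insert0 i v.
  move=> ev; have [-> _] := Hm v ev; rewrite chart_invK //.
  exact/(facet_domE fe).
exists e, c, (remove i u); split=> //; first exact: facet_atlas fe.
split=> //; first by rewrite -up; exact: chart_imgE.
split.
  apply: smooth_atW (smooth_insert0 i (chart_dom e) (remove i u)) => v ev.
  by rewrite /= FE.
move=> j; rewrite /= FE // removeK // => -[jk uj].
case: (unliftP i j) => [j' jE|jE].
  right; exists j'; first by split; [rewrite kE -(lift_lt _ ik) -jE|rewrite mxE -jE].
  apply: eq_coord_multiple (coord_multiple_coord j' eu); apply: filterE => v ev.
  by rewrite FE // jE insert0_lift.
by left; apply: filterE => v ev; rewrite FE // jE insert0_eq.
Qed.

Lemma bdry_fun_extends (p : boundary X) (a : boundary X -> R) :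
  smooth_fun setT a -> exists h : X -> R, smooth_fun setT h /\
    \forall q \near p, a q = h (bdry_pt (q : bdry X)).
Proof.
move=> sa; have [c [u [i [e [fe cu ai fp [up eu ep]]]]]] := bdry_facet HX p.
have [Ac ik kE _ Hm] := fe; have Hc := atlas_chart HX Ac.
have He := facet_is_chart HX fe.
have [r [Hr _]] := adapted_ex Hc cu (@filterT _ (nbhs (chart_map c u)) _).
have [r0 adr] := Hr; have [N [oN Nu NE]] := image_ball_open Hc cu r0.
pose A y := a (chart_map e (remove i (chart_inv c y))).
have ui : u 0 i = 0 by case: ai.
have eN v : chart_dom c v -> ball u r v -> chart_dom e (remove i v).
  move=> cv bv; apply/(facet_domE fe).
  have b0 : ball u r (insert0 i (remove i v)).
    move/(ball_rVP _ _ r0): bv => bv; apply/ball_rVP => // j.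
    case: (unliftP i j) => [j' ->|->]; first by rewrite insert0_lift mxE.
    by rewrite insert0_eq ui subrr normr0.
  apply/(proj1 (adr _ b0)) => j aj.
  case: (unliftP i j) => [j' jE|->]; last by rewrite insert0_eq.
  rewrite jE insert0_lift mxE -jE; exact: (proj1 (proj1 (adr v bv)) cv).
have sA : smooth_fun N A.
  apply: (smooth_funI HX) => y; rewrite NE => -[v [cv bv] vy]; exists c, v.
  split=> //.
  have sae : smooth_at (chart_dom e) (a \o chart_map e) (remove i v).
    by apply: (smooth_fun_at HB openT sa (facet_atlas fe)) => //; exact: eN.
  have nb : \forall w \near v, chart_dom c w -> chart_dom e (remove i w).
    have : \forall w \near v, ball u r w by exact: near_open (ball_open u r) bv _.
    by apply: filterS => w bw cw; exact: eN.
  have := smooth_at_comp_real cv (smooth_remove i (chart_dom c) v) sae nb.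
  by apply: smooth_atW => w cw; split=> //; rewrite /A /= chart_invK.
have [chi [cchi chi1]] := cutoff_ex HX hX oN Nu.
exists (fun y => chi y * A y); split; first exact: (cutoffM HX oN).
rewrite -ep; apply/(chart_near _ He eu).
have H1 : \forall v \near u, chart_dom c v -> chi (chart_map c v) = 1.
  exact: ((chart_near (fun y => chi y = 1) Hc cu).1 chi1).
have iru : insert0 i (remove i u) = u by rewrite removeK.
have H2 : \forall w \near remove i u, chart_dom c (insert0 i w) ->
    chi (chart_map c (insert0 i w)) = 1.
  rewrite -iru in H1; exact: (@insert0_continuous R _ i (remove i u) _ H1).
apply: filterS H2 => w H2 ew; have cw := (facet_domE fe w).1 ew.
have [qE _] := Hm w ew.
by rewrite qE H2 // mul1r /A chart_invK // insert0K.
Qed.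

Lemma bdry_pt_immersion : immersion (fun p : boundary X => bdry_pt p : X).
Proof.
split; first exact: bdry_pt_smooth.
move=> p D D' HD HD' DD' a sa.
have [h [sh ah]] := bdry_fun_extends p sa.
have sh' : smooth_fun setT (h \o (fun p : boundary X => bdry_pt p : X)).
  have := smooth_fun_comp HB HX (proj1 bdry_pt_smooth) openT sh.
  by rewrite preimage_setT.
rewrite (derivation_germ HB hB openT HD sa sh' ah).
rewrite (derivation_germ HB hB openT HD' sa sh' ah).
exact: DD'.
Qed.

End BoundaryInclusion.

Section Products.
Context {R : realType}.
Variables X Y Z : charted R.
Hypotheses (HX : is_atlas (atlas X)) (HY : is_atlas (atlas Y)) (HZ : is_atlas (atlas Z)).
Hypotheses (hX : hausdorff_space X) (hY : hausdorff_space Y) (hZ : hausdorff_space Z).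

Lemma fst_smooth : smooth_map (fun p : product X Y => p.1 : X).
Proof.
apply: smooth_mapI => //.
- exact: is_atlas_product.
- exact: product_hausdorff.
- by move=> p; exact: cvg_fst.
move=> [x y]; have [c [u [Ac cu ux]]] := atlas_point HX x.
have [d [w [Ad dw wy]]] := atlas_point HY y.
have Hc := atlas_chart HX Ac; have Hd := atlas_chart HY Ad.
have [kc _ _ _ _] := Hc; have [kd _ _ _ _] := Hd.
pose t := @join_rV R _ _ (corners c) (corners d) u w.
have tP : chart_dom (prod_chart c d) t by rewrite /= split_fst_join // split_snd_join.
exists (prod_chart c d), c, t; split=> //; first exact: prod_chart_atlas.
split.
- by rewrite /= split_fst_join // split_snd_join // ux wy.
- by rewrite -ux; exact: chart_imgE.
have FE v : chart_dom (prod_chart c d) v ->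
    chart_inv c (chart_map (prod_chart c d) v).1 = split_fst (corners c) (corners d) v.
  by move=> [cv dv]; rewrite /= chart_invK.
split.
  apply: smooth_atW (@smooth_split_fst R _ _ (corners c) (corners d) _ t) => v Pv.
  by rewrite /comp FE.
move=> j; rewrite [_ t]FE // => -[jk tj]; right.
have jl : (j < dim X + dim Y)%N by lia.
have cE v : split_fst (corners c) (corners d) v 0 j = (v : 'rV[R]_(dim X + dim Y)) 0 (Ordinal jl).
  by rewrite mxE jk -coord_ord.
exists (Ordinal jl); first by split; [rewrite /=; lia|rewrite -cE].
apply: eq_coord_multiple (coord_multiple_coord (Ordinal jl) tP).
by apply: filterE => v Pv; rewrite -cE -FE.
Qed.

Lemma snd_smooth : smooth_map (fun p : product X Y => p.2 : Y).
Proof.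
apply: smooth_mapI => //.
- exact: is_atlas_product.
- exact: product_hausdorff.
- by move=> p; exact: cvg_snd.
move=> [x y]; have [c [u [Ac cu ux]]] := atlas_point HX x.
have [d [w [Ad dw wy]]] := atlas_point HY y.
have Hc := atlas_chart HX Ac; have Hd := atlas_chart HY Ad.
have [kc _ _ _ _] := Hc; have [kd _ _ _ _] := Hd.
pose t := @join_rV R _ _ (corners c) (corners d) u w.
have tP : chart_dom (prod_chart c d) t by rewrite /= split_fst_join // split_snd_join.
exists (prod_chart c d), d, t; split=> //; first exact: prod_chart_atlas.
split.
- by rewrite /= split_fst_join // split_snd_join // ux wy.
- by rewrite -wy; exact: chart_imgE.
have FE v : chart_dom (prod_chart c d) v ->
    chart_inv d (chart_map (prod_chart c d) v).2 = split_snd (corners c) (corners d) v.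
  by move=> [cv dv]; rewrite /= chart_invK.
split.
  apply: smooth_atW (@smooth_split_snd R _ _ (corners c) (corners d) _ t) => v Pv.
  by rewrite /comp FE.
move=> j; rewrite [_ t]FE // => -[jk tj]; right.
have jl : (corners c + j < dim X + dim Y)%N by lia.
have cE v : split_snd (corners c) (corners d) v 0 j = (v : 'rV[R]_(dim X + dim Y)) 0 (Ordinal jl).
  by rewrite mxE jk -coord_ord.
exists (Ordinal jl); first by split; [rewrite /=; lia|rewrite -cE].
apply: eq_coord_multiple (coord_multiple_coord (Ordinal jl) tP).
by apply: filterE => v Pv; rewrite -cE -FE.
Qed.

Lemma pair_smooth (f : X -> Y) (g : X -> Z) : smooth_map f -> smooth_map g ->
  smooth_map (fun x : X => (f x, g x) : product Y Z).
Proof.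
move=> sf sg; have cf := sf.1.1; have cg := sg.1.1.
have cfg : continuous (fun x : X => (f x, g x) : product Y Z).
  move=> x P [[A B] /= [nA nB] AB].
  have nA' : \forall z \near x, A (f z) by exact: cf.
  have nB' : \forall z \near x, B (g z) by exact: cg.
  suff : \forall z \near x, P (f z, g z) by [].
  by apply: filterS2 nA' nB' => z Az Bz; apply: AB.
apply: smooth_mapI => //.
- exact: is_atlas_product.
- exact: product_hausdorff.
move=> x; have [c [u [Ac cu ux]]] := atlas_point HX x.
have [d [w [Ad dw wy]]] := atlas_point HY (f x).
have [e [t [Ae et tz]]] := atlas_point HZ (g x).
have Hc := atlas_chart HX Ac; have Hd := atlas_chart HY Ad.
have He := atlas_chart HZ Ae.
have [kd _ _ _ _] := Hd; have [ke _ _ _ _] := He.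
have df : chart_img d (f (chart_map c u)) by rewrite ux -wy; exact: chart_imgE.
have eg : chart_img e (g (chart_map c u)) by rewrite ux -tz; exact: chart_imgE.
have [sF cF] := smooth_map_charts HX HY hX sf Ac Ad cu df.
have [sG cG] := smooth_map_charts HX HZ hX sg Ac Ae cu eg.
set F := _ \o _ in sF cF; set G := _ \o _ in sG cG.
have nF := preimage_near cf Hc Hd cu df; have nG := preimage_near cg Hc He cu eg.
exists c, (prod_chart d e), u; split=> //; first exact: prod_chart_atlas.
split=> //.
  by apply/prod_chart_img => //; rewrite -ux.
pose J v := @join_rV R _ _ (corners d) (corners e) (F v) (G v).
have JE : \forall v \near u, chart_dom c v ->
    chart_inv (prod_chart d e) (f (chart_map c v), g (chart_map c v)) = J v.
  apply: filterS2 nF nG => v Fv Gv cv.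
  rewrite (prod_chart_invE Hd He) //; apply/prod_chart_img => //.
  by split; [exact: Fv|exact: Gv].
split.
  apply: smooth_atS (@smooth_join R _ _ (corners d) (corners e) _ _ _ _ _ sF sG).
  by apply: filterS JE => v Jv cv; split=> //; rewrite /= Jv.
move=> l; rewrite [_ u](nbhs_singleton JE) // => -[/= lk ul].
case: (ltnP l (corners d)) => ld.
  have lY : (l < dim Y)%N by lia.
  have jE v : J v 0 l = F v 0 (Ordinal lY) by rewrite mxE /join_coord ld -coord_ord.
  have al : active d (F u) (Ordinal lY) by split=> //; rewrite -jE.
  case: (cF _ al) => [F0|[i ai cmi]]; [left|right; exists i => //].
    by apply: filterS2 JE F0 => v Jv F0 cv; have := F0 cv; rewrite -jE -Jv.
  by apply: eq_coord_multiple cmi; apply: filterS JE => v Jv cv; rewrite -jE -Jv.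
have le : (l < corners d + corners e)%N by [].
have lZ : (l - corners d < dim Z)%N by lia.
have jE v : J v 0 l = G v 0 (Ordinal lZ).
  by rewrite mxE /join_coord ltnNge ld /= le -coord_ord.
have al : active e (G u) (Ordinal lZ) by split; [rewrite /=; lia|rewrite -jE].
case: (cG _ al) => [G0|[i ai cmi]]; [left|right; exists i => //].
  by apply: filterS2 JE G0 => v Jv G0 cv; have := G0 cv; rewrite -jE -Jv.
by apply: eq_coord_multiple cmi; apply: filterS JE => v Jv cv; rewrite -jE -Jv.
Qed.

End Products.

Section Point.
Context {R : realType}.
Local Notation pt := (@point_manifold R).

Lemma point_is_atlas : is_atlas (atlas pt).
Proof.
apply: is_atlas_max; pose c0 : chart R 0 'rV[R]_0 := Chart 0%N setT id.
have img0 : chart_img c0 = setT by rewrite /chart_img image_id.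
have H0 : is_chart c0.
  split=> //.
  - by exists setT; [exact: openT|apply/seteqP; split].
  - split; first by rewrite img0; split=> //; exact: imageP.
      by apply: continuous_subspaceT => x; exact: cvg_id.
    by exists id; split=> //; apply: continuous_subspaceT => x; exact: cvg_id.
  - by rewrite img0; exact: openT.
  - by rewrite img0; exists 0.
split=> [c ->|c d -> ->|] //.
  apply/compatibleP => //; suff : smooth_transition c0 c0 by [].
  move=> u _ _; apply: smooth_atW (smooth_at_id setT u) => v _.
  by rewrite /= (chart_invK H0).
by rewrite bigcup_set1 img0.
Qed.

Lemma point_eq0 (v : 'rV[R]_0) : v = 0.
Proof. by apply/rowP => -[]. Qed.

Lemma point_hausdorff : hausdorff_space pt.
Proof. by move=> p q _; rewrite (point_eq0 p) (point_eq0 q). Qed.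

Lemma to_point_smooth (X : charted R) : is_atlas (atlas X) -> hausdorff_space X ->
  forall p : X -> pt, p = (fun=> 0) /\ smooth_map p.
Proof.
move=> HX hX p; have pE : p = (fun=> 0) by apply/funext => x; exact: point_eq0.
split=> //; have Hp := point_is_atlas; have hp := point_hausdorff.
apply: smooth_mapI => //; first by rewrite pE => x; exact: cvg_cst.
move=> x; have [c [u [Ac cu ux]]] := atlas_point HX x.
have [d [w [Ad dw wp]]] := atlas_point Hp (p x).
exists c, d, u; split=> //; split=> //; first by rewrite -wp; exact: chart_imgE.
split; last by case.
apply: smooth_atW (smooth_at_cst (chart_dom c) (0 : 'rV[R]_0) u) => v cv; split=> //.
exact: (esym (point_eq0 _)).
Qed.

End Point.

Lemma from_empty_smooth (R : realType) (X : charted R) n (e : empty_manifold n -> X) :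
  e = @of_void X /\ smooth_map e.
Proof.
split; first by apply/funext; case.
split; last by case.
by split=> [[]|c d []].
Qed.

Theorem theorem3p4 (R : realType) (W X Y Z : mwc R) :
  (forall (f : X -> Y) (g : Y -> Z),
     smooth_map f -> smooth_map g -> smooth_map (fun x => g (f x))) /\
  smooth_map (fun x : X => x) /\
  (forall f : X -> Y, diffeomorphism f <-> manifold_iso f) /\
  immersion (fun p : boundary X => bdry_pt p : X) /\
  (forall (f : W -> Y) (g : X -> Z),
     smooth_map f -> smooth_map g ->
     smooth_map (fun p : product W X => (f p.1, g p.2) : product Y Z)) /\
  (forall (f : X -> Y) (g : X -> Z),
     smooth_map f -> smooth_map g ->
     smooth_map (fun x : X => (f x, g x) : product Y Z)) /\
  (forall (n : nat) (e : empty_manifold n -> X), e = @of_void X /\ smooth_map e) /\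
  (forall p : X -> point_manifold, p = (fun=> 0%R) /\ smooth_map p).
Proof.
have HW := mwc_atlas W; have HX := mwc_atlas X; have HY := mwc_atlas Y.
have HZ := mwc_atlas Z; have hW := @mwc_hausdorff R W; have hX := @mwc_hausdorff R X.
have hY := @mwc_hausdorff R Y; have hZ := @mwc_hausdorff R Z.
split; [|split; [|split; [|split; [|split; [|split; [|split]]]]]].
- by move=> f g; exact: smooth_map_comp.
- exact: smooth_map_id.
- by move=> f; split; [exact: diffeomorphism_iso|exact: iso_diffeomorphism].
- exact: bdry_pt_immersion.
- move=> f g sf sg; have HWX := is_atlas_product HW HX.
  have hWX : hausdorff_space (product W X) by exact: product_hausdorff.
  have sfst := fst_smooth HW HX hW hX; have ssnd := snd_smooth HW HX hW hX.
  apply: (@pair_smooth R (product W X) Y Z) => //.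
    exact: (@smooth_map_comp R (product W X) W Y _ f).
  exact: (@smooth_map_comp R (product W X) X Z _ g).
- by move=> f g; exact: pair_smooth.
- by move=> n e; exact: from_empty_smooth.
- exact: to_point_smooth.
Qed.
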